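(* Let $X,X_1,X_2,\ldots$ be i.i.d. non-negative, non-lattice random variables with mean $\nu$ and with moment-generating function $M_X(\vartheta)=\mathbb{E}[e^{\vartheta X}]$ finite for all $\vartheta$ in an open set containing $0$. Let $a>\nu$, let $\Lambda_X:=\log M_X$ and $$I_X(a):=\sup_{\vartheta\in\mathbb{R}}\{\vartheta a-\Lambda_X(\vartheta)\},$$ and assume that the supremum is attained at some $\vartheta_X^\star$ in the interior of $\{\vartheta: M_X(\vartheta)<\infty\}$. Put $$C_X(a):=\frac{1}{\vartheta_X^\star\sqrt{2\pi\Lambda_X''(\vartheta_X^\star)}}.$$ Assume $b_+:=\sup\{b:\mathbb{P}(X>b)>0\}>a$. For $\alpha>0$ let $$P_N(a):=\mathbb{P}\left(\mathrm{Pois}\left(N\,\overline{X}_{N^\alpha}\right)\geqslant Na\right),$$ where $N\to\infty$ through values for which $Na$ and $N^\alpha$ are integers. Then: (i) if $0<\alpha<\frac13$, then, as $N\to\infty$, $$P_N(a)\sim e^{-N^\alpha I_X(a)}\,\frac{C_X(a)}{N^{\alpha/2}};$$ (ii) if $\alpha\in[\frac13,\frac12)$, then $$\liminf_{N\to\infty}P_N(a)\,e^{N^\alpha I_X(a)}\,N^{\alpha/2}\geqslant C_X(a).$$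
   Context: For a positive integer $m$, $\overline{X}_m:=\frac1m\sum_{i=1}^m X_i$. For a non-negative random variable $Y$, $\mathrm{Pois}(Y)$ denotes a mixed Poisson random variable: conditionally on $Y=y$ it has the Poisson distribution with mean $y$. The notation $f(N)\sim g(N)$ means $f(N)/g(N)\to1$ as $N\to\infty$. The limit in $N$ is taken along values for which $Na$ and $N^\alpha$ are positive integers. $b_+$ may equal $+\infty$. *)

(* Defs.v *)
From HB Require Import structures.
From mathcomp Require Import all_boot all_order all_algebra.
From mathcomp Require Import finmap.
From mathcomp Require Import all_classical all_reals all_analysis.

Set Implicit Arguments.
Unset Strict Implicit.
Unset Printing Implicit Defensive.

Import Order.TTheory GRing.Theory Num.Theory.
Import numFieldNormedType.Exports.

Local Open Scope classical_set_scope.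
Local Open Scope ring_scope.

Section Definitions.
Context (d : measure_display) (T : measurableType d) (R : realType)
  (P : probability T R).

Definition mutually_independent (X : nat -> {RV P >-> R}) : Prop :=
  forall (J : {fset nat}) (B : nat -> set R),
    (forall j, j \in J -> measurable (B j)) ->
    P (\bigcap_(j in [set` J]) (X j @^-1` B j)) =
      (\prod_(j <- J) P (X j @^-1` B j))%E.

Definition identically_distributed (X : nat -> {RV P >-> R}) : Prop :=
  forall (i j : nat) (B : set R), measurable B ->
    distribution P (X i) B = distribution P (X j) B.

Definition iid (X : nat -> {RV P >-> R}) : Prop :=
  mutually_independent X /\ identically_distributed X.

(* Lattice in the sense of large deviations: the span may be shifted, so that
   a.s. constant variables are lattice too. *)
Definition lattice (X : {RV P >-> R}) : Prop :=
  exists c h : R, 0 < h /\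
    P [set w | exists k : int, X w = c + k%:~R * h] = 1%E.

(* Indices start at 1: the 0-th variable of a sequence is the generic copy. *)
Definition sample_mean (X : nat -> {RV P >-> R}) (m : nat) (w : T) : R :=
  m%:R^-1 * \sum_(1 <= i < m.+1) X i w.

(* Z is Pois(Y): the regular conditional law of Z given Y = y is Poisson with
   mean y (the point mass at 0 when y = 0).  The argument 0 of poisson_prob is
   a dummy that the library's definition ignores. *)
Definition mixed_poisson (Y : T -> R) (Z : {RV P >-> nat}) : Prop :=
  forall (B : set R) (A : set nat), measurable B ->
    P ((Y @^-1` B) `&` (Z @^-1` A)) =
      (\int[P]_(w in Y @^-1` B) poisson_prob (Y w) 0 A)%E.

Definition log_mgf (X : {RV P >-> R}) (t : R) : \bar R := lne ('M_P X t).

Definition rate_function (X : {RV P >-> R}) (a : R) : \bar R :=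
  ereal_sup [set ((t * a)%:E - log_mgf X t)%E | t in [set: R]].

Definition prefactor (X : {RV P >-> R}) (t : R) : R :=
  1 / (t * Num.sqrt (2 * pi * derive1n 2 (fun s : R => fine (log_mgf X s)) t)).

Definition ess_supremum (X : {RV P >-> R}) : \bar R :=
  ereal_sup [set b%:E | b in [set b : R | (0 < P [set w | b < X w]%R)%E]].

End Definitions.

Definition admissible (R : realType) (a alpha : R) : set R :=
  [set N | [/\ 0 < N, 0 < N * a, N * a \is a Num.nat
             & N `^ alpha \is a Num.nat]].

Definition to_infinity (R : realType) (a alpha : R) : set_system R :=
  within (admissible a alpha) (pinfty_nbhs R).

Definition asymp_equiv (R : realType) (F : set_system R) (f g : R -> R) : Prop :=
  (fun N => f N / g N) @ F --> (1 : R).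

(* Main.v *)
Require Import Defs.
From HB Require Import structures.
From mathcomp Require Import all_boot all_order all_algebra.
From mathcomp Require Import finmap.
From mathcomp Require Import all_classical all_reals all_analysis.
From mathcomp Require Import measurable_realfun ring lra.
Import Order.TTheory GRing.Theory Num.Theory.
Import numFieldNormedType.Exports HBNNSimple.
Set Implicit Arguments.
Unset Strict Implicit.
Unset Printing Implicit Defensive.
Local Open Scope classical_set_scope.
Local Open Scope ring_scope.

(* Let W_m be the sum of m independent copies of X - a, and Q_m its law tilted
   by exp (theta x + m I).  Conditioning on the X_i gives
     P_N e^(m I) sqrt m =
       sqrt m * int e^(- theta x) P(Pois(N (a + x / m)) >= N a) dQ_m(x),
   with m = N^alpha.  Chernoff bounds show that, as soon as N / m^2 is large,
   the integrand is squeezed between exponentials cut off at +-eta, up to an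
   error eps / (1 + x^2).  Since alpha < 1/2 gives N / m^2 -> oo, this single
   estimate yields both parts.

   The tilted step law q is centred, with variance Lambda''(theta) and, X being
   non-lattice, a characteristic function of modulus < 1 away from 0.  Fourier
   inversion against the Fejer kernel, whose transform has compact support,
   then shows that sqrt m * Q_m integrates every translate of the scaled kernel
   to (2 pi Lambda''(theta))^(-1/2) in the limit; smoothing transfers this local
   limit to the cut-off exponentials, whose integrals are close to 1 / theta. *)

(** The obstacle is that [sqrt m * Q_m] has total mass [sqrt m], so an error that is merely small
    uniformly in [x] says nothing after integration. Every error term has to be either a fraction of
    the main term or carry the weight [1 / (1 + x^2)], whose integrals against [sqrt m * Q_m] stay
    bounded. Being non-lattice keeps the characteristic function away from modulus 1 only on compact
    sets of frequencies that avoid 0; nothing is known at infinity. This is why test functions with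
    compactly supported transform come first and the discontinuous cut-off exponentials are reached
    from them by inequalities. The scale [N / m^2] comes from comparing two relative sizes: a value
    [x] of [W_m] moves the Poisson rate by the fraction [x / (m a)], while the Poisson variable
    fluctuates by a fraction of order [(N a)^(-1/2)]. In the central estimate [m] and [N] are
    independent variables linked only by [B m^2 <= N]; the relation [m = N^alpha] enters in the last
    proof alone. *)

Section elementary_inequalities.
Context {R : realType}.
Implicit Types x y : R.

(** Mean value theorem. The Taylor bounds for sine and cosine climb by it one degree at a time: the
    derivative of each difference is the difference handled just before. *)
Lemma ge0_of_derive_ge0 (f df : R -> R) x : f 0 = 0 ->
  (forall y, is_derive y 1 f (df y)) -> (forall y, 0 <= y -> 0 <= df y) ->
  0 <= x -> 0 <= f x.
Proof.
move=> f0 fdf df0 x0.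
have cf : {within `[0, x], continuous f}.
  apply: derivable_within_continuous => y _; exact: ex_derive.
have [c + fE] := MVT_segment x0 (fun y _ => fdf y) cf.
rewrite in_itv/= => /andP[c0 _].
by move: fE; rewrite f0 !subr0 => ->; rewrite mulr_ge0// df0.
Qed.

Lemma sin_le x : 0 <= x -> sin x <= x.
Proof.
move=> x0; rewrite -subr_ge0.
apply: (@ge0_of_derive_ge0 (fun y => y - sin y) (fun y => 1 - cos y)) => //.
by rewrite sin0 subr0.
Qed.

Lemma cos_ge_quad x : 1 - x ^+ 2 / 2 <= cos x.
Proof.
wlog x0 : x / 0 <= x.
  move=> h; have [/h//|/ltW x0] := leP 0 x.
  by rewrite -cosN -sqrrN h// oppr_ge0.
rewrite -subr_ge0.
apply: (@ge0_of_derive_ge0 (fun y => cos y - (1 - y ^+ 2 / 2)) (fun y => y - sin y)) => //.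
- by rewrite cos0 expr0n/= mul0r subr0 subrr.
- move=> y; apply: is_derive_eq.
  by rewrite /GRing.scale/=; field.
- by move=> y y0; rewrite subr_ge0 sin_le.
Qed.

Lemma sin_ge_cubic x : 0 <= x -> x - x ^+ 3 / 6 <= sin x.
Proof.
move=> x0; rewrite -subr_ge0.
apply: (@ge0_of_derive_ge0 (fun y => sin y - (y - y ^+ 3 / 6))
  (fun y => cos y - (1 - y ^+ 2 / 2))) => //.
- by rewrite sin0 expr0n/= mul0r !subr0.
- move=> y; apply: is_derive_eq.
  by rewrite /GRing.scale/=; field.
- by move=> y y0; rewrite subr_ge0 cos_ge_quad.
Qed.

Lemma cos_le_quartic x : cos x <= 1 - x ^+ 2 / 2 + x ^+ 4 / 24.
Proof.
wlog x0 : x / 0 <= x.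
  move=> h; have [/h//|/ltW x0] := leP 0 x.
  have -> : 1 - x ^+ 2 / 2 + x ^+ 4 / 24 = 1 - (- x) ^+ 2 / 2 + (- x) ^+ 4 / 24 by ring.
  by rewrite -cosN h// oppr_ge0.
rewrite -subr_ge0.
apply: (@ge0_of_derive_ge0 (fun y => 1 - y ^+ 2 / 2 + y ^+ 4 / 24 - cos y)
  (fun y => sin y - (y - y ^+ 3 / 6))) => //.
- by rewrite cos0 !expr0n/= !mul0r subr0 addr0 subrr.
- move=> y; apply: is_derive_eq.
  by rewrite /GRing.scale/=; field.
- by move=> y y0; rewrite subr_ge0 sin_ge_cubic.
Qed.

Lemma normr_sin_le x : `|sin x| <= `|x|.
Proof.
wlog x0 : x / 0 <= x.
  move=> h; have [/h//|/ltW x0] := leP 0 x.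
  by rewrite -[leLHS]normrN -sinN -[leRHS]normrN h// oppr_ge0.
rewrite (ger0_norm x0) ler_norml sin_le// andbT lerNl -sinN.
(* What remains is [- sin x <= x]: up to [pi] the sine is nonnegative, and beyond it [x] exceeds 2,
   hence 1. *)
have [xp|px] := leP x pi.
  by rewrite sinN (le_trans _ x0)// oppr_le0 sin_ge0_pi// x0.
rewrite (le_trans (sin_le1 _))// (le_trans _ (ltW px))// (le_trans _ (pi_ge2 _))//.
by rewrite ler1n.
Qed.

Lemma normr_sin_sub_le x : `|sin x - x| <= `|x| ^+ 3 / 6.
Proof.
wlog x0 : x / 0 <= x.
  move=> h; have [/h//|/ltW x0] := leP 0 x.
  have -> : sin x - x = - (sin (- x) - - x) by rewrite sinN; ring.
  by rewrite normrN -[in leRHS]normrN h// oppr_ge0.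
rewrite (ger0_norm x0) ler_norml.
have := sin_le x0; have := sin_ge_cubic x0; have : 0 <= x ^+ 3 by rewrite exprn_ge0.
by lra.
Qed.

Lemma normr_cosB_le x y : `|cos x - cos y| <= `|x - y|.
Proof.
have -> : cos x - cos y = - (2 * (sin ((x + y) / 2) * sin ((x - y) / 2))).
  have xE : x = (x + y) / 2 + (x - y) / 2 by field.
  have yE : y = (x + y) / 2 - (x - y) / 2 by field.
  by rewrite [in cos x]xE [in cos y]yE cosD cosB; ring.
rewrite normrN normrM (ger0_norm (ler0n _ 2)) normrM.
rewrite (@le_trans _ _ (2 * (1 * `|(x - y) / 2|)))//.
  by rewrite ler_pM2l// ler_pM// ?sin_max// normr_sin_le.
by rewrite mul1r normrM (ger0_norm (_ : 0 <= 2^-1 :> R))// mulrCA divff// mulr1.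
Qed.

Lemma normr_sinB_le x y : `|sin x - sin y| <= `|x - y|.
Proof.
rewrite -!cosBpihalf (le_trans (normr_cosB_le _ _))//.
by rewrite opprD addrACA subrr addr0.
Qed.

(** Serves to turn equality in [|cf| <= 1] into lattice values. The remainder [y] of [x] modulo
    [2 pi] is 0 by injectivity of cosine on [[0, pi]]; if it lay above [pi], the same injectivity
    applied to [y - pi] would give [y = 2 pi]. *)
Lemma cos_eq1 x : cos x = 1 -> exists k : int, x = k%:~R * (pi *+ 2).
Proof.
move=> cx1; have p2 : 0 < pi *+ 2 :> R by rewrite pmulrn_lgt0// pi_gt0.
exists (Num.floor (x / (pi *+ 2))); set k := Num.floor _.
have /andP[] := floor_itv (x / (pi *+ 2)).
rewrite -/k ler_pdivlMr// ltr_pdivrMr// => k1 k2.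
pose y := x - k%:~R * (pi *+ 2).
have cyx : cos y = 1.
  rewrite -cx1; case: (k) @y => n y.
    have -> : x = y + (pi *+ 2) *+ n by rewrite -[_ *+ n]mulr_natl /y subrK.
    by rewrite (periodicn (@cosD2pi R)).
  have -> : y = x + (pi *+ 2) *+ n.+1 by rewrite -[_ *+ n.+1]mulr_natl /y NegzE mulrNz mulNr opprK.
  by rewrite (periodicn (@cosD2pi R)).
have y0 : 0 <= y by rewrite subr_ge0.
have y2 : y < pi *+ 2 by rewrite ltrBlDr addrC; move: k2; rewrite intrD mulrDl mul1r.
apply/eqP; rewrite -subr_eq0 -/y; apply/eqP.
have [yp|py] := leP y pi.
  by apply: cos_inj; rewrite ?in_itv/= ?y0 ?lexx ?pi_ge0// cos0.
have : y - pi = pi.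
  apply: cos_inj; rewrite ?in_itv/= ?lexx ?pi_ge0//.
    by rewrite subr_ge0 (ltW py) lerBlDr -mulr2n ltW.
  by rewrite cosB cospi sinpi cyx mulr0 addr0 mul1r.
by move=> /eqP; rewrite subr_eq -mulr2n => /eqP yE; rewrite yE ltxx in y2.
Qed.

Lemma expRN_quad x : 0 <= x -> `|expR (- x) - (1 - x)| <= x ^+ 2 / 2.
Proof.
move=> x0; rewrite ger0_norm ?subr_ge0 ?expR_ge1Dx// -subr_ge0.
apply: (@ge0_of_derive_ge0 (fun y => y ^+ 2 / 2 - (expR (- y) - (1 - y)))
  (fun y => expR (- y) - (1 + - y))) => //.
- by rewrite oppr0 expR0 expr0n/= mul0r addr0 subrr oppr0 addr0.
- move=> y; apply: is_derive_eq.
  by rewrite /GRing.scale/=; field.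
- by move=> y y0; rewrite subr_ge0 expR_ge1Dx.
Qed.

(** Apply [ln s <= s - 1] to [s = sqrt x]. The right-hand side is the Chernoff exponent of a Poisson
    variable per unit of rate; the left-hand side is a form of it without logarithm, valid on both
    sides of 1. *)
Lemma ln_le_entropy x : 0 < x -> (Num.sqrt x - 1) ^+ 2 <= x - 1 - ln x.
Proof.
move=> x0; have sx0 : 0 < Num.sqrt x by rewrite sqrtr_gt0.
have lnx : ln x = 2 * ln (Num.sqrt x).
  by rewrite -{1}(sqr_sqrtr (ltW x0)) lnXn// mulr_natl.
have : ln (Num.sqrt x) <= Num.sqrt x - 1.
  by rewrite -[X in ln X](subrKC 1) le_ln1Dx// ltrBrDl subrr.
have := sqr_sqrtr (ltW x0).
by rewrite lnx; nra.
Qed.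

End elementary_inequalities.

(** * Tonelli and Fubini on measurable rectangles *)

Section iterated_integrals.
Context d1 d2 (T1 : measurableType d1) (T2 : measurableType d2) (R : realType).
Variables (m1 : {sigma_finite_measure set T1 -> \bar R})
  (m2 : {sigma_finite_measure set T2 -> \bar R}).
Variables (A : set T1) (B : set T2).
Hypotheses (mA : measurable A) (mB : measurable B).

(** Here and in the next two lemmas the indicators of the sets are moved into the integrand, so that
    sign or size conditions are required only on the sets and the whole-space theorems apply. *)
Lemma measurable_integral_on (f : T1 -> T2 -> R) :
  measurable_fun [set: T1 * T2] (fun z => f z.1 z.2) ->
  (forall x y, B y -> 0 <= f x y) ->
  measurable_fun [set: T1] (fun x => \int[m2]_(y in B) (f x y)%:E)%E.
Proof.
move=> mf f0.
pose g (z : T1 * T2) := (f z.1 z.2 * \1_B z.2)%:E.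
have -> : (fun x => \int[m2]_(y in B) (f x y)%:E)%E = fubini_F m2 g.
  apply/funext => x; rewrite integral_mkcond; apply: eq_integral => y _.
  by rewrite patchE /g/= indicE; case: ifPn => _; rewrite ?mulr1 ?mulr0.
apply: measurable_fun_fubini_tonelli_F.
  by apply/measurable_EFinP; apply: measurable_funM => //; exact: measurableT_comp.
move=> [x y]; rewrite /g/= lee_fin indicE.
have [/set_mem yB|] := boolP (y \in B); last by rewrite mulr0.
by rewrite mulr1 f0.
Qed.

Lemma tonelli_on (f : T1 -> T2 -> R) :
  measurable_fun [set: T1 * T2] (fun z => f z.1 z.2) ->
  (forall x y, A x -> B y -> 0 <= f x y) ->
  (\int[m1]_(x in A) \int[m2]_(y in B) (f x y)%:E =
   \int[m2]_(y in B) \int[m1]_(x in A) (f x y)%:E)%E.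
Proof.
move=> mf f0.
pose g (z : T1 * T2) := (f z.1 z.2 * \1_A z.1 * \1_B z.2)%:E.
have -> : (\int[m1]_(x in A) \int[m2]_(y in B) (f x y)%:E =
    \int[m1]_x \int[m2]_y g (x, y))%E.
  rewrite integral_mkcond; apply: eq_integral => x _; rewrite patchE.
  case: ifPn => xA.
    rewrite integral_mkcond; apply: eq_integral => y _.
    by rewrite patchE /g/= !indicE xA mulr1; case: ifPn => _; rewrite ?mulr1 ?mulr0.
  rewrite integral0_eq// => y _.
  by rewrite /g/= indicE (negbTE xA) mulr0 mul0r.
have -> : (\int[m2]_(y in B) \int[m1]_(x in A) (f x y)%:E =
    \int[m2]_y \int[m1]_x g (x, y))%E.
  rewrite integral_mkcond; apply: eq_integral => y _; rewrite patchE.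
  case: ifPn => yB.
    rewrite integral_mkcond; apply: eq_integral => x _.
    by rewrite patchE /g/= !indicE yB mulr1; case: ifPn => _; rewrite ?mulr1 ?mulr0.
  rewrite integral0_eq// => x _.
  by rewrite /g/= !indicE (negbTE yB) mulr0.
apply: fubini_tonelli.
- apply/measurable_EFinP; apply: measurable_funM.
    by apply: measurable_funM => //; exact: measurableT_comp.
  exact: measurableT_comp.
- move=> [x y]; rewrite /g/= lee_fin !indicE.
  have [/set_mem xA|] := boolP (x \in A); last by rewrite mulr0 mul0r.
  have [/set_mem yB|] := boolP (y \in B); last by rewrite mulr0.
  by rewrite !mulr1 f0.
Qed.

Hypotheses (Afin : (m1 A < +oo)%E) (Bfin : (m2 B < +oo)%E).

Lemma fubini_bounded_on (f : T1 -> T2 -> R) (M : R) :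
  measurable_fun [set: T1 * T2] (fun z => f z.1 z.2) ->
  (forall x y, A x -> B y -> `|f x y| <= M) ->
  \int[m1]_(x in A) \int[m2]_(y in B) f x y =
  \int[m2]_(y in B) \int[m1]_(x in A) f x y.
Proof.
move=> mf fM.
have mfx x : measurable_fun [set: T2] (f x).
  exact: (measurableT_comp mf (measurable_pair1 x)).
have mfy y : measurable_fun [set: T1] (f ^~ y).
  exact: (measurableT_comp mf (measurable_pair2 y)).
have bnd T (g : T -> R) (D : set T) : (forall x, D x -> `|g x| <= M) ->
    [bounded g x | x in D].
  move=> gM; exists M; split; first exact: num_real.
  by move=> N MN x Dx; rewrite /= (le_trans (gM x Dx))// ltW.
have ix x : A x -> m2.-integrable B (EFin \o f x).
  move=> Ax.
  apply: measurable_bounded_integrable => //; first exact: measurable_funTS.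
  by apply: bnd => y; exact: fM.
have iy y : B y -> m1.-integrable A (EFin \o f ^~ y).
  move=> By.
  apply: measurable_bounded_integrable => //; first exact: measurable_funTS.
  by apply: bnd => x Ax; exact: fM.
pose g (z : T1 * T2) := (f z.1 z.2 * \1_A z.1 * \1_B z.2)%:E.
have mg : measurable_fun setT g.
  apply/measurable_EFinP; apply: measurable_funM.
    by apply: measurable_funM => //; exact: measurableT_comp.
  exact: measurableT_comp.
have gx x : (\int[m2]_y g (x, y) =
    ((fun x => \int[m2]_(y in B) f x y)%R \_ A x)%:E)%E.
  rewrite patchE; case: ifPn => xA.
    rewrite /Rintegral fineK; last exact: (integrable_fin_num _ (ix x (set_mem xA))).
    rewrite [RHS]integral_mkcond; apply: eq_integral => y _.
    by rewrite patchE /g/= !indicE xA mulr1; case: ifPn => _; rewrite ?mulr1 ?mulr0.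
  rewrite integral0_eq// => y _.
  by rewrite /g/= indicE (negbTE xA) mulr0 mul0r.
have gy y : (\int[m1]_x g (x, y) =
    ((fun y => \int[m1]_(x in A) f x y)%R \_ B y)%:E)%E.
  rewrite patchE; case: ifPn => yB.
    rewrite /Rintegral fineK; last exact: (integrable_fin_num _ (iy y (set_mem yB))).
    rewrite [RHS]integral_mkcond; apply: eq_integral => x _.
    by rewrite patchE /g/= !indicE yB mulr1; case: ifPn => _; rewrite ?mulr1 ?mulr0.
  rewrite integral0_eq// => x _.
  by rewrite /g/= !indicE (negbTE yB) mulr0.
rewrite [LHS]Rintegral_mkcond [RHS]Rintegral_mkcond; congr fine.
under eq_integral do rewrite -gx; under [RHS]eq_integral do rewrite -gy.
apply: Fubini.
have mAB : measurable (A `*` B) by exact: measurableX.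
apply: (@le_integrable _ _ _ _ _ measurableT _ (fun z => (M%:E * (\1_(A `*` B) z)%:E)%E)) => //.
  move=> [x y] _; rewrite /g/= lee_fin.
  rewrite !normrM !indicE in_setX/=.
  have [/set_mem xA|_] := boolP (x \in A); last by rewrite normr0 mulr0 mul0r mulr_ge0.
  have [/set_mem yB|_] := boolP (y \in B); last by rewrite normr0 mulr0 mulr_ge0.
  by rewrite normr1 !mulr1 (le_trans (fM _ _ _ _))// ler_norm.
apply: integrableZl => //; apply/integrableP; split; first exact/measurable_EFinP.
under eq_integral => z _ do rewrite gee0_abs ?lee_fin//.
rewrite integral_indic// setIT.
rewrite [ltLHS](product_measure1E m1 m2 mA mB).
by rewrite lte_mul_pinfty// ge0_fin_numE.
Qed.

End iterated_integrals.

Lemma integrable_subr d (T : measurableType d) (R : realType)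
    (mu : {measure set T -> \bar R}) (D : set T) (f g : T -> R) :
  measurable D -> mu.-integrable D (EFin \o f) -> mu.-integrable D (EFin \o g) ->
  mu.-integrable D (EFin \o (fun x => f x - g x)).
Proof. by move=> mD fi gi; exact: (integrableB mD fi gi). Qed.

Lemma integrable_mulrl d (T : measurableType d) (R : realType)
    (mu : {measure set T -> \bar R}) (D : set T) (k : R) (f : T -> R) :
  measurable D -> mu.-integrable D (EFin \o f) ->
  mu.-integrable D (EFin \o (fun x => k * f x)).
Proof. by move=> mD fi; exact: (integrableZl mD k fi). Qed.

(** * The Fejer kernel *)

Section fejer_kernel.
Context {R : realType}.
Notation mu := (@lebesgue_measure R).
Implicit Types x y u : R.

(* Normalised so that its total mass is 1. *)
Definition fejer x : R := pi^-1 * \int[mu]_(t in `[0, 1]) ((1 - t) * cos (t * x)).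

Lemma integrable_fejer x :
  mu.-integrable `[0, 1] (EFin \o (fun t : R => (1 - t) * cos (t * x))).
Proof.
apply: continuous_compact_integrable; first exact: segment_compact.
apply: continuous_subspaceT => t; apply: cvgM.
  by apply: cvgB; [exact: cvg_cst|exact: cvg_id].
apply: continuous_comp; last exact: continuous_cos.
by apply: cvgM; [exact: cvg_id|exact: cvg_cst].
Qed.

(** An explicit primitive [F] gives the classical closed form. The integral is kept as the
    definition: it has no singularity at 0, yields the bound 1 and the Lipschitz bound at once, and
    displays the triangle function whose transform the kernel is. *)
Lemma fejerE x : x != 0 -> fejer x = (1 - cos x) / (pi * x ^+ 2).
Proof.
move=> x0.
pose F t := (1 - t) * sin (t * x) / x - cos (t * x) / x ^+ 2.
have dF (t : R) : is_derive t 1 F ((1 - t) * cos (t * x)).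
  apply: is_derive_eq; rewrite /GRing.scale/=.
  by field.
rewrite /fejer /Rintegral (@continuous_FTC2 _ _ F)//.
- rewrite /F /= subrr !mul0r mul1r subr0 sin0 cos0.
  have : pi != 0 :> R by rewrite gt_eqF ?pi_gt0.
  by move: (pi : R) => p p0; field; rewrite x0 p0.
- apply: continuous_subspaceT => t; apply: cvgM.
    by apply: cvgB; [exact: cvg_cst|exact: cvg_id].
  apply: continuous_comp; last exact: continuous_cos.
  by apply: cvgM; [exact: cvg_id|exact: cvg_cst].
- have cF t : {for t, continuous F}.
    apply/differentiable_continuous/derivable1_diffP.
    exact: ex_derive.
  split; first by move=> t _; exact: ex_derive.
  + exact/cvg_at_right_filter/cF.
  + exact/cvg_at_left_filter/cF.
- by move=> t _; rewrite derive1E derive_val.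
Qed.

Lemma fejerN x : fejer (- x) = fejer x.
Proof. by congr (_ * _); apply: eq_Rintegral => t _; rewrite mulrN cosN. Qed.

Lemma fejer_ge0 x : 0 <= fejer x.
Proof.
have [->|x0] := eqVneq x 0; last first.
  by rewrite fejerE// divr_ge0 ?subr_ge0 ?cos_le1// mulr_ge0 ?sqr_ge0 ?pi_ge0.
rewrite mulr_ge0 ?invr_ge0 ?pi_ge0//; apply: Rintegral_ge0 => t /=.
by rewrite in_itv/= mulr0 cos0 mulr1 subr_ge0 => /andP[].
Qed.

Lemma fejer_le x : x != 0 -> fejer x <= 2 / (pi * x ^+ 2).
Proof.
move=> x0; have x2 : 0 < x ^+ 2 by rewrite exprn_even_gt0.
rewrite fejerE// ler_pM2r; last by rewrite invr_gt0 mulr_gt0 ?pi_gt0.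
by have := cos_geN1 x; lra.
Qed.

(** Lower bound meant to be added to its translate by [pi], where [1 - cos] becomes [1 + cos] and
    the zeros disappear. *)
Lemma le_fejer x : (1 - cos x) / (pi * (1 + x ^+ 2)) <= fejer x.
Proof.
have [->|x0] := eqVneq x 0; first by rewrite cos0 subrr mul0r fejer_ge0.
have x2 : 0 < x ^+ 2 by rewrite exprn_even_gt0.
have x21 : 0 < 1 + x ^+ 2 by rewrite addr_gt0.
have pi0 : 0 < pi :> R by exact: pi_gt0.
rewrite fejerE// ler_wpM2l ?subr_ge0 ?cos_le1//.
rewrite lef_pV2 ?posrE; [|exact: mulr_gt0..].
by rewrite ler_pM2l// lerDr.
Qed.

Lemma fejer_le1 x : fejer x <= 1.
Proof.
rewrite /fejer ler_pdivrMl ?pi_gt0// mulr1.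
rewrite (@le_trans _ _ (\int[mu]_(t in `[0, 1]) 1))//.
  apply: le_Rintegral => //.
  - exact: integrable_fejer.
  - apply: continuous_compact_integrable; first exact: segment_compact.
    by apply: continuous_subspaceT => t; exact: cvg_cst.
  move=> t; rewrite /= in_itv/= => /andP[t0 t1].
  rewrite (le_trans (ler_norm _))// normrM -[leRHS]mulr1 ler_pM ?cos_max//.
  by rewrite ger0_norm ?subr_ge0// lerBlDr lerDl.
rewrite Rintegral_cst//= lebesgue_measure_itv/= lte_fin ltr01 oppr0 adde0 mulr1.
by rewrite (le_trans _ (pi_ge2 _))// ler1n.
Qed.

Lemma fejer_lipschitz x y : `|fejer x - fejer y| <= `|x - y|.
Proof.
rewrite /fejer -mulrBr normrM gtr0_norm ?invr_gt0 ?pi_gt0//.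
rewrite -RintegralB//; try exact: integrable_fejer.
have iB : mu.-integrable `[0, 1] (EFin \o
    (fun t : R => (1 - t) * cos (t * x) - (1 - t) * cos (t * y))).
  by apply: integrable_subr => //; exact: integrable_fejer.
rewrite ler_pdivrMl ?pi_gt0//.
have -> : `|x - y| = \int[mu]_(t in `[0, 1]) `|x - y|.
  by rewrite Rintegral_cst//= lebesgue_measure_itv/= lte_fin ltr01 oppr0 adde0 mulr1.
rewrite (le_trans (le_normr_Rintegral _ iB))// (@le_trans _ _
  (\int[mu]_(t in `[0, 1]) `|x - y|))//.
  apply: le_Rintegral => //.
  - exact: integrable_norm.
  - apply: continuous_compact_integrable; first exact: segment_compact.
    by apply: continuous_subspaceT => t; exact: cvg_cst.
  move=> t; rewrite /= in_itv/= => /andP[t0 t1].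
  rewrite -mulrBr normrM ger0_norm ?subr_ge0//.
  rewrite (@le_trans _ _ (1 * `|t * x - t * y|))//.
    by rewrite ler_pM ?subr_ge0 ?normr_cosB_le// lerBlDr lerDl.
  by rewrite mul1r -mulrBr normrM (ger0_norm t0) ler_piMl.
rewrite ler_peMl//; first by apply: Rintegral_ge0 => t _.
by rewrite (le_trans _ (pi_ge2 _))// ler1n.
Qed.

Lemma continuous_fejer : continuous fejer.
Proof.
move=> x; apply/cvgrPdist_le => e e0; near=> y.
apply: (le_trans (fejer_lipschitz _ _)).
by near: y; apply: cvgr_dist_le => //; exact: cvg_id.
Unshelve. all: by end_near. Qed.

Lemma measurable_fejer : measurable_fun [set: R] fejer.
Proof. by apply: continuous_measurable_fun; exact: continuous_fejer. Qed.

Lemma cvg_expRN_scaled u : 0 < u -> expR (- (u * x)) @[x --> +oo] --> (0 : R).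
Proof.
move=> u0.
apply: (@cvg_comp _ _ _ (fun x => u * x) (fun y => expR (- y)) _ (+oo)); last exact: cvgr_expR.
by apply: gt0_cvgMry => //; exact: cvg_id.
Qed.

(** Represents [x^(-2)] as a Laplace integral, so that the mass of the Fejer kernel becomes a double
    integral of elementary functions. *)
Lemma integral_mul_expRN x : 0 < x ->
  (\int[mu]_(u in `[0%R, +oo[) (u * expR (- (x * u)))%:E = (x ^- 2)%:E)%E.
Proof.
move=> x0.
pose F u := - ((u / x + x ^- 2) * expR (- (x * u))).
have dF (u : R) : is_derive u 1 F (u * expR (- (x * u))).
  apply: is_derive_eq; rewrite /GRing.scale/=.
  by field; rewrite gt_eqF.
have cF u : {for u, continuous F}.
  by apply/differentiable_continuous/derivable1_diffP; exact: ex_derive.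
rewrite (@ge0_continuous_FTC2y _ _ F _ 0)//.
- by rewrite -EFinB; congr EFin; rewrite /F mul0r !add0r mulr0 oppr0 expR0 mulr1 opprK.
- by move=> u u0; rewrite mulr_ge0.
- apply: continuous_subspaceT => u; apply: cvgM; first exact: cvg_id.
  apply: continuous_comp; last exact: continuous_expR.
  by apply: cvgN; apply: cvgM; [exact: cvg_cst|exact: cvg_id].
- rewrite -oppr0; apply: cvgN.
  (* Half of the exponential decay absorbs the linear factor: with [t = x / 2 * u],
     [2 * t + 1 <= 3 * (1 + t) <= 3 * expR t]. *)
  apply: (@squeeze_cvgr _ _ _ _ (cst 0) (fun u => 3 / x ^+ 2 * expR (- (x / 2 * u)))).
  + near=> u.
    have u0 : 0 <= u by near: u; exact: nbhs_pinfty_ge.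
    rewrite mulr_ge0 ?addr_ge0 ?divr_ge0 ?invr_ge0 ?sqr_ge0 ?(ltW x0)//=.
    have -> : expR (- (x * u)) = expR (- (x / 2 * u)) * expR (- (x / 2 * u)).
      by rewrite -expRD; congr expR; field.
    rewrite mulrA ler_wpM2r//.
    have xu0 : 0 <= x / 2 * u by rewrite !mulr_ge0// ltW.
    rewrite expRN ler_pdivrMr ?expR_gt0//.
    have h := expR_ge1Dx (x / 2 * u).
    have -> : u / x + x ^- 2 = (2 * (x / 2 * u) + 1) / x ^+ 2 by field; rewrite gt_eqF.
    rewrite [leRHS]mulrAC ler_pM2r ?invr_gt0 ?exprn_gt0//.
    by lra.
  + exact: cvg_cst.
  + rewrite -(mulr0 (3 / x ^+ 2)); apply: cvgM; first exact: cvg_cst.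
    by apply: cvg_expRN_scaled; rewrite divr_gt0.
- exact/cvg_at_right_filter/cF.
- by move=> u _; rewrite derive1E derive_val.
Unshelve. all: by end_near. Qed.

Lemma integral_1Bcos_expRN u : 0 < u ->
  (\int[mu]_(x in `[0%R, +oo[) ((1 - cos x) * (u * expR (- (x * u))))%:E =
   ((1 + u ^+ 2)^-1)%:E)%E.
Proof.
move=> u0; have u21 : 1 + u ^+ 2 != 0 by rewrite gt_eqF// addr_gt0// exprn_gt0.
pose F x := (- 1 - u * (sin x - u * cos x) / (1 + u ^+ 2)) * expR (- (u * x)).
have dF (x : R) : is_derive x 1 F ((1 - cos x) * (u * expR (- (x * u)))).
  apply: is_derive_eq; rewrite /GRing.scale/= (mulrC x u).
  by field.
have cF x : {for x, continuous F}.
  by apply/differentiable_continuous/derivable1_diffP; exact: ex_derive.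
rewrite (@ge0_continuous_FTC2y _ _ F _ 0)//.
- rewrite -EFinB; congr EFin; rewrite /F sin0 cos0 !mulr0 oppr0 expR0 mulr1.
  by field.
- by move=> x x0; rewrite !mulr_ge0 ?subr_ge0 ?cos_le1// ltW.
- apply: continuous_subspaceT => x; apply: cvgM.
    by apply: cvgB; [exact: cvg_cst|exact: continuous_cos].
  apply: cvgM; first exact: cvg_cst.
  apply: continuous_comp; last exact: continuous_expR.
  by apply: cvgN; apply: cvgM; [exact: cvg_id|exact: cvg_cst].
- apply: norm_cvg0.
  pose C := 1 + u * (1 + u) / (1 + u ^+ 2).
  apply: (@squeeze_cvgr _ _ _ _ (cst 0) (fun x => C * expR (- (u * x)))).
  + near=> x; rewrite normr_ge0 normrM (ger0_norm (expR_ge0 _)) ler_wpM2r//.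
    rewrite -normrN opprD !opprK (le_trans (ler_normD _ _))// normr1 lerD2l.
    rewrite normrM normfV (gtr0_norm (_ : 0 < 1 + u ^+ 2)) ?addr_gt0 ?exprn_gt0//.
    rewrite ler_wpM2r ?invr_ge0 ?addr_ge0 ?sqr_ge0//.
    rewrite normrM gtr0_norm// ler_pM2l// (le_trans (ler_normB _ _))//.
    by rewrite lerD ?sin_max// normrM gtr0_norm// ler_piMr ?cos_max// ltW.
  + exact: cvg_cst.
  + rewrite -(mulr0 C); apply: cvgM; first exact: cvg_cst.
    exact: cvg_expRN_scaled.
- exact/cvg_at_right_filter/cF.
- by move=> x _; rewrite derive1E derive_val.
Unshelve. all: by end_near. Qed.

(** By symmetry it suffices to treat the half-line. There [x^(-2)] is replaced by its Laplace
    integral, Tonelli exchanges the two variables, the inner integral becomes [1 / (1 + u^2)], and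
    the arctangent contributes [pi / 2]. *)
Lemma integral_fejer : (\int[mu]_x (fejer x)%:E = 1)%E.
Proof.
rewrite ge0_symfun_integralT; [|exact: fejer_ge0|exact: continuous_fejer|
  by move=> x; rewrite /= fejerN].
have mfej := measurable_fejer.
pose f (x u : R) := (1 - cos x) * (u * expR (- (x * u))).
have mf : measurable_fun [set: R * R] (fun z => f z.1 z.2).
  apply: measurable_funM.
    apply: measurable_funB => //; apply: measurableT_comp => //.
    by apply: continuous_measurable_fun; exact: continuous_cos.
  apply: measurable_funM => //; apply: measurableT_comp => //.
  by apply: measurableT_comp => //; exact: measurable_funM.
have mf1 x : measurable_fun [set: R] (f x).
  exact: (measurableT_comp mf (measurable_pair1 x)).
have mf2 u : measurable_fun [set: R] (f ^~ u).
  exact: (measurableT_comp mf (measurable_pair2 u)).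
have f0 x u : 0 < x -> 0 < u -> 0 <= f x u.
  by move=> x0 u0; rewrite !mulr_ge0 ?subr_ge0 ?cos_le1// ltW.
rewrite -set_itvcy -integral_itv_obnd_cbnd; last first.
  by apply/measurable_EFinP; exact: measurable_funTS.
have -> : (\int[mu]_(x in `]0%R, +oo[) (fejer x)%:E =
    pi^-1%:E * \int[mu]_(x in `]0%R, +oo[) \int[mu]_(u in `]0%R, +oo[) (f x u)%:E)%E.
  rewrite -ge0_integralZl_EFin ?invr_ge0 ?pi_ge0//; last 2 first.
    move=> x; rewrite /= in_itv/= andbT => x0; apply: integral_ge0 => u.
    by rewrite /= in_itv/= andbT => u0; rewrite lee_fin f0.
    apply: measurable_funTS; apply: measurable_integral_on => // x u.
    by rewrite /= in_itv/= andbT => u0; rewrite !mulr_ge0 ?subr_ge0 ?cos_le1// ltW.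
  apply: eq_integral => x; rewrite inE/= in_itv/= andbT => x0.
  rewrite (integral_itv_obnd_cbnd (f := fun u => (f x u)%:E)); last first.
    by apply/measurable_EFinP; exact: measurable_funTS.
  rewrite /f; under eq_integral do rewrite EFinM.
  rewrite ge0_integralZl_EFin ?subr_ge0 ?cos_le1//; last 2 first.
    by move=> u; rewrite /= in_itv/= andbT => u0; rewrite lee_fin mulr_ge0.
    apply/measurable_EFinP/measurable_funM => //; apply: measurableT_comp => //.
    by apply: measurableT_comp => //; exact: measurable_funM.
  rewrite integral_mul_expRN// -!EFinM fejerE ?gt_eqF//.
  by rewrite invfM mulrCA mulrA.
rewrite tonelli_on//; last first.
  by move=> x u /=; rewrite !in_itv/= !andbT; exact: f0.
under eq_integral => u.
  rewrite inE/= in_itv/= andbT => u0.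
  rewrite (integral_itv_obnd_cbnd (f := fun x => (f x u)%:E)); last first.
    by apply/measurable_EFinP; exact: measurable_funTS.
  rewrite integral_1Bcos_expRN//.
  over.
rewrite integral_itv_obnd_cbnd; last first.
  apply/measurable_EFinP; apply: measurable_funTS.
  exact: (continuous_measurable_fun (@continuous_oneDsqrV R)).
rewrite (integral0y_oneDsqr R) -!EFinM; congr EFin.
have : pi != 0 :> R by rewrite gt_eqF ?pi_gt0.
by move: (pi : R) => p p0; field.
Qed.

End fejer_kernel.

Lemma continuous_scale {R : realType} (f : R -> R) (k : R) :
  continuous f -> continuous (fun t : R => f (t * k)).
Proof.
move=> cf t; apply: (@continuous_comp _ _ _ (fun t : R => t * k) f); last exact: cf.
by apply: cvgM; [exact: cvg_id|exact: cvg_cst].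
Qed.

(** * Gaussian integrals and rescaling of the unit interval *)

Section gaussian_integral.
Context {R : realType}.
Notation mu := (@lebesgue_measure R).
Implicit Type k : R.

Lemma continuous_gauss_scaled k : continuous (fun u : R => expR (- (k * u ^+ 2))).
Proof.
move=> u; apply: continuous_comp; last exact: continuous_expR.
by apply: cvgN; apply: cvgM; [exact: cvg_cst|exact: sqr_continuous].
Qed.

Lemma measurable_gauss_scaled k :
  measurable_fun [set: R] (fun u : R => expR (- (k * u ^+ 2))).
Proof. by apply: continuous_measurable_fun; exact: continuous_gauss_scaled. Qed.

(** Normalisation of the centred normal density of variance [1 / (2 k)]. *)
Lemma integral_gauss_scaled k : 0 < k ->
  (\int[mu]_u (expR (- (k * u ^+ 2)))%:E = (Num.sqrt (pi / k))%:E)%E.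
Proof.
move=> k0; pose s := Num.sqrt (2 * k)^-1.
have s2 : s ^+ 2 = (2 * k)^-1 by rewrite sqr_sqrtr// invr_ge0 mulr_ge0// ltW.
have s0 : s != 0 by rewrite gt_eqF// sqrtr_gt0 invr_gt0 mulr_gt0.
have := integral_normal_pdf 0 s; rewrite normal_pdfE//.
have pk : normal_peak s = (Num.sqrt (pi / k))^-1.
  rewrite /normal_peak s2; congr (Num.sqrt _)^-1.
  rewrite -mulr_natr; have : pi != 0 :> R by rewrite gt_eqF ?pi_gt0.
  by move: (pi : R) => p p0; field; rewrite gt_eqF.
have pk0 : 0 < Num.sqrt (pi / k) by rewrite sqrtr_gt0 divr_gt0// pi_gt0.
rewrite pk; under eq_integral do rewrite EFinM.
rewrite ge0_integralZl_EFin//; last 2 first.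
- by move=> u _; rewrite lee_fin expR_ge0.
- by apply/measurable_EFinP; exact: measurable_normal_fun.
move=> h; rewrite -[RHS]mule1 -h muleA -EFinM divff ?gt_eqF// mul1e.
apply: eq_integral => u _; congr EFin; congr expR.
by rewrite /normal_fun subr0 s2 -mulr_natr; field; rewrite gt_eqF.
Qed.

Lemma integrable_gauss_scaled k : 0 < k ->
  mu.-integrable [set: R] (EFin \o (fun u : R => expR (- (k * u ^+ 2)))).
Proof.
move=> k0; apply/integrableP; split.
  by apply/measurable_EFinP; exact: measurable_gauss_scaled.
under eq_integral => u _ do rewrite gee0_abs ?lee_fin ?expR_ge0//.
by rewrite integral_gauss_scaled// ltry.
Qed.

Lemma integral0y_gauss_scaled k : 0 < k ->
  (\int[mu]_(u in `[0%R, +oo[) (expR (- (k * u ^+ 2)))%:E =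
   (Num.sqrt (pi / k) / 2)%:E)%E.
Proof.
move=> k0; have := integral_gauss_scaled k0.
rewrite ge0_symfun_integralT; last 3 first.
- by move=> u; exact: expR_ge0.
- exact: continuous_gauss_scaled.
- by move=> u; rewrite /= sqrrN.
rewrite -set_itvcy => h.
by rewrite mulrC EFinM -h muleA -EFinM mulVf// mul1e.
Qed.

Lemma integral_unit_scale (L : R) (G : R -> R) : 0 < L -> continuous G ->
  \int[mu]_(t in `[0, 1]) G t = \int[mu]_(u in `[0, L]) (G (u / L) / L).
Proof.
move=> L0 cG; pose F u := u / L.
have dF (u : R) : is_derive u 1 F L^-1.
  by apply: is_derive_eq; rewrite /GRing.scale/=; ring.
have F'E : F^`()%classic = cst L^-1.
  by apply/funext => u; rewrite derive1E derive_val.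
have cF u : {for u, continuous F}.
  by apply/differentiable_continuous/derivable1_diffP; exact: ex_derive.
rewrite /Rintegral; congr fine.
have -> : `[0, 1]%classic = `[F 0, F L]%classic by rewrite /F mul0r divff// gt_eqF.
rewrite integration_by_substitution_increasing//.
- by rewrite F'E.
- exact: ltW.
- by move=> u v _ _ uv; rewrite /F ltr_pM2r ?invr_gt0.
- by rewrite F'E => u _; exact: cvg_cst.
- by rewrite F'E; exact: is_cvg_cst.
- by rewrite F'E; exact: is_cvg_cst.
- split=> //.
  + exact/cvg_at_right_filter/cF.
  + exact/cvg_at_left_filter/cF.
- exact: continuous_subspaceT.
Qed.

End gaussian_integral.

(** * Local limit theorem *)

Section characteristic_function.
Context {R : realType}.
Implicit Types (p : probability R R) (s x : R).

(** Real part of the characteristic function; [cf_sin] is the imaginary part. Keeping the two apart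
    confines everything to real integrals, and complex multiplication becomes the addition
    formulas. *)
Definition cf_cos p s := \int[p]_x cos (s * x).
Definition cf_sin p s := \int[p]_x sin (s * x).

Lemma measurable_cosM s : measurable_fun [set: R] (fun x => cos (s * x)).
Proof.
apply: continuous_measurable_fun => x.
apply: continuous_comp; last exact: continuous_cos.
by apply: cvgM; [exact: cvg_cst|exact: cvg_id].
Qed.

Lemma measurable_sinM s : measurable_fun [set: R] (fun x => sin (s * x)).
Proof.
apply: continuous_measurable_fun => x.
apply: continuous_comp; last exact: continuous_sin.
by apply: cvgM; [exact: cvg_cst|exact: cvg_id].
Qed.

Lemma integrable_bounded p (f : R -> R) M : measurable_fun [set: R] f ->
  (forall x, `|f x| <= M) -> p.-integrable [set: R] (EFin \o f).
Proof.
move=> mf fM; apply: measurable_bounded_integrable => //.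
  by rewrite (le_lt_trans (probability_le1 p measurableT))// ltry.
exists M; split; first exact: num_real.
by move=> N MN x _; rewrite /= (le_trans (fM x))// ltW.
Qed.

Lemma integrable_cosM p s : p.-integrable [set: R] (EFin \o (fun x => cos (s * x))).
Proof.
by apply: (@integrable_bounded _ _ 1) => [|x]; [exact: measurable_cosM|exact: cos_max].
Qed.

Lemma integrable_sinM p s : p.-integrable [set: R] (EFin \o (fun x => sin (s * x))).
Proof.
by apply: (@integrable_bounded _ _ 1) => [|x]; [exact: measurable_sinM|exact: sin_max].
Qed.

Lemma Rintegral_probability_cst p (r : R) : \int[p]_x r = r.
Proof. by rewrite Rintegral_cst//= probability_setT mulr1. Qed.

Lemma normr_Rintegral_le p (f : R -> R) M : measurable_fun [set: R] f ->
  (forall x, `|f x| <= M) -> `|\int[p]_x f x| <= M.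
Proof.
move=> mf fM; have fi := integrable_bounded p mf fM.
rewrite (le_trans (le_normr_Rintegral measurableT fi))//.
rewrite -[leRHS](Rintegral_probability_cst p); apply: le_Rintegral => //.
- exact: integrable_norm.
- exact: finite_measure_integrable_cst.
Qed.

Lemma normr_cf_cos_le1 p s : `|cf_cos p s| <= 1.
Proof. by apply: normr_Rintegral_le => [|x]; [exact: measurable_cosM|exact: cos_max]. Qed.

Lemma normr_cf_sin_le1 p s : `|cf_sin p s| <= 1.
Proof. by apply: normr_Rintegral_le => [|x]; [exact: measurable_sinM|exact: sin_max]. Qed.

(** Real part of the characteristic function multiplied by [exp (- i s y)]. *)
Lemma cf_cos_shift p s y :
  \int[p]_x cos (s * (x - y)) =
  cf_cos p s * cos (s * y) + cf_sin p s * sin (s * y).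
Proof.
rewrite -RintegralZr//; last exact: integrable_cosM.
rewrite -RintegralZr//; last exact: integrable_sinM.
rewrite -RintegralD//; last 2 first.
- apply: (@integrable_bounded _ _ 1) => [|x].
    by apply: measurable_funM => //; exact: measurable_cosM.
  by rewrite normrM -[leRHS]mul1r ler_pM ?cos_max.
- apply: (@integrable_bounded _ _ 1) => [|x].
    by apply: measurable_funM => //; exact: measurable_sinM.
  by rewrite normrM -[leRHS]mul1r ler_pM ?sin_max.
by apply: eq_Rintegral => x _; rewrite mulrBr cosB.
Qed.

End characteristic_function.

Section local_limit.
Context {R : realType} (q : probability R R) (sigma : R).
Hypotheses (sigma_gt0 : 0 < sigma)
  (q_moment4 : q.-integrable [set: R] (EFin \o (fun x => x ^+ 4)))
  (q_mean : \int[q]_x x = 0) (q_variance : \int[q]_x (x ^+ 2) = sigma ^+ 2)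
  (q_nonlattice : forall s, 0 < s -> cf_cos q s ^+ 2 + cf_sin q s ^+ 2 < 1).
Implicit Types (s u y : R).

Lemma integrable_dominated_moment4 (f : R -> R) : measurable_fun [set: R] f ->
  (forall x, `|f x| <= 1 + x ^+ 4) -> q.-integrable [set: R] (EFin \o f).
Proof.
move=> mf fM.
apply: (@le_integrable _ _ _ _ _ measurableT _ (EFin \o (fun x : R => 1 + x ^+ 4))).
- exact/measurable_EFinP.
- move=> x _; rewrite /= lee_fin (le_trans (fM x))// ger0_norm//.
  by rewrite addr_ge0// exprn_even_ge0.
- have -> : EFin \o (fun x : R => 1 + x ^+ 4) = (fun x => 1%:E + (x ^+ 4)%:E)%E by [].
  apply: integrableD => //.
  exact: finite_measure_integrable_cst.
Qed.

Lemma integrable_moment k : (k <= 4)%N ->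
  q.-integrable [set: R] (EFin \o (fun x => `|x| ^+ k)).
Proof.
move=> k4; apply: integrable_dominated_moment4 => [|x].
  by apply: measurable_funX; exact: normr_measurable.
rewrite ger0_norm ?exprn_ge0//.
have -> : x ^+ 4 = `|x| ^+ 4 by rewrite -normrX ger0_norm// exprn_even_ge0.
have [x1|x1] := leP `|x| 1.
  by rewrite (@le_trans _ _ 1) ?lerDl ?exprn_ge0// exprn_ile1.
by rewrite (@le_trans _ _ (`|x| ^+ 4))// ?lerDr// ler_weXn2l// ltW.
Qed.

Let moment k := \int[q]_x (`|x| ^+ k).

Let moment_ge0 k : 0 <= moment k.
Proof. by apply: Rintegral_ge0 => x _; rewrite exprn_ge0. Qed.

Lemma cf_cos_taylor s :
  `|cf_cos q s - (1 - sigma ^+ 2 * s ^+ 2 / 2)| <= s ^+ 4 * moment 4.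
Proof.
have i2 : q.-integrable [set: R] (EFin \o (fun x => x ^+ 2)).
  have := integrable_moment (isT : 2 <= 4)%N.
  by apply: eq_integrable => // x _; rewrite /= -normrX ger0_norm// sqr_ge0.
have i1 : q.-integrable [set: R] (EFin \o (fun x => 1 - s ^+ 2 / 2 * x ^+ 2)).
  apply: integrable_subr => //; first exact: finite_measure_integrable_cst.
  exact: integrable_mulrl.
have -> : 1 - sigma ^+ 2 * s ^+ 2 / 2 = \int[q]_x (1 - s ^+ 2 / 2 * x ^+ 2).
  rewrite RintegralB//; last 2 first.
  - exact: finite_measure_integrable_cst.
  - exact: integrable_mulrl.
  rewrite Rintegral_probability_cst RintegralZl// q_variance; ring.
rewrite -RintegralB//; last exact: integrable_cosM.
have iB := integrable_subr measurableT (integrable_cosM q s) i1.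
rewrite (le_trans (le_normr_Rintegral measurableT iB))//.
rewrite -RintegralZl//; last exact: integrable_moment.
apply: le_Rintegral => //.
- exact: integrable_norm.
- by apply: integrable_mulrl => //; exact: integrable_moment.
- move=> x _; rewrite ler_norml.
  have := cos_le_quartic (s * x); have := cos_ge_quad (s * x).
  have -> : `|x| ^+ 4 = x ^+ 4 by rewrite -normrX ger0_norm// exprn_even_ge0.
  have : 0 <= s ^+ 4 * x ^+ 4 by rewrite -exprMn exprn_even_ge0.
  rewrite !exprMn; lra.
Qed.

(** Since the mean is 0, [s * x] can be subtracted from the sine for free. The imaginary part is
    thus of third order, negligible against the quadratic loss in the real part. *)
Lemma cf_sin_taylor s : `|cf_sin q s| <= `|s| ^+ 3 * moment 3.
Proof.
have i1 : q.-integrable [set: R] (EFin \o id).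
  apply: integrable_dominated_moment4 => // x.
  have -> : x ^+ 4 = `|x| ^+ 4 by rewrite -normrX ger0_norm// exprn_even_ge0.
  have [x1|x1] := leP `|x| 1; first by rewrite (le_trans x1)// lerDl exprn_ge0.
  by rewrite (@le_trans _ _ (`|x| ^+ 4))// ?lerDr// ler_eXnr// ltW.
have isx : q.-integrable [set: R] (EFin \o (fun x => s * x)).
  exact: integrable_mulrl.
have -> : cf_sin q s = \int[q]_x (sin (s * x) - s * x).
  rewrite RintegralB//; last exact: integrable_sinM.
  by rewrite RintegralZl// q_mean mulr0 subr0.
have iB := integrable_subr measurableT (integrable_sinM q s) isx.
rewrite (le_trans (le_normr_Rintegral measurableT iB))//.
rewrite -RintegralZl//; last exact: integrable_moment.
apply: le_Rintegral => //.
- exact: integrable_norm.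
- by apply: integrable_mulrl => //; exact: integrable_moment.
- move=> x _; rewrite (le_trans (normr_sin_sub_le _))// normrM exprMn.
  rewrite ler_piMr ?mulr_ge0 ?exprn_ge0//.
  by rewrite invf_le1// ler1n.
Qed.

Let cf_lipschitz (f : R -> R) : (forall x y, `|f x - f y| <= `|x - y|) ->
  (forall s, q.-integrable [set: R] (EFin \o (fun x => f (s * x)))) ->
  continuous (fun s => \int[q]_x f (s * x)).
Proof.
move=> flip fi s; apply/cvgrPdist_le => e e0.
have m1 : 0 < moment 1 + 1 by rewrite ltr_wpDl.
have e1 : 0 < e / (moment 1 + 1) by rewrite divr_gt0.
near=> t.
rewrite -RintegralB//.
have iB := integrable_subr measurableT (fi s) (fi t).
rewrite (le_trans (le_normr_Rintegral measurableT iB))//.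
rewrite (@le_trans _ _ (`|s - t| * moment 1))//.
  rewrite -RintegralZl//; last exact: integrable_moment.
  apply: le_Rintegral => //.
  - exact: integrable_norm.
  - by apply: integrable_mulrl => //; exact: integrable_moment.
  - by move=> x _; rewrite (le_trans (flip _ _))// -mulrBl normrM expr1.
rewrite (@le_trans _ _ (e / (moment 1 + 1) * moment 1))//.
  rewrite ler_wpM2r//; near: t; apply: cvgr_dist_le => //; exact: cvg_id.
by rewrite mulrAC ler_pdivrMr// ler_pM2l// lerDl.
Unshelve. all: by end_near. Qed.

Lemma continuous_cf_cos : continuous (cf_cos q).
Proof. by apply: cf_lipschitz; [exact: normr_cosB_le|exact: integrable_cosM]. Qed.

Lemma continuous_cf_sin : continuous (cf_sin q).
Proof. by apply: cf_lipschitz; [exact: normr_sinB_le|exact: integrable_sinM]. Qed.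

(** Squared modulus of the characteristic function, which is multiplicative under convolution. *)
Let modsq s := cf_cos q s ^+ 2 + cf_sin q s ^+ 2.

(** Near 0 the real part lies in [[0, 1]], so its square is at most itself; this avoids squaring the
    expansion. With [v = sigma^2 / 2], half of the loss [v s^2] then pays for the fourth-order
    errors and the other half is the rate [sigma^2 / 4]. *)
Let modsq_le_near0 : exists2 d : R, 0 < d &
  forall s, 0 <= s -> s <= d -> modsq s <= expR (- (sigma ^+ 2 / 4 * s ^+ 2)).
Proof.
pose b := moment 4; pose e := moment 3 ^+ 2; pose v := sigma ^+ 2 / 2.
have b0 : 0 <= b := moment_ge0 4.
have e0 : 0 <= e by exact: sqr_ge0.
have v0 : 0 < v by rewrite divr_gt0 ?exprn_gt0.
(* For [s <= 1 / D] each summand of [D] gives one requirement: [s <= 1], [(b + e) s^2 <= v / 2] and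
   [(v + b) s^2 <= 1], the last of which makes the real part nonnegative. *)
pose D := 1 + v + (b + e) * 2 / v + b + e.
have bev : 0 <= (b + e) * 2 / v by rewrite divr_ge0 ?mulr_ge0 ?addr_ge0// ltW.
have D1 : 1 <= D by rewrite /D; lra.
have D0 : 0 < D by lra.
exists D^-1; first by rewrite invr_gt0.
move=> s s0 sD.
have sD1 : s * D <= 1 by rewrite -ler_pdivlMr// mul1r.
have s1 : s <= 1 by nra.
have s2s : s ^+ 2 <= s by rewrite expr2 ler_piMl.
have s20 : 0 <= s ^+ 2 by exact: sqr_ge0.
have hbe : (b + e) * s ^+ 2 <= v / 2.
  have : (b + e) * 2 / v * s <= 1.
    by rewrite (le_trans _ sD1)// mulrC ler_wpM2l// /D; lra.
  rewrite mulrAC ler_pdivrMr// mul1r => h.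
  have : (b + e) * s ^+ 2 <= (b + e) * s by rewrite ler_wpM2l// addr_ge0.
  lra.
have hvb : (v + b) * s ^+ 2 <= 1.
  rewrite (le_trans _ sD1)// mulrC ler_pM ?addr_ge0//; first exact: ltW.
  by rewrite /D; lra.
have hs := cf_sin_taylor s; rewrite (ger0_norm s0) in hs.
have /[!ler_norml]/andP[hc1 hc2] := cf_cos_taylor s.
have vE : sigma ^+ 2 * s ^+ 2 / 2 = v * s ^+ 2 by rewrite /v; ring.
rewrite vE -/b in hc1 hc2.
have s4 : s ^+ 4 = s ^+ 2 * s ^+ 2 by rewrite -exprD.
have s4s : s ^+ 4 <= s ^+ 2 by rewrite s4 ler_piMl// (le_trans s2s).
have c0 : 0 <= cf_cos q s.
  have : s ^+ 4 * b <= s ^+ 2 * b by rewrite ler_wpM2r.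
  by move: hc1 hvb; rewrite mulrDl (mulrC b); lra.
have c1 : cf_cos q s <= 1 by rewrite (le_trans (ler_norm _))// normr_cf_cos_le1.
have cc : cf_cos q s ^+ 2 <= cf_cos q s by rewrite expr2 ler_piMl.
have ss : cf_sin q s ^+ 2 <= s ^+ 4 * e.
  rewrite -[leLHS]ger0_norm ?sqr_ge0// normrX.
  rewrite (@le_trans _ _ ((s ^+ 3 * moment 3) ^+ 2))//.
    by rewrite lerXn2r ?nnegrE ?mulr_ge0 ?exprn_ge0.
  rewrite exprMn ler_wpM2r// -exprM (_ : 3 * 2 = 4 + 2)%N// exprD ler_piMr ?exprn_ge0//.
  by rewrite (le_trans s2s).
rewrite (le_trans _ (expR_ge1Dx _))// /modsq.
have -> : sigma ^+ 2 / 4 * s ^+ 2 = v / 2 * s ^+ 2 by rewrite /v; field.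
have : (b + e) * s ^+ 2 * s ^+ 2 <= v / 2 * s ^+ 2 by rewrite ler_wpM2r.
by move: cc ss hc2; rewrite s4; lra.
Qed.

(** Beyond the Taylor zone, the modulus attains its maximum on the compact [[d, l]], and this
    maximum is below 1 because [q] is non-lattice. As [s <= l], a constant [r < 1] is itself
    dominated by a Gaussian of rate [- ln r / l^2]. The rate depends on [l] and may degenerate as
    [l] grows. *)
Lemma cf_sq_le (l : R) : 0 < l -> exists2 k : R, 0 < k &
  forall s, 0 <= s -> s <= l -> modsq s <= expR (- (k * s ^+ 2)).
Proof.
move=> l0; have [d d0 dP] := modsq_le_near0.
have [ld|dl] := leP l d.
  exists (sigma ^+ 2 / 4); first by rewrite divr_gt0 ?exprn_gt0.
  by move=> s s0 sl; rewrite dP// (le_trans sl).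
have cmodsq : continuous modsq.
  have -> : modsq = (fun s => cf_cos q s * cf_cos q s + cf_sin q s * cf_sin q s) by [].
  move=> s; apply: cvgD; apply: cvgM.
  - exact: continuous_cf_cos.
  - exact: continuous_cf_cos.
  - exact: continuous_cf_sin.
  - exact: continuous_cf_sin.
have [|||c cdl cmax] := @compact_EVT_max _ R modsq `[d, l].
- by exists l; rewrite /= in_itv/= lexx ltW.
- exact: segment_compact.
- exact: continuous_subspaceT.
have c1 : modsq c < 1.
  apply: q_nonlattice; move: cdl; rewrite inE/= in_itv/= => /andP[dc _].
  exact: lt_le_trans dc.
(* The maximum [modsq c] might be 0; the floor [1 / 2] keeps the logarithm meaningful. *)
pose r := Num.max (modsq c) 2^-1.
have r0 : 0 < r by rewrite lt_max orbC invr_gt0 ltr0n.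
have r1 : r < 1 by rewrite gt_max c1 invf_lt1// ltr1n.
have lr : 0 < - ln r by rewrite oppr_gt0 ln_lt0// r0.
exists (Num.min (sigma ^+ 2 / 4) (- ln r / l ^+ 2)).
  by rewrite lt_min !divr_gt0 ?exprn_gt0.
move=> s s0 sl; have [sd|ds] := leP s d.
  rewrite (le_trans (dP _ s0 sd))// ler_expR lerN2 ler_wpM2r ?sqr_ge0//.
  by rewrite ge_min lexx.
rewrite (@le_trans _ _ r)//.
  by rewrite le_max cmax// inE/= in_itv/= (ltW ds).
rewrite -{1}(lnK r0) ler_expR lerNr (@le_trans _ _ (- ln r / l ^+ 2 * s ^+ 2))//.
  by rewrite ler_wpM2r ?sqr_ge0// ge_min lexx orbT.
rewrite mulrAC ler_pdivrMr ?exprn_gt0// ler_wpM2l ?(ltW lr)//.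
by rewrite lerXn2r ?nnegrE// (le_trans s0).
Qed.

Variable Q : nat -> probability R R.
Hypotheses
  (Q0_cos : forall s, cf_cos (Q 0%N) s = 1) (Q0_sin : forall s, cf_sin (Q 0%N) s = 0)
  (QS_cos : forall m s, cf_cos (Q m.+1) s =
     cf_cos (Q m) s * cf_cos q s - cf_sin (Q m) s * cf_sin q s)
  (QS_sin : forall m s, cf_sin (Q m.+1) s =
     cf_cos (Q m) s * cf_sin q s + cf_sin (Q m) s * cf_cos q s).

(** The hypotheses on [Q] are complex multiplication written in coordinates: the characteristic
    function of [Q m] is the [m]-th power of that of [q]. *)
Let modsqX m s : cf_cos (Q m) s ^+ 2 + cf_sin (Q m) s ^+ 2 = modsq s ^+ m.
Proof.
elim: m => [|m IH]; first by rewrite Q0_cos Q0_sin expr1n expr0n/= addr0.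
by rewrite [RHS]exprS -IH QS_cos QS_sin /modsq; ring.
Qed.

Let continuous_cfX m : continuous (cf_cos (Q m)) /\ continuous (cf_sin (Q m)).
Proof.
elim: m => [|m [IHc IHs]].
  have -> : cf_cos (Q 0%N) = cst 1 by apply/funext => s; rewrite Q0_cos.
  have -> : cf_sin (Q 0%N) = cst 0 by apply/funext => s; rewrite Q0_sin.
  by split=> s; exact: cvg_cst.
split=> s.
- have -> : cf_cos (Q m.+1) = (fun s => cf_cos (Q m) s * cf_cos q s - cf_sin (Q m) s * cf_sin q s).
    by apply/funext => ?; rewrite QS_cos.
  apply: cvgB; apply: cvgM; [exact: IHc|exact: continuous_cf_cos|exact: IHs|exact: continuous_cf_sin].
- have -> : cf_sin (Q m.+1) = (fun s => cf_cos (Q m) s * cf_sin q s + cf_sin (Q m) s * cf_cos q s).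
    by apply/funext => ?; rewrite QS_sin.
  apply: cvgD; apply: cvgM; [exact: IHc|exact: continuous_cf_sin|exact: IHs|exact: continuous_cf_cos].
Qed.

Let cf_sinX_le m s : `|cf_sin (Q m) s| <= m%:R * `|cf_sin q s|.
Proof.
elim: m => [|m IH]; first by rewrite Q0_sin normr0 mul0r.
rewrite QS_sin (le_trans (ler_normD _ _))// -natr1 mulrDl mul1r addrC.
rewrite !normrM; apply: lerD; last by rewrite ler_piMl// normr_cf_cos_le1.
by rewrite (le_trans _ IH)// ler_piMr// normr_cf_cos_le1.
Qed.

(** Telescoping comparison of the [m]-th power of a complex number with that of a real one. All
    moduli are at most 1, so each exchanged factor costs its own error once, the imaginary part
    counting as an error. *)
Let cf_cosX_approx m s w : 0 <= w -> w <= 1 ->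
  `|cf_cos (Q m) s - w ^+ m| <= m%:R * (`|cf_cos q s - w| + `|cf_sin q s|).
Proof.
move=> w0 w1; elim: m => [|m IH]; first by rewrite Q0_cos expr0 subrr normr0 mul0r.
have -> : cf_cos (Q m.+1) s - w ^+ m.+1 =
    cf_cos (Q m) s * (cf_cos q s - w) + (cf_cos (Q m) s - w ^+ m) * w
    - cf_sin (Q m) s * cf_sin q s.
  by rewrite QS_cos exprS; ring.
rewrite -natr1 [leRHS]mulrDl mul1r (le_trans (ler_normB _ _))//.
rewrite addrA lerD//; last first.
  by rewrite normrM ler_piMl// normr_cf_sin_le1.
rewrite (le_trans (ler_normD _ _))// addrC lerD//.
  by rewrite normrM ler_piMl// normr_cf_cos_le1.
by rewrite (le_trans _ IH)// normrM (ger0_norm w0) ler_piMr.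
Qed.

(** This is the integral of [cos (u (x - y) / sqrt m)] under [Q m], the frequency being rescaled so
    that a Gaussian limit appears. *)
Let H m u y := let s := u / Num.sqrt m%:R in
  cf_cos (Q m) s * cos (s * y) + cf_sin (Q m) s * sin (s * y).

Let sqrtS_gt0 m : 0 < Num.sqrt m.+1%:R :> R.
Proof. by rewrite sqrtr_gt0 ltr0n. Qed.

Let sqr_sqrtS m : Num.sqrt m.+1%:R ^+ 2 = m.+1%:R :> R.
Proof. by rewrite sqr_sqrtr. Qed.

Let continuous_H m y : continuous (fun u => H m u y).
Proof.
have cM (k : R) : continuous (fun u : R => u / k) /\ continuous (fun u : R => u / k * y).
  have c1 : continuous (fun u : R => u / k).
    by move=> u; apply: cvgM; [exact: cvg_id|exact: cvg_cst].
  by split=> // u; apply: cvgM; [exact: c1|exact: cvg_cst].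
have [c1 c2] := cM (Num.sqrt m%:R); have [cc cs] := continuous_cfX m.
move=> u; apply: cvgD; apply: cvgM.
- by apply: (continuous_comp (c1 u)); exact: cc.
- by apply: (continuous_comp (c2 u)); exact: continuous_cos.
- by apply: (continuous_comp (c1 u)); exact: cs.
- by apply: (continuous_comp (c2 u)); exact: continuous_sin.
Qed.

(** Fourier inversion: insert the integral that defines [fejer], exchange it with the integral over
    [Q], and substitute [u = t * l * sqrt m.+1]. The Jacobian consumes exactly the factors [l] and
    [sqrt m.+1]. *)
Let fejer_transform (l : R) m y : 0 < l ->
  Num.sqrt m.+1%:R * \int[Q m.+1]_x (l * fejer (l * (x - y))) =
  pi^-1 * \int[lebesgue_measure]_(u in `[0, l * Num.sqrt m.+1%:R])
    ((1 - u / (l * Num.sqrt m.+1%:R)) * H m.+1 u y).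
Proof.
move=> l0; set r := Num.sqrt _; have r0 : 0 < r := sqrtS_gt0 m.
pose G (t : R) := (1 - t) * H m.+1 (t * (l * r)) y.
have GE t : G t = \int[Q m.+1]_x ((1 - t) * cos (t * (l * (x - y)))).
  rewrite RintegralZl//; last first.
    apply: (@integrable_bounded _ _ _ 1) => [|x]; last exact: cos_max.
    apply: measurableT_comp; first exact: (continuous_measurable_fun (@continuous_cos R)).
    by apply: measurable_funM => //; apply: measurable_funM => //; exact: measurable_funB.
  congr (_ * _); rewrite /H mulrA mulfK ?gt_eqF//.
  by rewrite -cf_cos_shift; apply: eq_Rintegral => x _; rewrite mulrA.
have -> : \int[Q m.+1]_x (l * fejer (l * (x - y))) =
    l * (pi^-1 * \int[lebesgue_measure]_(t in `[0, 1]) G t).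
  have mf : measurable_fun [set: R * R]
      (fun z : R * R => (1 - z.2) * cos (z.2 * (l * (z.1 - y)))).
    apply: measurable_funM; first exact: measurable_funB.
    apply: measurableT_comp; first exact: (continuous_measurable_fun (@continuous_cos R)).
    by apply: measurable_funM => //; apply: measurable_funM => //; exact: measurable_funB.
  under [in RHS]eq_Rintegral do rewrite GE.
  have := @fubini_bounded_on _ _ _ _ _ (Q m.+1) lebesgue_measure setT `[0, 1]
    measurableT (measurable_itv _) _ _
    (fun x t => (1 - t) * cos (t * (l * (x - y)))) 1 mf.
  move=> <-//; last 3 first.
  - by rewrite (le_lt_trans (probability_le1 _ measurableT))// ltry.
  - by rewrite /= lebesgue_measure_itv/= lte_fin ltr01 oppr0 adde0 ltry.
  - move=> x t _; rewrite /= in_itv/= => /andP[t0 t1].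
    rewrite normrM -[leRHS]mulr1 ler_pM ?cos_max//.
    by rewrite ger0_norm ?subr_ge0// lerBlDr lerDl.
  have ifej : (Q m.+1).-integrable setT (EFin \o (fun x => fejer (l * (x - y)))).
    apply: (@integrable_bounded _ _ _ 1) => [|x].
      apply: measurableT_comp; first exact: measurable_fejer.
      by apply: measurable_funM => //; exact: measurable_funB.
    by rewrite ger0_norm ?fejer_ge0// fejer_le1.
  rewrite RintegralZl//; congr (_ * _).
  have -> : \int[Q m.+1]_x \int[lebesgue_measure]_(t in `[0, 1])
      ((1 - t) * cos (t * (l * (x - y)))) = \int[Q m.+1]_x (pi * fejer (l * (x - y))).
    by apply: eq_Rintegral => x _; rewrite /fejer mulVKf// gt_eqF ?pi_gt0.
  by rewrite RintegralZl// mulKf// gt_eqF ?pi_gt0.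
have lr0 : 0 < l * r by rewrite mulr_gt0.
have cG : continuous G.
  move=> t; apply: cvgM; first by apply: cvgB; [exact: cvg_cst|exact: cvg_id].
  exact: (continuous_scale (@continuous_H m.+1 y)).
rewrite (integral_unit_scale lr0 cG) RintegralZr//; last first.
  apply: continuous_compact_integrable; first exact: segment_compact.
  by apply: continuous_subspaceT; exact: continuous_scale.
have -> : \int[lebesgue_measure]_(u in `[0, l * r]) G (u / (l * r)) =
    \int[lebesgue_measure]_(u in `[0, l * r]) ((1 - u / (l * r)) * H m.+1 u y).
  by apply: eq_Rintegral => u _; rewrite /G divfK// gt_eqF.
set J := Rintegral _ _ _.
have : pi != 0 :> R by rewrite gt_eqF ?pi_gt0.
move: (lt0r_neq0 l0) (lt0r_neq0 r0) (pi : R) => l0' r0' p p0.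
by field; rewrite l0' r0' p0.
Qed.

(** Cauchy-Schwarz, in the form of Lagrange's identity, removes the shift [y] and leaves the
    modulus. Its square is at most [expR (- (k * u ^+ 2))] because [m.+1 * s ^+ 2 = u ^+ 2]; the
    square root halves the rate. *)
Let H_le (l k : R) m u y : 0 < l ->
  (forall s, 0 <= s -> s <= l -> modsq s <= expR (- (k * s ^+ 2))) ->
  0 <= u -> u <= l * Num.sqrt m.+1%:R ->
  `|H m.+1 u y| <= expR (- (k / 2 * u ^+ 2)).
Proof.
move=> l0 hk u0 ul; set r := Num.sqrt _ in ul *; have r0 : 0 < r := sqrtS_gt0 m.
rewrite -ler_sqr ?nnegrE ?expR_ge0// -normrX ger0_norm ?sqr_ge0//.
rewrite /H -/r; set s := u / r; set A := cf_cos _ _; set B := cf_sin _ _.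
rewrite (@le_trans _ _ (A ^+ 2 + B ^+ 2))//.
  have := cos2Dsin2 (s * y); move: (cos _) (sin _) => c d cd.
  rewrite -subr_ge0 (_ : _ - _ = (A * d - B * c) ^+ 2) ?sqr_ge0//.
  by transitivity ((A ^+ 2 + B ^+ 2) * (c ^+ 2 + d ^+ 2) - (A * c + B * d) ^+ 2);
    [rewrite cd mulr1|ring].
rewrite modsqX (@le_trans _ _ (expR (- (k * s ^+ 2)) ^+ m.+1))//.
  rewrite lerXn2r ?nnegrE ?expR_ge0 ?addr_ge0 ?sqr_ge0//.
  by apply: hk; rewrite ?divr_ge0 ?(ltW r0)// ler_pdivrMr.
rewrite -!expRM_natl ler_expR -sqr_sqrtS -/r /s.
suff -> : (r ^+ 2 * - (k * (u / r) ^+ 2)) = 2%:R * - (k / 2 * u ^+ 2) by [].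
by field; rewrite gt_eqF.
Qed.

Let cvg_invsqrt : (Num.sqrt (m.+1%:R : R))^-1 @[m --> \oo] --> (0 : R).
Proof.
rewrite gtr0_cvgV0; last by near=> m; exact: sqrtS_gt0.
apply/cvgryPge => A; near=> m.
rewrite (le_trans (ler_norm A))// -sqrtr_sqr ler_wsqrtr//.
rewrite (@le_trans _ _ m%:R)// ?ler_nat//.
by near: m; exact: nbhs_infty_ger.
Unshelve. all: by end_near. Qed.

(** The real part is compared with [w = expR (- (v * s ^+ 2))], whose power [m.+1] is exactly the
    Gaussian limit. One factor errs by order [s^3], so [m.+1] of them err by order [1 / sqrt m.+1],
    as does the twist [cos (s y) - 1]; [K] collects the constants. *)
Let H_cvg u y : 0 <= u ->
  H m.+1 u y @[m --> \oo] --> expR (- (sigma ^+ 2 / 2 * u ^+ 2)).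
Proof.
move=> u0; pose v := sigma ^+ 2 / 2; set E := expR _.
have v0 : 0 <= v by rewrite divr_ge0 ?sqr_ge0.
pose K := u ^+ 4 * (moment 4 + v ^+ 2) + 2 * (u ^+ 3 * moment 3) + u * `|y|.
apply/subr_cvg0/norm_cvg0P.
apply: (@squeeze_cvgr _ _ _ _ (cst 0) (fun m => K * (Num.sqrt m.+1%:R)^-1)); last 2 first.
- exact: cvg_cst.
- by rewrite -(mulr0 K); apply: cvgM; [exact: cvg_cst|exact: cvg_invsqrt].
near=> m; rewrite normr_ge0/= /H; set r := Num.sqrt _; set s := u / r.
have r0 : 0 < r := sqrtS_gt0 m.
have r2 : r ^+ 2 = m.+1%:R := sqr_sqrtS m.
have r1 : 1 <= r by rewrite -sqrtr1 ler_wsqrtr// ler1n.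
have s0 : 0 <= s by rewrite divr_ge0// ltW.
pose w := expR (- (v * s ^+ 2)).
have vs : 0 <= v * s ^+ 2 by rewrite mulr_ge0 ?sqr_ge0.
have wE : w ^+ m.+1 = E.
  by rewrite /w /E -expRM_natl -r2 /s -/v; congr expR; field; rewrite gt_eqF.
have w1 : w <= 1 by rewrite -expR0 ler_expR oppr_le0.
have cw : `|cf_cos q s - w| <= s ^+ 4 * (moment 4 + v ^+ 2).
  have -> : cf_cos q s - w = (cf_cos q s - (1 - v * s ^+ 2)) - (w - (1 - v * s ^+ 2)) by ring.
  rewrite (le_trans (ler_normB _ _))// mulrDr lerD//.
    have -> : v * s ^+ 2 = sigma ^+ 2 * s ^+ 2 / 2 by rewrite /v; ring.
    exact: cf_cos_taylor.
  rewrite (le_trans (expRN_quad vs))//.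
  have : 0 <= s ^+ 4 * v ^+ 2 by rewrite mulr_ge0 ?exprn_ge0.
  have -> : (v * s ^+ 2) ^+ 2 = s ^+ 4 * v ^+ 2 by ring.
  lra.
have sn : `|cf_sin q s| <= s ^+ 3 * moment 3.
  by have := cf_sin_taylor s; rewrite (ger0_norm s0).
have h1 : `|cf_cos (Q m.+1) s - E| <= m.+1%:R * (s ^+ 4 * (moment 4 + v ^+ 2) + s ^+ 3 * moment 3).
  by rewrite -wE (le_trans (cf_cosX_approx _ _ _ _))// ?expR_ge0// ler_wpM2l// lerD.
have h2 : `|cf_sin (Q m.+1) s| <= m.+1%:R * (s ^+ 3 * moment 3).
  by rewrite (le_trans (cf_sinX_le _ _))// ler_wpM2l.
have h3 : `|cos (s * y) - 1| <= s * `|y|.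
  by rewrite -cos0 (le_trans (normr_cosB_le _ _))// subr0 normrM ger0_norm.
have E1 : `|E| <= 1.
  by rewrite ger0_norm ?expR_ge0// -wE exprn_ile1// expR_ge0.
have -> : cf_cos (Q m.+1) s * cos (s * y) + cf_sin (Q m.+1) s * sin (s * y) - E =
  (cf_cos (Q m.+1) s - E) * cos (s * y) + E * (cos (s * y) - 1) +
  cf_sin (Q m.+1) s * sin (s * y) by ring.
rewrite (@le_trans _ _ (m.+1%:R * (s ^+ 4 * (moment 4 + v ^+ 2) + s ^+ 3 * moment 3) +
  s * `|y| + m.+1%:R * (s ^+ 3 * moment 3)))//.
  rewrite (le_trans (ler_normD _ _))// lerD//; last first.
    by rewrite normrM (le_trans _ h2)// ler_piMr// sin_max.
  rewrite (le_trans (ler_normD _ _))// lerD//.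
    by rewrite normrM (le_trans _ h1)// ler_piMr// cos_max.
  by rewrite normrM (le_trans _ h3)// ler_piMl.
rewrite -r2 -/r /K.
have -> : r ^+ 2 * (s ^+ 4 * (moment 4 + v ^+ 2) + s ^+ 3 * moment 3) + s * `|y| +
    r ^+ 2 * (s ^+ 3 * moment 3) =
  (u ^+ 4 * (moment 4 + v ^+ 2) * r^-1 + 2 * (u ^+ 3 * moment 3) + u * `|y|) / r.
  by rewrite /s; field; rewrite gt_eqF.
rewrite ler_pM2r ?invr_gt0// !lerD2r ler_piMr ?invf_le1//.
by rewrite mulr_ge0 ?exprn_ge0// addr_ge0 ?sqr_ge0 ?moment_ge0.
Unshelve. all: by end_near. Qed.

(** Uniformity in the translate [y] is what later permits dominated convergence in [y]; it is
    inherited from [H_le], whose bound does not involve [y]. *)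
Lemma fejer_bounded (l : R) : 0 < l -> exists C : R, forall m y,
  Num.sqrt m.+1%:R * \int[Q m.+1]_x (l * fejer (l * (x - y))) <= C.
Proof.
move=> l0; have [k k0 hk] := cf_sq_le l0.
pose C := pi^-1 * \int[lebesgue_measure]_u expR (- (k / 2 * u ^+ 2)).
have k20 : 0 < k / 2 by rewrite divr_gt0.
exists C => m y; rewrite fejer_transform// ler_pM2l ?invr_gt0 ?pi_gt0//.
have lr0 := mulr_gt0 l0 (sqrtS_gt0 m); set L := l * _ in lr0 *.
have ci : lebesgue_measure.-integrable `[0, L]
    (EFin \o (fun u => (1 - u / L) * H m.+1 u y)).
  apply: continuous_compact_integrable; first exact: segment_compact.
  apply: continuous_subspaceT => u; apply: cvgM; last exact: continuous_H.
  apply: cvgB; first exact: cvg_cst.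
  by apply: cvgM; [exact: cvg_id|exact: cvg_cst].
have gi := integrable_gauss_scaled k20.
rewrite (@le_trans _ _ (\int[lebesgue_measure]_(u in `[0, L]) expR (- (k / 2 * u ^+ 2))))//.
  apply: le_Rintegral => //; first exact: (integrableS _ _ _ gi).
  move=> u; rewrite /= in_itv/= => /andP[u0 uL].
  rewrite (le_trans (ler_norm _))// normrM -[leRHS]mul1r ler_pM//.
    by rewrite ger0_norm ?subr_ge0 ?ler_pdivrMr ?mul1r// lerBlDr lerDl divr_ge0// ltW.
  exact: H_le uL.
rewrite /Rintegral fine_le//; try exact: integrable_fin_num.
- by apply: integrable_fin_num => //; exact: (integrableS _ _ _ gi).
- apply: ge0_subset_integral => //.
  by apply/measurable_EFinP; exact: measurable_gauss_scaled.
Qed.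

(** Dominated convergence in [fejer_transform], the integrand being extended by 0 beyond
    [l * sqrt m.+1]. The triangle factor tends to 1, so [l] disappears from the limit, a Gaussian
    integral over the half-line. *)
Lemma fejer_cvg (l y : R) : 0 < l ->
  Num.sqrt m.+1%:R * \int[Q m.+1]_x (l * fejer (l * (x - y))) @[m --> \oo] -->
  (sigma * Num.sqrt (2 * pi))^-1.
Proof.
move=> l0; have [k k0 hk] := cf_sq_le l0.
have k20 : 0 < k / 2 by rewrite divr_gt0.
have v0 : 0 < sigma ^+ 2 / 2 by rewrite divr_gt0// exprn_gt0.
pose L m := l * Num.sqrt (m.+1%:R : R).
have L0 m : 0 < L m by rewrite mulr_gt0.
pose g m u := (1 - u / L m) * H m.+1 u y.
have cg m : continuous (g m).
  move=> u; apply: cvgM; last exact: continuous_H.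
  apply: cvgB; first exact: cvg_cst.
  by apply: cvgM; [exact: cvg_id|exact: cvg_cst].
have invL_cvg : (L m)^-1 @[m --> \oo] --> 0.
  under eq_fun do rewrite /L invfM.
  by rewrite -(mulr0 l^-1); apply: cvgM; [exact: cvg_cst|exact: cvg_invsqrt].
pose f m u : \bar R := ((g m \_ `[0, L m]) u)%:E.
pose f_lim u : \bar R :=
  (((fun u => expR (- (sigma ^+ 2 / 2 * u ^+ 2))) \_ `[0%R, +oo[) u)%:E.
have f_cvg u : f ^~ u @ \oo --> f_lim u.
  apply: cvg_EFin; first exact: nearW.
  rewrite /f_lim /=; have [u0|u0] := ltP u 0.
    rewrite patchE ifF; last by rewrite mem_setE in_itv/= leNgt u0.
    rewrite (_ : fine \o _ = cst point); first exact: cvg_cst.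
    by apply/funext => m; rewrite /f/= patchE ifF// mem_setE in_itv/= leNgt u0.
  rewrite patchE ifT; last by rewrite mem_setE in_itv/= u0.
  apply: (@cvg_trans _ (g m u @[m --> \oo])).
    have uL_cvg : u / L m @[m --> \oo] --> 0.
      by rewrite -(mulr0 u); apply: cvgM; [exact: cvg_cst|exact: invL_cvg].
    apply: near_eq_cvg; near=> m; rewrite /f/= patchE ifT// mem_setE in_itv/= u0/=.
    rewrite -[leRHS]mul1r -ler_pdivrMr// ltW//.
    by near: m; apply: (cvgr_lt _ uL_cvg).
  have : g m u @[m --> \oo] --> (1 - 0) * expR (- (sigma ^+ 2 / 2 * u ^+ 2)).
    apply: cvgM; last exact: H_cvg.
    apply: cvgB; first exact: cvg_cst.
    by rewrite -[X in _ --> X](mulr0 u); apply: cvgM; [exact: cvg_cst|exact: invL_cvg].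
  by rewrite subr0 mul1r.
have f_dom m u : (`|f m u| <= (expR (- (k / 2 * u ^+ 2)))%:E)%E.
  rewrite /f lee_fin patchE; case: ifPn => [|_]; last by rewrite normr0 expR_ge0.
  rewrite mem_setE in_itv/= => /andP[u0 uL].
  rewrite normrM -[leRHS]mul1r ler_pM//; last exact: H_le uL.
  by rewrite ger0_norm ?subr_ge0 ?ler_pdivrMr ?mul1r// lerBlDr lerDl divr_ge0// ltW.
have f_int m : (\int[lebesgue_measure]_u f m u =
    (Num.sqrt m.+1%:R * \int[Q m.+1]_x (l * fejer (l * (x - y))) * pi)%:E)%E.
  rewrite fejer_transform// mulrC mulVKf ?gt_eqF ?pi_gt0//.
  rewrite /Rintegral fineK; last first.
    apply: integrable_fin_num => //; apply: continuous_compact_integrable.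
      exact: segment_compact.
    by apply: continuous_subspaceT; exact: (cg m).
  by rewrite [RHS]integral_mkcond; apply: eq_integral => u _; rewrite /f !patchE; case: ifPn.
have f_lim_int : (\int[lebesgue_measure]_u f_lim u =
    (pi * (sigma * Num.sqrt (2 * pi))^-1)%:E)%E.
  transitivity (Num.sqrt (pi / (sigma ^+ 2 / 2)) / 2)%:E.
    rewrite -integral0y_gauss_scaled// [RHS]integral_mkcond.
    by apply: eq_integral => u _; rewrite /f_lim !patchE; case: ifPn.
  congr EFin.
  have p0 : 0 < pi :> R by exact: pi_gt0.
  have r0 : 0 < Num.sqrt (2 * pi) :> R by rewrite sqrtr_gt0 mulr_gt0.
  have rr : Num.sqrt (2 * pi) ^+ 2 = 2 * pi :> R by rewrite sqr_sqrtr// mulr_ge0// ltW.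
  have -> : pi / (sigma ^+ 2 / 2) = (2 * pi) / sigma ^+ 2 :> R.
    by move: (pi : R) => p; field; rewrite gt_eqF.
  rewrite sqrtrM ?mulr_ge0 ?(ltW p0)// sqrtrV ?sqr_ge0// sqrtr_sqr gtr0_norm//.
  move: r0 rr; move: (Num.sqrt _) => r r0 rr.
  have -> : pi = r ^+ 2 / 2 :> R by rewrite rr mulrAC divff ?mul1r.
  by field; rewrite !gt_eqF.
have gi := integrable_gauss_scaled k20.
have mf m : measurable_fun [set: R] (f m).
  apply/measurable_EFinP; apply/(measurable_restrictT _ (measurable_itv _)).
  by apply: measurable_funTS; apply: continuous_measurable_fun; exact: cg.
have := @dominated_cvg _ _ _ (@lebesgue_measure R) setT measurableT f f_lim
  (fun u => (expR (- (k / 2 * u ^+ 2)))%:E) mf (fun u _ => f_cvg u) (fun _ _ => isT) gi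
  (fun m u _ => f_dom m u).
rewrite f_lim_int; under eq_fun do rewrite f_int.
move=> /fine_cvg/= h.
have p0 : pi != 0 :> R by rewrite gt_eqF ?pi_gt0.
have -> : (sigma * Num.sqrt (2 * pi))^-1 = pi / (sigma * Num.sqrt (2 * pi)) * pi^-1.
  by rewrite mulrAC divff// mul1r.
rewrite (_ : (fun m => _) = (fun m => Num.sqrt m.+1%:R *
   \int[Q m.+1]_x (l * fejer (l * (x - y))) * pi * pi^-1)); last first.
  by apply/funext => m; rewrite mulfK.
by apply: cvgM; [exact: h|exact: cvg_cst].
Unshelve. all: by end_near. Qed.

End local_limit.

(** * Smoothing *)

Section scaled_fejer_kernel.
Context {R : realType}.
Notation mu := (@lebesgue_measure R).
Implicit Types (l x y : R).

Definition scaled_fejer l x := l * fejer (l * x).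

Lemma scaled_fejer_ge0 l x : 0 < l -> 0 <= scaled_fejer l x.
Proof. by move=> l0; rewrite mulr_ge0 ?fejer_ge0// ltW. Qed.

Lemma scaled_fejer_le l x : 0 < l -> scaled_fejer l x <= l.
Proof. by move=> l0; rewrite ler_piMr ?fejer_le1// ltW. Qed.

Lemma scaled_fejerN l x : scaled_fejer l (- x) = scaled_fejer l x.
Proof. by rewrite /scaled_fejer mulrN fejerN. Qed.

Lemma scaled_fejer_le_sq l x : 0 < l -> x != 0 -> scaled_fejer l x <= 2 / (pi * l * x ^+ 2).
Proof.
move=> l0 x0; have lx0 : l * x != 0 by rewrite mulf_neq0// gt_eqF.
rewrite (@le_trans _ _ (l * (2 / (pi * (l * x) ^+ 2))))//.
  by rewrite ler_wpM2l ?fejer_le// ltW.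
have : pi != 0 :> R by rewrite gt_eqF ?pi_gt0.
by move: (pi : R) => p p0; rewrite le_eqVlt; apply/orP; left; apply/eqP;
  field; rewrite p0 x0 gt_eqF.
Qed.

Lemma measurable_scaled_fejer l : measurable_fun [set: R] (scaled_fejer l).
Proof.
apply: measurable_funM => //; apply: measurableT_comp; first exact: measurable_fejer.
exact: measurable_funM.
Qed.

Lemma measurable_scaled_fejerB l :
  measurable_fun [set: R * R] (fun z => scaled_fejer l (z.1 - z.2)).
Proof.
by apply: measurableT_comp; [exact: measurable_scaled_fejer|exact: measurable_funB].
Qed.

Lemma integral_affine (G : R -> R) l x : 0 < l -> continuous G ->
  (forall u, 0 <= G u) ->
  (\int[mu]_y (l * G (l * (y - x)))%:E = \int[mu]_u (G u)%:E)%E.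
Proof.
move=> l0 cG G0; pose F y := l * (y - x).
have dF y : is_derive y 1 F l.
  by apply: is_derive_eq; rewrite /GRing.scale/=; ring.
have F'E : F^`()%classic = cst l by apply/funext => u; rewrite derive1E derive_val.
rewrite [RHS](@increasing_ge0_integration_by_substitutionT _ F)//.
- by apply: eq_integral => y _; rewrite F'E /= mulrC.
- by move=> u v uv; rewrite /F ltr_pM2l// ltrD2r.
- by rewrite F'E => u; exact: cvg_cst.
- by rewrite F'E; exact: is_cvg_cst.
- by rewrite F'E; exact: is_cvg_cst.
- by apply/gt0_cvgMrNy; last exact: cvg_addrr_Ny.
- by apply/gt0_cvgMry; last exact: cvg_addrr.
Qed.

Lemma integral_scaled_fejer l x : 0 < l -> (\int[mu]_y (scaled_fejer l (x - y))%:E = 1)%E.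
Proof.
move=> l0; rewrite -(@integral_fejer R) -(integral_affine x l0); last 2 first.
- exact: continuous_fejer.
- exact: fejer_ge0.
by apply: eq_integral => y _; rewrite -scaled_fejerN opprB.
Qed.

Lemma integral_oneDsqrV : (\int[mu]_u ((1 + u ^+ 2)^-1)%:E = pi%:E)%E.
Proof.
rewrite ge0_symfun_integralT; last 3 first.
- by move=> u; rewrite invr_ge0 addr_ge0 ?sqr_ge0.
- exact: continuous_oneDsqrV.
- by move=> u; rewrite /= sqrrN.
rewrite -set_itvcy (integral0y_oneDsqr R) -EFinM; congr EFin.
by rewrite mulrC divfK.
Qed.

(** The kernel is at most [2 / (pi l z^2)], and [z^(-2) <= (1 + eta^(-2)) / (1 + z^2)] for
    [|z| > eta]. The mass [pi] of the Cauchy weight cancels the [pi] of the kernel. *)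
Lemma integral_scaled_fejer_tail l (eta : R) x : 0 < l -> 0 < eta ->
  (\int[mu]_(y in [set y | (eta < `|x - y|)%R]) (scaled_fejer l (x - y))%:E <=
   (2 * (1 + eta ^- 2) / l)%:E)%E.
Proof.
move=> l0 eta0; set D := [set y | _]; pose c := 2 * (1 + eta ^- 2) / (pi * l).
have pl0 : 0 < pi * l by rewrite mulr_gt0// pi_gt0.
have c0 : 0 <= c.
  by rewrite divr_ge0 ?(ltW pl0)// mulr_ge0// addr_ge0// invr_ge0 sqr_ge0.
have mD : measurable D.
  have -> : D = (fun y => `|x - y|) @^-1` `]eta, +oo[.
    by apply/seteqP; split=> y; rewrite /D/= in_itv/= andbT.
  have mn : measurable_fun [set: R] (fun y : R => `|x - y|).
    by apply: measurableT_comp; [exact: normr_measurable|exact: measurable_funB].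
  by rewrite -[X in measurable X]setTI; exact: (mn measurableT _ (measurable_itv _)).
have mg : measurable_fun [set: R] (fun y => (1 + (y - x) ^+ 2)^-1).
  apply: (measurableT_comp (continuous_measurable_fun (@continuous_oneDsqrV R))).
  exact: measurable_funB.
have gE : (\int[mu]_y ((1 + (y - x) ^+ 2)^-1)%:E = pi%:E)%E.
  rewrite -integral_oneDsqrV -(@integral_affine (fun u => (1 + u ^+ 2)^-1) 1 x)//.
  - by apply: eq_integral => y _; rewrite !mul1r.
  - exact: continuous_oneDsqrV.
  - by move=> u; rewrite invr_ge0 addr_ge0 ?sqr_ge0.
apply: (@le_trans _ _ (\int[mu]_(y in D) (c%:E * ((1 + (y - x) ^+ 2)^-1)%:E))%E).
  apply: ge0_le_integral => //.
  - by move=> y _; rewrite lee_fin scaled_fejer_ge0.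
  - apply/measurable_EFinP; apply: measurable_funTS.
    exact: (measurableT_comp (measurable_scaled_fejerB l) (measurable_pair1 x)).
  - by apply/measurable_EFinP; apply: measurable_funM => //; exact: measurable_funTS.
  - move=> y /= ey; rewrite -EFinM lee_fin.
    have xy0 : x - y != 0 by rewrite -normr_gt0 (lt_trans eta0).
    rewrite (le_trans (scaled_fejer_le_sq l0 xy0))//.
    have -> : (y - x) ^+ 2 = (x - y) ^+ 2 by ring.
    have d0 : 0 < (x - y) ^+ 2 by rewrite exprn_even_gt0.
    rewrite ler_pdivrMr ?(mulr_gt0 pl0 d0)// /c.
    have -> : 2 * (1 + eta ^- 2) / (pi * l) / (1 + (x - y) ^+ 2) * (pi * l * (x - y) ^+ 2) =
        2 * ((1 + eta ^- 2) * (x - y) ^+ 2 / (1 + (x - y) ^+ 2)).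
      move: (pi * l) pl0 => pl pl0; field.
      by rewrite !gt_eqF// ?addr_gt0.
    rewrite ler_peMr// ler_pdivlMr ?addr_gt0// mul1r mulrDl mul1r addrC lerD2l.
    rewrite mulrC ler_pdivlMr ?exprn_gt0// mul1r -[leRHS]ger0_norm ?sqr_ge0// normrX.
    by rewrite lerXn2r ?nnegrE// ltW.
rewrite ge0_integralZl_EFin//; last 2 first.
- by move=> y _; rewrite lee_fin invr_ge0 addr_ge0 ?sqr_ge0.
- by apply/measurable_EFinP; exact: measurable_funTS.
apply: (@le_trans _ _ (c%:E * pi%:E)%E).
  rewrite lee_wpmul2l ?lee_fin// -gE; apply: ge0_subset_integral => //.
  - exact/measurable_EFinP.
  - by move=> y _; rewrite lee_fin invr_ge0 addr_ge0 ?sqr_ge0.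
rewrite -EFinM lee_fin /c.
have : pi != 0 :> R by rewrite gt_eqF ?pi_gt0.
by move: (pi : R) => p p0; rewrite le_eqVlt; apply/orP; left; apply/eqP;
  field; rewrite p0 !gt_eqF.
Qed.

End scaled_fejer_kernel.

Section renewal_type_limit.
Context {R : realType} (Q : nat -> probability R R) (ell theta : R).
Notation mu := (@lebesgue_measure R).
Hypotheses (ell_gt0 : 0 < ell) (theta_gt0 : 0 < theta)
  (scaled_fejer_bounded : forall l, 0 < l -> exists C : R, forall m y,
     Num.sqrt m.+1%:R * \int[Q m.+1]_x scaled_fejer l (x - y) <= C)
  (scaled_fejer_cvg : forall l y, 0 < l ->
     Num.sqrt m.+1%:R * \int[Q m.+1]_x scaled_fejer l (x - y) @[m --> \oo] --> ell).
Implicit Types (l x y c : R).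

(** Extended-real valued, so that nonnegative functions need no integrability proof. The index [m]
    stands for [m.+1] summands, which keeps the factor positive. *)
Definition scaled_integral m (h : R -> \bar R) : \bar R :=
  ((Num.sqrt m.+1%:R)%:E * \int[Q m.+1]_x h x)%E.

Lemma le_scaled_integral m (f h : R -> \bar R) :
  measurable_fun [set: R] f -> measurable_fun [set: R] h ->
  (forall x, (0 <= f x)%E) -> (forall x, (f x <= h x)%E) ->
  (scaled_integral m f <= scaled_integral m h)%E.
Proof.
move=> mf mh f0 fh; rewrite lee_wpmul2l ?lee_fin//.
by apply: ge0_le_integral => // x _; exact: le_trans (f0 x) (fh x).
Qed.

Lemma scaled_integralD m (f h : R -> \bar R) :
  measurable_fun [set: R] f -> measurable_fun [set: R] h ->
  (forall x, (0 <= f x)%E) -> (forall x, (0 <= h x)%E) ->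
  (scaled_integral m (fun x => f x + h x) =
   scaled_integral m f + scaled_integral m h)%E.
Proof.
move=> mf mh f0 h0; rewrite /scaled_integral ge0_integralD// ge0_muleDr//.
- exact: integral_ge0.
- exact: integral_ge0.
Qed.

Lemma scaled_integralZl m k (f : R -> \bar R) : 0 <= k ->
  measurable_fun [set: R] f -> (forall x, (0 <= f x)%E) ->
  (scaled_integral m (fun x => k%:E * f x) = k%:E * scaled_integral m f)%E.
Proof.
by move=> k0 mf f0; rewrite /scaled_integral ge0_integralZl_EFin// muleCA.
Qed.

Lemma integrable_scaled_fejerB m l y : 0 < l ->
  (Q m).-integrable [set: R] (EFin \o (fun x => scaled_fejer l (x - y))).
Proof.
move=> l0; apply: (@integrable_bounded _ _ _ l) => [|x].
  exact: (measurableT_comp (measurable_scaled_fejerB l) (measurable_pair2 y)).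
by rewrite ger0_norm ?scaled_fejer_ge0// scaled_fejer_le.
Qed.

Section smoothing.
Variables (B : set R) (g : R -> R).
Hypotheses (mB : measurable B) (mg : measurable_fun [set: R] g)
  (g0 : forall y, 0 <= g y) (ig : mu.-integrable B (EFin \o g)).

Definition smoothing l x : \bar R := (\int[mu]_(y in B) (g y * scaled_fejer l (x - y))%:E)%E.

Let mgk l : measurable_fun [set: R * R] (fun z => g z.2 * scaled_fejer l (z.1 - z.2)).
Proof.
apply: measurable_funM; last exact: measurable_scaled_fejerB.
exact: (measurableT_comp mg).
Qed.

Lemma measurable_smoothing l : 0 < l -> measurable_fun [set: R] (smoothing l).
Proof.
move=> l0; apply: (@measurable_integral_on _ _ _ _ _ mu B mB
  (fun x y => g y * scaled_fejer l (x - y)) (mgk l)) => x y _.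
by rewrite mulr_ge0// scaled_fejer_ge0.
Qed.

Lemma smoothing_ge0 l x : 0 < l -> (0 <= smoothing l x)%E.
Proof. by move=> l0; apply: integral_ge0 => y _; rewrite lee_fin mulr_ge0// scaled_fejer_ge0. Qed.

(** Tonelli brings the [Q]-integral inside, where it meets a translate of the kernel only: [a m y]
    tends to [ell] for each [y] and is bounded by a constant, so [C * g] dominates. *)
Lemma smoothing_cvg l : 0 < l ->
  scaled_integral m (smoothing l) @[m --> \oo] --> (ell * \int[mu]_(y in B) g y)%:E.
Proof.
move=> l0; pose a m y := Num.sqrt m.+1%:R * \int[Q m.+1]_x scaled_fejer l (x - y).
have a0 m y : 0 <= a m y.
  by rewrite mulr_ge0//; apply: Rintegral_ge0 => x _; exact: scaled_fejer_ge0.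
pose b m y := (\int[Q m.+1]_x (g y * scaled_fejer l (x - y))%:E)%E.
have mb m : measurable_fun [set: R] (b m).
  have := @measurable_integral_on _ _ _ _ _ (Q m.+1) setT measurableT
    (fun y x => g y * scaled_fejer l (x - y)).
  apply; last by move=> y x _; rewrite mulr_ge0// scaled_fejer_ge0.
  apply: measurable_funM; first exact: (measurableT_comp mg).
  by apply: measurableT_comp; [exact: measurable_scaled_fejer|exact: measurable_funB].
have b0 m y : (0 <= b m y)%E.
  by apply: integral_ge0 => x _; rewrite lee_fin mulr_ge0// scaled_fejer_ge0.
have abE m y : (g y * a m y)%:E = ((Num.sqrt m.+1%:R)%:E * b m y)%E.
  rewrite /b; under eq_integral do rewrite EFinM.
  rewrite ge0_integralZl_EFin//; last 2 first.
  - by move=> x _; rewrite lee_fin scaled_fejer_ge0.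
  - apply/measurable_EFinP.
    exact: (measurableT_comp (measurable_scaled_fejerB l) (measurable_pair2 y)).
  rewrite /a /Rintegral muleCA 2!EFinM fineK//.
  by apply: integrable_fin_num => //; exact: integrable_scaled_fejerB.
have mab m : measurable_fun [set: R] (fun y => (g y * a m y)%:E).
  by under eq_fun do rewrite abE; exact: measurable_funeM.
have aE m : (scaled_integral m (smoothing l) = \int[mu]_(y in B) (g y * a m y)%:E)%E.
  rewrite /scaled_integral (@tonelli_on _ _ _ _ _ (Q m.+1) mu _ _ measurableT mB
    (fun x y => g y * scaled_fejer l (x - y)) (mgk l)); last first.
    by move=> x y _ _; rewrite mulr_ge0// scaled_fejer_ge0.
  rewrite -/(b m) -ge0_integralZl_EFin//.
  - by apply: eq_integral => y _; rewrite abE.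
  - by move=> y _; exact: b0.
  - by apply: measurable_funTS; exact: mb.
under eq_fun do rewrite aE.
have [C hC] := scaled_fejer_bounded l0.
have -> : (ell * \int[mu]_(y in B) g y)%:E = (\int[mu]_(y in B) (g y * ell)%:E)%E.
  rewrite mulrC EFinM /Rintegral fineK; last exact: integrable_fin_num.
  by rewrite -integralZr.
apply: (@dominated_cvg _ _ _ mu _ mB (fun m y => (g y * a m y)%:E)
  (fun y => (g y * ell)%:E) (fun y => (C * g y)%:E)) => //.
- move=> m; exact: (measurable_funTS (mab m)).
- move=> y By; apply: cvg_EFin; first exact: nearW.
  by apply: cvgM; [exact: cvg_cst|exact: scaled_fejer_cvg].
- by apply: (integrable_mulrl C _ ig).
- move=> m y By; rewrite lee_fin ger0_norm; last exact: mulr_ge0 (g0 y) (a0 m y).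
  by rewrite mulrC ler_wpM2r//; exact: hC.
Qed.

End smoothing.

(** The kernel itself cannot dominate the Cauchy weight, as it vanishes at the nonzero multiples of
    [2 pi]. Its translate by [pi] fills these zeros, since [(1 - cos x) + (1 + cos x) = 2]. *)
Lemma cauchy_weight_bounded : exists C : R, forall m,
  (scaled_integral m (fun x => ((1 + x ^+ 2)^-1)%:E) <= C%:E)%E.
Proof.
have [C hC] := scaled_fejer_bounded ltr01.
(* The factor [2 + 2 * pi ^+ 2] bounds [(1 + (x - pi)^2) / (1 + x^2)]. *)
pose A : R := pi * (2 + 2 * pi ^+ 2) / 2.
exists (A * (C + C)) => m.
have p0 : 0 < pi :> R by exact: pi_gt0.
have k1 x : (1 + x ^+ 2)^-1 <= A * (scaled_fejer 1 (x - 0) + scaled_fejer 1 (x - pi)).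
  rewrite subr0 /scaled_fejer !mul1r.
  have h1 := le_fejer x; have h2 := le_fejer (x - pi).
  have x20 := sqr_ge0 x; have p20 := sqr_ge0 (pi : R).
  have cx : cos (x - pi) = - cos x by rewrite cosB cospi sinpi mulr0 addr0 mulrN1.
  rewrite cx opprK in h2.
  have x21 : 0 < 1 + x ^+ 2 by rewrite ltr_wpDr.
  have y21 : 0 < 1 + (x - pi) ^+ 2 by rewrite ltr_wpDr ?sqr_ge0.
  pose a : R := 2 + 2 * pi ^+ 2.
  have a1 : 1 + (x - pi) ^+ 2 <= a * (1 + x ^+ 2).
    have := sqr_ge0 (x + pi); have := mulr_ge0 x20 p20; rewrite /a; nra.
  have a0 : 1 <= a by rewrite /a; lra.
  have a_gt0 : 0 < a by lra.
  have D0 : 0 < pi * (a * (1 + x ^+ 2)) := mulr_gt0 p0 (mulr_gt0 a_gt0 x21).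
  have k1 : (1 - cos x) / (pi * (a * (1 + x ^+ 2))) <= fejer x.
    rewrite (le_trans _ h1)// ler_wpM2l ?subr_ge0 ?cos_le1//.
    rewrite lef_pV2 ?posrE//; last exact: mulr_gt0.
    by rewrite ler_pM2l// ler_peMl// ltW.
  have k2 : (1 + cos x) / (pi * (a * (1 + x ^+ 2))) <= fejer (x - pi).
    rewrite (le_trans _ h2)// ler_wpM2l//.
    rewrite lef_pV2 ?posrE//; last exact: mulr_gt0.
    by rewrite ler_pM2l.
  have A0 : 0 <= A by rewrite divr_ge0// mulr_ge0// ltW.
  rewrite (le_trans _ (ler_wpM2l A0 (lerD k1 k2)))// -mulrDl /A -/a.
  have p0' : pi != 0 :> R by rewrite gt_eqF.
  rewrite le_eqVlt; apply/orP; left; apply/eqP.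
  move: (1 + x ^+ 2) x21 (a) a_gt0 (pi : R) p0' => b b0 a' a'0 p p0'.
  by field; rewrite p0' !gt_eqF.
have A0 : 0 <= A by rewrite divr_ge0// mulr_ge0 ?(ltW p0)// addr_ge0// mulr_ge0// sqr_ge0.
have mk y : measurable_fun [set: R] (fun x => (scaled_fejer 1 (x - y))%:E).
  apply/measurable_EFinP.
  exact: (measurableT_comp (measurable_scaled_fejerB 1) (measurable_pair2 y)).
have kle y : (scaled_integral m (fun x => (scaled_fejer 1 (x - y))%:E) <= C%:E)%E.
  have -> : scaled_integral m (fun x => (scaled_fejer 1 (x - y))%:E) =
      (Num.sqrt m.+1%:R * \int[Q m.+1]_x scaled_fejer 1 (x - y))%:E.
    rewrite EFinM /Rintegral fineK//.
    by apply: integrable_fin_num => //; exact: integrable_scaled_fejerB.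
  by rewrite lee_fin; exact: hC.
have k0 y x : (0 <= (scaled_fejer 1 (x - y))%:E)%E by rewrite lee_fin scaled_fejer_ge0.
apply: (@le_trans _ _ (scaled_integral m (fun x => A%:E *
    ((scaled_fejer 1 (x - 0))%:E + (scaled_fejer 1 (x - pi))%:E))%E)).
  apply: le_scaled_integral => //.
  - apply/measurable_EFinP.
    exact: (continuous_measurable_fun (@continuous_oneDsqrV R)).
  - by apply: measurable_funeM; apply: emeasurable_funD.
  - by move=> x; rewrite lee_fin invr_ge0 addr_ge0 ?sqr_ge0.
rewrite scaled_integralZl//; last 2 first.
- exact: emeasurable_funD.
- by move=> x; rewrite adde_ge0.
rewrite scaled_integralD// [leRHS]EFinM EFinD.
by apply: lee_wpmul2l; [rewrite lee_fin|exact: leeD].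
Qed.

Let g y := expR (- (theta * y)).

Let cg : continuous g.
Proof.
move=> y; apply: continuous_comp; last exact: continuous_expR.
by apply: cvgN; apply: cvgM; [exact: cvg_cst|exact: cvg_id].
Qed.

Let mg : measurable_fun [set: R] g.
Proof. by apply: continuous_measurable_fun; exact: cg. Qed.

Let g_ge0 y : 0 <= g y. Proof. exact: expR_ge0. Qed.

Let G y := - g y / theta.

Let dG y : is_derive y 1 G (g y).
Proof.
apply: is_derive_eq; rewrite /GRing.scale/= /g.
by field; rewrite gt_eqF.
Qed.

Let continuous_G y : {for y, continuous G}.
Proof. by apply/differentiable_continuous/derivable1_diffP; exact: ex_derive. Qed.

Let integral_g_tail c : (\int[mu]_(y in `[c, +oo[) (g y)%:E = (g c / theta)%:E)%E.
Proof.
rewrite (@ge0_continuous_FTC2y _ _ G _ 0)//.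
- by rewrite -EFinB /G sub0r mulNr opprK.
- by apply: continuous_subspaceT; exact: cg.
- rewrite -(mul0r theta^-1) -oppr0; apply: cvgM; last exact: cvg_cst.
  by apply: cvgN; exact: cvg_expRN_scaled.
- exact/cvg_at_right_filter/continuous_G.
- by move=> y _; have dGy := dG y; rewrite derive1E derive_val.
Qed.

Let integral_g_segment c D : c < D ->
  (\int[mu]_(y in `[c, D]) (g y)%:E = ((g c - g D) / theta)%:E)%E.
Proof.
move=> cD; rewrite (@continuous_FTC2 _ _ G)//.
- by rewrite -EFinB /G; congr EFin; ring.
- by apply: continuous_subspaceT; exact: cg.
- split=> //.
  + exact/cvg_at_right_filter/continuous_G.
  + exact/cvg_at_left_filter/continuous_G.
- by move=> y _; have dGy := dG y; rewrite derive1E derive_val.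
Qed.

Definition exp_tail c x : R := g x * \1_`[c, +oo[ x.

Lemma measurable_exp_tail c : measurable_fun [set: R] (exp_tail c).
Proof. by apply: measurable_funM => //; exact: measurable_indic. Qed.

Lemma exp_tail_ge0 c x : 0 <= exp_tail c x.
Proof. by rewrite mulr_ge0// indicE. Qed.

Let exp_tailT c x : c <= x -> exp_tail c x = g x.
Proof. by move=> cx; rewrite /exp_tail indicE mem_setE in_itv/= cx mulr1. Qed.

Let exp_tailF c x : x < c -> exp_tail c x = 0.
Proof. by move=> xc; rewrite /exp_tail indicE mem_setE in_itv/= leNgt xc mulr0. Qed.

Let measurable_far (eta : R) x : measurable [set y : R | (eta < `|x - y|)%R].
Proof.
have -> : [set y | eta < `|x - y|] = (fun y => `|x - y|) @^-1` `]eta, +oo[.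
  by apply/seteqP; split=> y; rewrite /= in_itv/= andbT.
have mn : measurable_fun [set: R] (fun y : R => `|x - y|).
  by apply: measurableT_comp; [exact: normr_measurable|exact: measurable_funB].
by rewrite -[X in measurable X]setTI; exact: (mn measurableT _ (measurable_itv _)).
Qed.

Let measurable_scaled_fejer_at l x A : measurable_fun A (fun y : R => (scaled_fejer l (x - y))%:E).
Proof.
apply: measurable_funTS; apply/measurable_EFinP.
exact: (measurableT_comp (measurable_scaled_fejerB l) (measurable_pair1 x)).
Qed.

Let measurable_gscaled_fejer_at l x A :
  measurable_fun A (fun y : R => (g y * scaled_fejer l (x - y))%:E).
Proof.
apply: measurable_funTS; apply/measurable_EFinP; apply: measurable_funM => //.
exact: (measurableT_comp (measurable_scaled_fejerB l) (measurable_pair1 x)).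
Qed.

(** Write [g x] as [g x] times the unit mass of the kernel at [x] and split at distance [eta].
    Nearby, [g x] is at most [expR (theta * eta) * g y]. The far part is at most a fraction [k] of
    [exp_tail c x] itself, to be absorbed later into the left-hand side. *)
Let exp_tail_le_smoothing c (eta k l : R) x : 0 < eta -> 0 < l ->
  2 * (1 + eta ^- 2) / l <= k ->
  ((exp_tail c x)%:E <= (expR (theta * eta))%:E * smoothing `[(c - eta)%R, +oo[ g l x
     + (k * exp_tail c x)%:E)%E.
Proof.
move=> eta0 l0 hk; have k0 : 0 <= k.
  by rewrite (le_trans _ hk)// divr_ge0 ?(ltW l0)// mulr_ge0// addr_ge0// invr_ge0 sqr_ge0.
have [xc|cx] := ltP x c.
  rewrite exp_tailF// mulr0 adde0 mule_ge0 ?lee_fin ?expR_ge0//.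
  exact: smoothing_ge0.
rewrite exp_tailT//.
pose D := [set y : R | (eta < `|x - y|)%R].
have mD : measurable D := measurable_far eta x.
have gK : ((g x)%:E = \int[mu]_(y in ~` D `|` D) ((g x)%:E * (scaled_fejer l (x - y))%:E))%E.
  rewrite setvU ge0_integralZl_EFin//.
  - by rewrite integral_scaled_fejer// mule1.
  - by move=> y _; rewrite lee_fin scaled_fejer_ge0.
  - exact: measurable_scaled_fejer_at.
rewrite [leLHS]gK ge0_integral_setU//; last 4 first.
- exact: measurableC.
- by apply: measurable_funeM; exact: measurable_scaled_fejer_at.
- by move=> y _; rewrite mule_ge0// lee_fin// scaled_fejer_ge0.
- by rewrite disj_set2E setICl.
apply: leeD.
- rewrite /smoothing -ge0_integralZl_EFin ?expR_ge0//; last 2 first.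
  + by move=> y _; rewrite lee_fin mulr_ge0// scaled_fejer_ge0.
  + exact: measurable_gscaled_fejer_at.
  apply: (@le_trans _ _ (\int[mu]_(y in ~` D)
      ((expR (theta * eta))%:E * (g y * scaled_fejer l (x - y))%:E))%E).
    apply: ge0_le_integral => //.
    + exact: measurableC.
    + by move=> y _; rewrite mule_ge0// lee_fin// scaled_fejer_ge0.
    + by apply: measurable_funeM; exact: measurable_scaled_fejer_at.
    + by apply: measurable_funeM; exact: measurable_gscaled_fejer_at.
    + move=> y /negP; rewrite -leNgt => xy.
      rewrite -!EFinM lee_fin [leRHS]mulrA.
      apply: ler_wpM2r; first exact: scaled_fejer_ge0.
      rewrite /g -expRD ler_expR.
      have : 0 <= theta * (eta + x - y).
        by rewrite mulr_ge0 ?(ltW theta_gt0)//; move: xy; rewrite ler_norml; lra.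
      by rewrite mulrBr mulrDr; lra.
  apply: ge0_subset_integral => //.
  + exact: measurableC.
  + by apply: measurable_funeM; exact: measurable_gscaled_fejer_at.
  + by move=> y _; rewrite mule_ge0// lee_fin ?expR_ge0// mulr_ge0// scaled_fejer_ge0.
  + move=> y /negP; rewrite -leNgt => xy; rewrite /= in_itv/= andbT.
    by move: xy; rewrite ler_norml; lra.
- rewrite ge0_integralZl_EFin//; last 2 first.
  + by move=> y _; rewrite lee_fin scaled_fejer_ge0.
  + exact: measurable_scaled_fejer_at.
  rewrite mulrC EFinM lee_wpmul2l ?lee_fin//.
  by rewrite (le_trans (integral_scaled_fejer_tail x l0 eta0))// lee_fin.
Qed.

Let integrable_g_tail c : mu.-integrable `[c, +oo[ (EFin \o g).
Proof.
apply/integrableP; split; first exact/measurable_EFinP/measurable_funTS.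
under eq_integral => y _ do rewrite gee0_abs ?lee_fin//.
by rewrite integral_g_tail ltry.
Qed.

Lemma exp_tail_upper c (e : R) : 0 < e -> \forall m \near \oo,
  (scaled_integral m (fun x => (exp_tail c x)%:E) <= (ell * (g c / theta) + e)%:E)%E.
Proof.
move=> e0; pose T := ell * (g c / theta).
have T0 : 0 < T by rewrite mulr_gt0// divr_gt0// expR_gt0.
(* The admissible relative error [expR r] is spent in four quarters: moving the cut-off by [eta],
   comparing [g] at distance [eta], absorbing the fraction [k = 1 - expR (- (r / 4))], and the slack
   in the limit. *)
pose r := ln (1 + e / T).
have r0 : 0 < r by rewrite ln_gt0// ltrDl divr_gt0.
have rE : expR r = 1 + e / T by rewrite lnK// posrE addr_gt0// divr_gt0.
pose eta := r / 4 / theta; have eta0 : 0 < eta by rewrite !divr_gt0.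
have thetaeta : theta * eta = r / 4 by rewrite /eta mulrC divfK// gt_eqF.
pose k := 1 - expR (- (r / 4)).
have k0 : 0 < k by rewrite subr_gt0 -expR0 ltr_expR oppr_lt0 divr_gt0.
pose l := 2 * (1 + eta ^- 2) / k.
have a0 : 0 < 2 * (1 + eta ^- 2) by rewrite mulr_gt0// ltr_wpDr// invr_ge0 sqr_ge0.
have l0 : 0 < l by rewrite divr_gt0.
have kl : 2 * (1 + eta ^- 2) / l <= k.
  by rewrite ler_pdivrMr// [leRHS]mulrC /l divfK// gt_eqF.
pose B : set R := `[c - eta, +oo[%classic.
have mB : measurable B by exact: measurable_itv.
have mh := measurable_smoothing mB mg g_ge0 l0.
have h0 x := smoothing_ge0 B g_ge0 x l0.
have tail_le x : ((exp_tail c x)%:E <= (expR (r / 2))%:E * smoothing B g l x)%E.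
  have := exp_tail_le_smoothing c x eta0 l0 kl.
  rewrite -/B thetaeta; case: (smoothing B g l x) (h0 x) => [s s0|_ _|//].
    rewrite -!EFinM -EFinD !lee_fin /k => h.
    have -> : r / 2 = r / 4 + r / 4 by field.
    rewrite expRD -mulrA -ler_pdivrMl ?expR_gt0// -expRN.
    by move: h; rewrite mulrBl mul1r; lra.
  by rewrite gt0_muley ?lte_fin ?expR_gt0// leey.
have hcvg := smoothing_cvg mB mg g_ge0 (integrable_g_tail (c - eta)) l0.
have limE : ell * \int[mu]_(y in B) g y = T * expR (r / 4).
  rewrite /Rintegral integral_g_tail/= /T /g -thetaeta mulrBr opprB expRD; ring.
rewrite limE in hcvg.
have lim_lt : T * expR (r / 4) < T * expR (r / 2).
  by rewrite ltr_pM2l// ltr_expR; lra.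
have -> : T + e = expR (r / 2) * (T * expR (r / 2)).
  rewrite mulrCA -expRD (_ : r / 2 + r / 2 = r) ?rE; last by field.
  by rewrite mulrDr mulr1 mulrCA divff ?mulr1// gt_eqF.
move/fine_cvgP : hcvg => [hfin hcvg].
near=> m.
rewrite (@le_trans _ _ ((expR (r / 2))%:E * scaled_integral m (smoothing B g l))%E)//.
  rewrite -scaled_integralZl ?expR_ge0//; apply: le_scaled_integral => //.
  - by apply/measurable_EFinP; exact: measurable_exp_tail.
  - exact: measurable_funeM.
  - by move=> x; rewrite lee_fin exp_tail_ge0.
rewrite EFinM lee_wpmul2l ?lee_fin ?expR_ge0//.
have hf : scaled_integral m (smoothing B g l) \is a fin_num by near: m.
rewrite -(fineK hf) lee_fin ltW//.
by near: m; exact: (cvgr_lt _ hcvg).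
Unshelve. all: by end_near. Qed.

(** For [y] within [eta] of [x] the point [x] lies beyond [c], so [exp_tail c x] is available. Far
    from [y] it may vanish, and absorption is impossible; the quadratic decay of the kernel is
    traded for the Cauchy weight instead. The segment is bounded so that a constant [C0] can
    exist. *)
Let smoothing_le_exp_tail c D (eta C0 l : R) x : 0 < eta -> 0 < l -> 0 <= C0 ->
  c + eta < D ->
  (forall y, c + eta <= y <= D -> eta < `|x - y| -> 1 + x ^+ 2 <= C0 * (x - y) ^+ 2) ->
  (smoothing `[(c + eta)%R, D] g l x <= ((expR (theta * eta)) * exp_tail c x)%:E +
     (2 * C0 / (pi * l) * ((g (c + eta) - g D) / theta))%:E * ((1 + x ^+ 2)^-1)%:E)%E.
Proof.
move=> eta0 l0 C00 cD hC0; set kap := 2 * C0 / (pi * l).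
have pl0 : 0 < pi * l by rewrite mulr_gt0// pi_gt0.
have kap0 : 0 <= kap by rewrite divr_ge0 ?(ltW pl0)// mulr_ge0.
have x21 : 0 < 1 + x ^+ 2 by rewrite ltr_wpDr// sqr_ge0.
have E0 : 0 <= expR (theta * eta) * exp_tail c x.
  by rewrite mulr_ge0 ?expR_ge0 ?exp_tail_ge0.
apply: (@le_trans _ _ (\int[mu]_(y in `[(c + eta)%R, D])
  ((expR (theta * eta) * exp_tail c x)%:E * (scaled_fejer l (x - y))%:E +
   (kap / (1 + x ^+ 2))%:E * (g y)%:E))%E).
  apply: ge0_le_integral => //.
  - by move=> y _; rewrite lee_fin mulr_ge0// scaled_fejer_ge0.
  - exact: measurable_gscaled_fejer_at.
  - apply: emeasurable_funD; apply: measurable_funeM.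
      exact: measurable_scaled_fejer_at.
    by apply: measurable_funTS; exact/measurable_EFinP.
  - move=> y; rewrite /= in_itv/= => /andP[cy yD].
    rewrite -!EFinM -EFinD lee_fin.
    have w0 : 0 <= kap / (1 + x ^+ 2) * g y.
      by rewrite mulr_ge0// divr_ge0// ltW.
    have K0 := @scaled_fejer_ge0 _ l (x - y) l0.
    have [xy|xy] := leP `|x - y| eta.
      have cx : c <= x by move: xy; rewrite ler_norml; lra.
      rewrite exp_tailT// ler_wpDr// ler_wpM2r// /g -expRD ler_expR.
      have : 0 <= theta * (eta - x + y).
        by rewrite mulr_ge0 ?(ltW theta_gt0)//; move: xy; rewrite ler_norml; lra.
      by rewrite mulrDr mulrBr; lra.
    have xy0 : x - y != 0 by rewrite -normr_gt0 (lt_trans eta0).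
    have d0 : 0 < (x - y) ^+ 2 by rewrite exprn_even_gt0.
    apply: ler_wpDl; first exact: mulr_ge0 E0 K0.
    rewrite mulrC; apply: ler_wpM2r => //.
    rewrite (le_trans (scaled_fejer_le_sq l0 xy0))//.
    rewrite ler_pdivlMr// mulrAC ler_pdivrMr; last exact: (mulr_gt0 pl0 d0).
    rewrite [leRHS]mulrA /kap divfK ?gt_eqF// -mulrA ler_pM2l//.
    by rewrite hC0// cy.
rewrite ge0_integralD//; last 4 first.
- by move=> y _; rewrite mule_ge0// lee_fin// scaled_fejer_ge0.
- by apply: measurable_funeM; exact: measurable_scaled_fejer_at.
- by move=> y _; rewrite mule_ge0// lee_fin ?g_ge0// divr_ge0// ltW.
- by apply: measurable_funeM; apply: measurable_funTS; exact/measurable_EFinP.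
rewrite !ge0_integralZl_EFin//.
- apply: leeD.
    rewrite -[leRHS]mule1 lee_wpmul2l ?lee_fin// -(integral_scaled_fejer x l0).
    apply: ge0_subset_integral => //; first exact: measurable_scaled_fejer_at.
    by move=> y _; rewrite lee_fin scaled_fejer_ge0.
  by rewrite integral_g_segment// -!EFinM lee_fin mulrAC.
- by move=> y _; rewrite lee_fin.
- by apply: measurable_funTS; exact/measurable_EFinP.
- by rewrite divr_ge0// ltW.
- by move=> y _; rewrite lee_fin scaled_fejer_ge0.
- exact: measurable_scaled_fejer_at.
Qed.

Lemma exp_tail_lower c (e : R) : 0 < e -> \forall m \near \oo,
  ((ell * (g c / theta) - e)%:E <= scaled_integral m (fun x => (exp_tail c x)%:E))%E.
Proof.
move=> e0; pose T := ell * (g c / theta).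
have T0 : 0 < T by rewrite mulr_gt0// divr_gt0// expR_gt0.
(* The factor [expR (- (theta * eta))] is lost twice, by the shifted cut-off and by comparing [g] at
   distance [eta]; with this [eta] the total loss is at most [e / 2]. *)
pose eta := e / (4 * T) / theta.
have eta0 : 0 < eta by rewrite !divr_gt0// mulr_gt0.
have thetaeta : theta * eta = e / (4 * T) by rewrite /eta mulrC divfK// gt_eqF.
(* [g D <= a] makes the contribution truncated beyond [D] at most [e / 4]. *)
pose a := e * theta / (4 * ell).
have a_gt0 : 0 < a by rewrite divr_gt0// mulr_gt0.
pose D := Num.max (c + eta + 1) (- ln a / theta).
have cD : c + eta < D by rewrite lt_max ltrDl ltr01.
have gD : ell * (g D / theta) <= e / 4.
  have : g D <= a.
    rewrite /g -[leRHS]lnK ?posrE// ler_expR lerNl mulrC -ler_pdivrMr//.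
    by rewrite le_max lexx orbT.
  rewrite mulrA ler_pdivrMr// -ler_pdivlMl// => h.
  by rewrite (le_trans h)// /a invfM; lra.
pose J := (g (c + eta) - g D) / theta.
have J0 : 0 < J.
  rewrite divr_gt0// subr_gt0 /g ltr_expR ltrN2 ltr_pM2l//.
have [Cv hCv] := cauchy_weight_bounded.
pose Cw := `|Cv| + 1; have Cw0 : 0 < Cw by rewrite ltr_wpDl.
pose M2 := (c + eta) ^+ 2 + D ^+ 2.
(* From [x^2 <= 2 (x - y)^2 + 2 y^2], [y^2 <= M2] and [eta^2 <= (x - y)^2]. *)
pose C0 := 2 + (1 + 2 * M2) / eta ^+ 2.
have M20 : 0 <= M2 by rewrite addr_ge0 ?sqr_ge0.
have C00 : 0 < C0.
  by rewrite ltr_pwDl// divr_ge0 ?sqr_ge0// addr_ge0// mulr_ge0.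
have hC0 x y : c + eta <= y <= D -> eta < `|x - y| -> 1 + x ^+ 2 <= C0 * (x - y) ^+ 2.
  move=> /andP[cy yD] exy.
  have y2 : y ^+ 2 <= M2.
    rewrite /M2; have [y0|y0] := leP 0 y.
      by rewrite ler_wpDl ?sqr_ge0// lerXn2r ?nnegrE// (le_trans y0).
    by rewrite ler_wpDr ?sqr_ge0// -sqrrN -[leRHS]sqrrN lerXn2r ?nnegrE; lra.
  have e2 : eta ^+ 2 <= (x - y) ^+ 2.
    by rewrite -[leRHS]ger0_norm ?sqr_ge0// normrX lerXn2r ?nnegrE// ltW.
  have x2 : x ^+ 2 <= 2 * (x - y) ^+ 2 + 2 * y ^+ 2.
    have := sqr_ge0 (x - 2 * y); nra.
  have : 1 + 2 * M2 <= (1 + 2 * M2) / eta ^+ 2 * (x - y) ^+ 2.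
    rewrite mulrAC ler_pdivlMr ?exprn_gt0// ler_wpM2l// addr_ge0// mulr_ge0//.
  rewrite /C0 mulrDl; lra.
(* Solved from [kE]: the Cauchy-weighted error then contributes at most [e / 8]. *)
pose l := 16 * C0 * J * Cw / (pi * e).
have p0 : 0 < pi :> R := pi_gt0 R.
have l0 : 0 < l.
  by rewrite divr_gt0 ?(mulr_gt0 p0 e0)//; do 3 rewrite mulr_gt0//.
have kE : 2 * C0 / (pi * l) * J * Cw = e / 8.
  rewrite /l; have := lt0r_neq0 C00; have := lt0r_neq0 J0; have := lt0r_neq0 Cw0.
  have := lt0r_neq0 e0; have := lt0r_neq0 p0.
  move: (pi : R) C0 J Cw {C00 hC0 J0 Cw0 l l0} => p C J' C' h1 h2 h3 h4 h5.
  by field; rewrite h1 h2 h3 h4 h5.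
pose B : set R := `[c + eta, D]%classic.
have mB : measurable B by exact: measurable_itv.
have iB : mu.-integrable B (EFin \o g).
  apply: continuous_compact_integrable; first exact: segment_compact.
  exact: continuous_subspaceT.
have hcvg := smoothing_cvg mB mg g_ge0 iB l0.
have mh := measurable_smoothing mB mg g_ge0 l0.
have h0 x := smoothing_ge0 B g_ge0 x l0.
have limE : \int[mu]_(y in B) g y = J by rewrite /Rintegral integral_g_segment.
rewrite limE in hcvg; move/fine_cvgP : hcvg => [hfin hcvg].
near=> m.
set nu := scaled_integral m _.
have hf : scaled_integral m (smoothing B g l) \is a fin_num by near: m.
have h1 : ((ell * J - e / 8)%:E <= scaled_integral m (smoothing B g l))%E.
  rewrite -(fineK hf) lee_fin ltW//; near: m; apply: (cvgr_gt _ hcvg).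
  by rewrite ltrBlDr ltrDl divr_gt0.
have mE : measurable_fun [set: R] (fun x => (exp_tail c x)%:E).
  by apply/measurable_EFinP; exact: measurable_exp_tail.
have mC : measurable_fun [set: R] (fun x : R => ((1 + x ^+ 2)^-1)%:E).
  apply/measurable_EFinP.
  exact: (continuous_measurable_fun (@continuous_oneDsqrV R)).
have C1 x : (0 <= ((1 + x ^+ 2)^-1)%:E :> \bar R)%E.
  by rewrite lee_fin invr_ge0 addr_ge0 ?sqr_ge0.
have kJ0 : 0 <= 2 * C0 / (pi * l) * J.
  by rewrite -(pmulr_lge0 _ Cw0) kE divr_ge0// ltW.
have h2 : (scaled_integral m (smoothing B g l) <=
    (expR (theta * eta))%:E * nu + (e / 8)%:E)%E.
  apply: (@le_trans _ _ ((expR (theta * eta))%:E * nu + (2 * C0 / (pi * l) * J)%:E *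
      scaled_integral m (fun x => ((1 + x ^+ 2)^-1)%:E))%E).
    rewrite -!scaled_integralZl ?expR_ge0//; last by move=> x; rewrite lee_fin exp_tail_ge0.
    rewrite -scaled_integralD.
    - apply: le_scaled_integral => //.
        by apply: emeasurable_funD; exact: measurable_funeM.
      move=> x; rewrite -EFinM; apply: smoothing_le_exp_tail => //; first exact: ltW.
      by move=> y; exact: hC0.
    - exact: measurable_funeM.
    - exact: measurable_funeM.
    - by move=> x; rewrite mule_ge0// lee_fin ?expR_ge0 ?exp_tail_ge0.
    - by move=> x; rewrite mule_ge0// lee_fin.
  apply: leeD2l; rewrite -kE [leRHS]EFinM; apply: lee_wpmul2l; first by rewrite lee_fin.
  rewrite (le_trans (hCv m))// lee_fin (le_trans (ler_norm _))// lerDl//.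
have h3 : ((expR (- (theta * eta)) * (ell * J - e / 4))%:E <= nu)%E.
  rewrite EFinM expRN lee_pdivrMl ?expR_gt0//.
  have := le_trans h1 h2; rewrite -leeBlDr// -EFinB; apply: le_trans.
  by rewrite lee_fin; lra.
apply: le_trans h3; rewrite lee_fin.
set s := expR _.
have s1 : s <= 1 by rewrite /s -expR0 ler_expR oppr_le0 mulr_ge0// ltW.
have s0 : 0 <= s by exact: expR_ge0.
have ss : 1 - 2 * (theta * eta) <= s ^+ 2.
  rewrite /s -expRM_natl (le_trans _ (expR_ge1Dx _))// mulrN//.
have ellJ : ell * J = T * s - ell * (g D / theta).
  by rewrite /J /T /s /g mulrDr opprD expRD; ring.
have Ts : T - e / 2 <= T * s ^+ 2.
  rewrite (le_trans _ (ler_wpM2l (ltW T0) ss))// mulrBr mulr1 thetaeta.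
  rewrite le_eqVlt; apply/orP; left; apply/eqP; field; rewrite gt_eqF//.
rewrite ellJ; set b := ell * _ in gD *.
have b0 : 0 <= b by rewrite mulr_ge0 ?divr_ge0 ?(ltW ell_gt0) ?(ltW theta_gt0).
have : s * (b + e / 4) <= e / 2.
  have be0 : 0 <= b + e / 4 by lra.
  by rewrite (le_trans (ler_wpM2r be0 s1))// mul1r; lra.
have -> : s * (T * s - b - e / 4) = T * s ^+ 2 - s * (b + e / 4) by ring.
rewrite -/T; lra.
Unshelve. all: by end_near. Qed.

End renewal_type_limit.

(** * Poisson tails *)

Section poisson_tails.
Context {R : realType}.
Implicit Types (y : R) (n k : nat) (U : set nat).

Lemma measurable_poisson_prob_at U :
  measurable_fun [set: R] (fun y => poisson_prob y 0 U).
Proof.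
exact: (measurable_kernel (kprobability (@measurable_poisson_prob R 0)) U).
Qed.

Lemma poisson_prob_le1 y U : (poisson_prob y 0 U <= 1)%E.
Proof. exact: (probability_le1 (poisson_prob y 0)). Qed.

(* Change of the Poisson rate from y to n, which turns the tail beyond n into
   an event of probability at most 1. *)
Lemma poisson_prob_tail_le y n U : 0 < y -> (0 < n)%N ->
  (forall k, U k -> (y / n%:R) ^+ k <= (y / n%:R) ^+ n) ->
  (poisson_prob y 0 U <= (expR (- (n%:R * (Num.sqrt (y / n%:R) - 1) ^+ 2)))%:E)%E.
Proof.
move=> y0 n0 hU; have n0' : 0 < n%:R :> R by rewrite ltr0n.
set r := y / n%:R in hU *; have r0 : 0 < r by rewrite divr_gt0.
(* The likelihood ratio of rates [y] and [n] at [k] is [r ^+ k * expR (n%:R - y)], which is at most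
   [c] on [U]. *)
pose c := r ^+ n * expR (n%:R - y).
have c0 : 0 <= c by rewrite mulr_ge0 ?expR_ge0// exprn_ge0// ltW.
apply: (@le_trans _ _ c%:E).
  apply: (@le_trans _ _ (c%:E * poisson_prob (n%:R : R) 0 U)%E); last first.
    by rewrite -[leRHS]mule1 lee_wpmul2l ?lee_fin ?poisson_prob_le1.
  rewrite /poisson_prob y0 n0'.
  rewrite -(set_mem_set U) -!nneseries_esum; [|by move=> k _; rewrite lee_fin poisson_pmf_ge0..].
  rewrite -nneseriesZl; last by move=> k _; rewrite lee_fin poisson_pmf_ge0.
  apply: lee_nneseries => [k _|k kU]; first by rewrite lee_fin poisson_pmf_ge0.
  rewrite -EFinM lee_fin /poisson_pmf y0 n0' /c.
  have -> : y ^+ k / k`!%:R * expR (- y) =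
      r ^+ k * (n%:R ^+ k / k`!%:R * (expR (n%:R - y) * expR (- n%:R))).
    rewrite -expRD /r expr_div_n addrAC subrr add0r.
    rewrite !mulrA divfK// expf_neq0// gt_eqF//.
  rewrite -[leRHS]mulrA [X in _ <= _ * X]mulrCA ler_wpM2r//.
  by apply: hU; exact: set_mem.
rewrite lee_fin /c -{1}(lnK r0) -expRM_natl -expRD ler_expR.
have yE : y = n%:R * r by rewrite /r mulrC divfK// gt_eqF.
have := ler_wpM2l (ltW n0') (ln_le_entropy r0).
by rewrite {1}yE; lra.
Qed.

(** With [s = sqrt (1 + v)], [v = (s - 1) (s + 1)] and [(s + 1)^2 <= 2 (s^2 + 1) = 4 + 2 v]. The
    resulting exponent is quadratic for small [v] and still linear for large [v]. *)
Lemma sqr_sqrt_sub1_ge (v : R) : -1 <= v ->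
  v ^+ 2 / (4 + 2 * v) <= (Num.sqrt (1 + v) - 1) ^+ 2.
Proof.
move=> v1; have v0 : 0 <= 1 + v by lra.
have := sqr_sqrtr v0; have := sqrtr_ge0 (1 + v); set s := Num.sqrt _ => s0 s2.
rewrite ler_pdivrMr; last by lra.
have -> : v = s ^+ 2 - 1 by lra.
have := sqr_ge0 (s - 1); have := sqr_ge0 ((s - 1) ^+ 2); nra.
Qed.

Lemma poisson_prob_upper_tail y n : 0 < y -> (0 < n)%N -> y <= n%:R ->
  (poisson_prob y 0 [set k | (n <= k)%N] <=
   (expR (- (n%:R * (y / n%:R - 1) ^+ 2 / 4)))%:E)%E.
Proof.
move=> y0 n0 yn; have n0' : 0 < n%:R :> R by rewrite ltr0n.
have r1 : y / n%:R <= 1 by rewrite ler_pdivrMr// mul1r.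
have r0 : 0 < y / n%:R by rewrite divr_gt0.
apply: (le_trans (poisson_prob_tail_le y0 n0 _)) => [k nk|].
  by rewrite ler_wiXn2l// ltW.
rewrite lee_fin ler_expR lerN2 -mulrA ler_wpM2l ?(ltW n0')//.
have := @sqr_sqrt_sub1_ge (y / n%:R - 1); rewrite subrKC; set v := _ - 1 => h.
have v1 : -1 <= v by rewrite /v; lra.
rewrite (le_trans _ (h v1))// ler_wpM2l ?sqr_ge0// lef_pV2 ?posrE//; rewrite /v; lra.
Qed.

Lemma poisson_prob_lower_tail y n : (0 < n)%N -> n%:R <= y ->
  (1 - (expR (- (n%:R * ((y / n%:R - 1) ^+ 2 / (4 + 2 * (y / n%:R - 1))))))%:E <=
   poisson_prob y 0 [set k | (n <= k)%N])%E.
Proof.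
move=> n0 ny; have n0' : 0 < n%:R :> R by rewrite ltr0n.
have y0 : 0 < y := lt_le_trans n0' ny.
have r1 : 1 <= y / n%:R by rewrite ler_pdivlMr// mul1r.
have -> : [set k | (n <= k)%N] = ~` [set k | (k < n)%N].
  by apply/seteqP; split => k /=; [rewrite leqNgt => /negP|move/negP; rewrite -leqNgt].
rewrite (probability_setC (poisson_prob y 0))//; apply: leeB => //.
apply: (le_trans (poisson_prob_tail_le y0 n0 _)) => [k /= /ltnW kn|].
  by rewrite ler_weXn2l.
rewrite lee_fin ler_expR lerN2 ler_wpM2l ?(ltW n0')//.
have := @sqr_sqrt_sub1_ge (y / n%:R - 1); rewrite subrKC; apply; lra.
Qed.

End poisson_tails.

Section poissonized_tail.
Context {R : realType} (theta a : R).
Hypotheses (theta_gt0 : 0 < theta) (a_gt0 : 0 < a).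
Implicit Types (x N eps eta : R) (m n : nat).

(* For N much larger than (m + 1)^2 the Poisson fluctuations are negligible and
   this is close to exp (- theta x) on x >= 0 and to 0 on x < 0. *)
Definition poissonized m N n x : \bar R :=
  ((expR (- (theta * x)))%:E *
   poisson_prob (N * (a + x / m.+1%:R)) 0 [set k | (n <= k)%N])%E.

Lemma poissonized_ge0 m N n x : (0 <= poissonized m N n x)%E.
Proof. by rewrite mule_ge0 ?lee_fin ?expR_ge0. Qed.

Lemma measurable_poissonized m N n : measurable_fun [set: R] (poissonized m N n).
Proof.
apply: emeasurable_funM.
  apply/measurable_EFinP; apply: measurableT_comp => //.
  by apply: measurableT_comp => //; exact: measurable_funM.
apply: (measurableT_comp (measurable_poisson_prob_at _)).
by apply: measurable_funM => //; apply: measurable_funD => //; exact: measurable_funM.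
Qed.

Let rateE m N n x : 0 < N -> N * a = n%:R ->
  N * (a + x / m.+1%:R) / n%:R - 1 = x / (m.+1%:R * a).
Proof. by move=> N0 <-; field; rewrite !gt_eqF ?ltr0n. Qed.

(** Here the ratio [N / m^2] appears: it multiplies [x^2 / a] in the Chernoff exponent. *)
Let rate_sqr m N n x : 0 < N -> N * a = n%:R ->
  n%:R * (x / (m.+1%:R * a)) ^+ 2 = N / m.+1%:R ^+ 2 * (x ^+ 2 / a).
Proof. by move=> N0 <-; field; rewrite !gt_eqF ?ltr0n. Qed.

(** On [x >= - eta] the probability is bounded by 1. To the left, [expR (- (theta * x))] grows
    exponentially, but the Poisson tail supplies [expR (- (b * x ^+ 2))]. One unit of [b] pays for
    [1 + x^2]; since [|x| > eta], the rest exceeds [theta |x| + |ln eps|], whence the form of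
    [b]. *)
Lemma poissonized_le eta eps : 0 < eta -> 0 < eps -> exists B : R,
  forall m N n x, 0 < N -> (0 < n)%N -> N * a = n%:R -> B * m.+1%:R ^+ 2 <= N ->
  (poissonized m N n x <=
    (exp_tail theta (- eta) x)%:E + (eps * (1 + x ^+ 2)^-1)%:E)%E.
Proof.
move=> eta0 eps0; pose b := 1 + (theta + `|ln eps| / eta) / eta.
exists (4 * a * b) => m N n x N0 n0 Na BN.
have x21 : 0 < 1 + x ^+ 2 by rewrite ltr_wpDr// sqr_ge0.
have w0 : 0 <= eps * (1 + x ^+ 2)^-1 by rewrite mulr_ge0 ?invr_ge0 ?ltW.
have M0 : 0 < m.+1%:R :> R by rewrite ltr0n.
have [x_eta|x_eta] := leP (- eta) x.
  rewrite -EFinD (@le_trans _ _ (exp_tail theta (- eta) x)%:E)//; last by rewrite lee_fin lerDl.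
  rewrite /exp_tail indicE mem_setE in_itv/= x_eta mulr1.
  by rewrite -[leRHS]mule1 lee_wpmul2l ?lee_fin ?expR_ge0 ?poisson_prob_le1.
apply: (@le_trans _ _ (eps * (1 + x ^+ 2)^-1)%:E); last first.
  by rewrite -EFinD lee_fin lerDr exp_tail_ge0.
(* For a rate that is not positive, [poisson_prob] is the point mass at 0, which misses the tail
   because [n > 0]. *)
have [y0|y0] := ltP 0 (N * (a + x / m.+1%:R)); last first.
  rewrite /poissonized /poisson_prob ltNge y0/= diracE memNset ?mule0 ?lee_fin//.
  by rewrite /= leqNgt n0.
have yn : N * (a + x / m.+1%:R) <= n%:R.
  rewrite -Na ler_pM2l// gerDl mulr_le0_ge0 ?invr_ge0// ltW// (lt_trans x_eta)//.
  by rewrite oppr_lt0.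
apply: (@le_trans _ _ ((expR (- (theta * x)))%:E *
    (expR (- (n%:R * (x / (m.+1%:R * a)) ^+ 2 / 4)))%:E)%E).
  rewrite lee_wpmul2l ?lee_fin ?expR_ge0//.
  by have := poisson_prob_upper_tail y0 n0 yn; rewrite (rateE m x N0 Na).
rewrite -EFinM lee_fin (rate_sqr m x N0 Na) ler_pdivlMr// -expRD.
have bN : b * x ^+ 2 <= N / m.+1%:R ^+ 2 * (x ^+ 2 / a) / 4.
  rewrite -ler_pdivlMr ?exprn_gt0// in BN.
  have xa : 0 <= x ^+ 2 / a by rewrite divr_ge0 ?sqr_ge0// ltW.
  rewrite (le_trans _ (ler_wpM2r (_ : 0 <= 4^-1) (ler_wpM2r xa BN)))//.
  by rewrite le_eqVlt; apply/orP; left; apply/eqP; field; rewrite gt_eqF.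
apply: (@le_trans _ _ (expR (- (theta * x) - b * x ^+ 2) * expR (x ^+ 2))).
  by apply: ler_pM (ltW x21) _ (expR_ge1Dx _) => //; rewrite ?expR_ge0// ler_expR lerB.
rewrite -expRD -[leRHS]lnK ?posrE// ler_expR.
have b1 : (b - 1) * eta = theta + `|ln eps| / eta.
  by rewrite /b addrC addKr divfK// gt_eqF.
have : (b - 1) * eta * (- x) <= (b - 1) * x ^+ 2.
  have b0 : 0 <= b - 1.
    by rewrite /b addrC addKr divr_ge0 ?addr_ge0 ?divr_ge0 ?(ltW eta0) ?(ltW theta_gt0).
  by rewrite -mulrA ler_wpM2l//; nra.
rewrite b1 mulrDl.
have : `|ln eps| <= `|ln eps| / eta * (- x).
  by rewrite mulrAC ler_pdivlMr// ler_wpM2l//; lra.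
by have := ler_norm (- ln eps); rewrite normrN; lra.
Qed.

(** The exponent [v^2 / (4 + 2 v)] increases with [v], so [x = eta] is the worst case. There
    [v0 <= 1] by the condition [eta <= m.+1%:R * a], hence [4 + 2 v0 <= 6], the origin of the 6 in
    [B]. *)
Lemma poissonized_ge eta eps : 0 < eta -> 0 < eps -> exists B : R,
  forall m N n x, 0 < N -> (0 < n)%N -> N * a = n%:R -> B * m.+1%:R ^+ 2 <= N ->
  eta <= m.+1%:R * a ->
  (((1 - eps) * exp_tail theta eta x)%:E <= poissonized m N n x)%E.
Proof.
move=> eta0 eps0; exists (6 * a * `|ln eps| / eta ^+ 2) => m N n x N0 n0 Na BN etaM.
have M0 : 0 < m.+1%:R :> R by rewrite ltr0n.
have Ma0 : 0 < m.+1%:R * a by rewrite mulr_gt0.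
have [x_eta|x_eta] := ltP x eta.
  rewrite /exp_tail indicE mem_setE in_itv/= (leNgt eta x) x_eta/= !mulr0.
  exact: poissonized_ge0.
have x0 : 0 <= x := le_trans (ltW eta0) x_eta.
rewrite /exp_tail indicE mem_setE in_itv/= x_eta mulr1 mulrC EFinM.
rewrite lee_wpmul2l ?lee_fin ?expR_ge0//.
have ny : n%:R <= N * (a + x / m.+1%:R).
  by rewrite -Na ler_pM2l// lerDl divr_ge0.
apply: le_trans (poisson_prob_lower_tail n0 ny); rewrite (rateE m x N0 Na).
rewrite EFinB; apply: leeB => //; rewrite lee_fin -[leRHS]lnK ?posrE// ler_expR.
set v := x / _; pose v0 := eta / (m.+1%:R * a).
have v00 : 0 < v0 by rewrite divr_gt0.
have v01 : v0 <= 1 by rewrite ler_pdivrMr// mul1r.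
have vv : v0 <= v by rewrite ler_pM2r ?invr_gt0.
have hv : v0 ^+ 2 / 6 <= v ^+ 2 / (4 + 2 * v).
  rewrite ler_pdivlMr; last by lra.
  have k1 : v0 * v0 <= v * v by apply: ler_pM => //; exact: ltW.
  have v_ge0 : 0 <= v := le_trans (ltW v00) vv.
  have k2 : v0 * v <= v * v by rewrite ler_wpM2r.
  have k3 : v0 * (v0 * v) <= v0 * v by rewrite ler_piMl// mulr_ge0// ltW.
  by rewrite mulrAC ler_pdivrMr// !expr2 mulrDr (mulrCA _ 2) -(mulrA v0); lra.
have n0' : 0 < n%:R :> R by rewrite ltr0n.
have h1 : n%:R * (v0 ^+ 2 / 6) <= n%:R * (v ^+ 2 / (4 + 2 * v)) by rewrite ler_wpM2l// ltW.
have h2 : `|ln eps| <= n%:R * (v0 ^+ 2 / 6).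
  rewrite mulrA (rate_sqr m eta N0 Na).
  rewrite -ler_pdivlMr ?exprn_gt0// in BN.
  have xa : 0 <= eta ^+ 2 / a by rewrite divr_ge0 ?sqr_ge0// ltW.
  rewrite (le_trans _ (ler_wpM2r (_ : 0 <= 6^-1) (ler_wpM2r xa BN)))//.
  by rewrite le_eqVlt; apply/orP; left; apply/eqP; field; rewrite !gt_eqF.
by have := ler_norm (- ln eps); rewrite normrN; lra.
Qed.

Variables (Q : nat -> probability R R) (ell : R).
Hypotheses (ell_gt0 : 0 < ell)
  (bounded : forall l, 0 < l -> exists C : R, forall m y,
     Num.sqrt m.+1%:R * \int[Q m.+1]_x scaled_fejer l (x - y) <= C)
  (cvg : forall l y, 0 < l ->
     Num.sqrt m.+1%:R * \int[Q m.+1]_x scaled_fejer l (x - y) @[m --> \oo] --> ell).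

Lemma poissonized_limit (e : R) : 0 < e -> exists B : R,
  \forall m \near \oo, forall N n, 0 < N -> (0 < n)%N -> N * a = n%:R ->
    B * m.+1%:R ^+ 2 <= N ->
    ((ell / theta - e)%:E <= scaled_integral Q m (poissonized m N n) <=
     (ell / theta + e)%:E)%E.
Proof.
move=> e0; pose d := e * theta / (4 * ell).
(* [d] is the relative change that moves [ell / theta] by [e / 4]. It fixes [eta] through
   [expR (theta * eta) = 1 + d]; [eps] makes the Cauchy-weighted error at most [e / 4], and the
   minimum with 1 in [eps'] keeps [1 - eps'] nonnegative. *)
have d0 : 0 < d by rewrite divr_gt0 ?mulr_gt0.
have elld : ell * (d / theta) = e / 4.
  by rewrite /d; field; rewrite !gt_eqF.
pose eta := ln (1 + d) / theta.
have eta0 : 0 < eta by rewrite divr_gt0// ln_gt0// ltrDl.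
have thetaeta : theta * eta = ln (1 + d) by rewrite /eta mulrC divfK// gt_eqF.
have expeta : expR (theta * eta) = 1 + d by rewrite thetaeta lnK// posrE addr_gt0.
have [Cv hCv] := cauchy_weight_bounded bounded.
pose eps := e / (4 * (`|Cv| + 1)).
have Cv1 : 0 < `|Cv| + 1 by rewrite ltr_wpDl.
have eps0 : 0 < eps by rewrite divr_gt0// mulr_gt0.
pose eps' := Num.min 1 d.
have eps'0 : 0 < eps' by rewrite lt_min ltr01.
have [B1 hB1] := poissonized_le eta0 eps0.
have [B2 hB2] := poissonized_ge eta0 eps'0.
exists (Num.max B1 B2).
have e40 : 0 < e / 4 by rewrite divr_gt0.
have up := exp_tail_upper ell_gt0 theta_gt0 bounded cvg (- eta) e40.
have low := exp_tail_lower ell_gt0 theta_gt0 bounded cvg eta e40.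
have etaM : \forall m \near \oo, eta <= m.+1%:R * a.
  near=> m; rewrite -ler_pdivrMr// (@le_trans _ _ m%:R) ?ler_nat//.
  by near: m; exact: nbhs_infty_ger.
near=> m => N n N0 n0 Na BN.
have BN1 : B1 * m.+1%:R ^+ 2 <= N.
  by rewrite (le_trans _ BN)// ler_wpM2r ?sqr_ge0// le_max lexx.
have BN2 : B2 * m.+1%:R ^+ 2 <= N.
  by rewrite (le_trans _ BN)// ler_wpM2r ?sqr_ge0// le_max lexx orbT.
have mt c : measurable_fun [set: R] (fun x => (exp_tail theta c x)%:E).
  by apply/measurable_EFinP; exact: measurable_exp_tail.
have mC : measurable_fun [set: R] (fun x : R => ((1 + x ^+ 2)^-1)%:E).
  apply/measurable_EFinP.
  exact: (continuous_measurable_fun (@continuous_oneDsqrV R)).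
have C1 x : (0 <= ((1 + x ^+ 2)^-1)%:E :> \bar R)%E.
  by rewrite lee_fin invr_ge0 addr_ge0 ?sqr_ge0.
have t0 c x : (0 <= (exp_tail theta c x)%:E)%E by rewrite lee_fin exp_tail_ge0.
apply/andP; split.
- apply: (@le_trans _ _ ((1 - eps')%:E *
    scaled_integral Q m (fun x => (exp_tail theta eta x)%:E))%E); last first.
    rewrite -scaled_integralZl//; last by rewrite subr_ge0 ge_min lexx.
    apply: le_scaled_integral => //.
    + exact: measurable_funeM.
    + exact: measurable_poissonized.
    + by move=> x; rewrite mule_ge0// lee_fin subr_ge0 ge_min lexx.
    + move=> x; rewrite -EFinM; apply: hB2 => //.
      by near: m; exact: etaM.
  apply: (@le_trans _ _ ((1 - eps')%:E * (ell * (expR (- (theta * eta)) / theta) - e / 4)%:E)%E).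
    rewrite -EFinM lee_fin expRN expeta.
    have u0 : 0 <= 1 - eps' by rewrite subr_ge0 ge_min lexx.
    have h1 : ell / theta - e / 2 <= ell * ((1 + d)^-1 / theta) - e / 4.
      have -> : ell * ((1 + d)^-1 / theta) = ell / theta / (1 + d).
        by rewrite mulrCA mulrC.
      suff : ell / theta - e / 4 <= ell / theta / (1 + d) by lra.
      have Ad : ell / theta * d = e / 4 by rewrite -elld mulrAC mulrA.
      rewrite ler_pdivlMr ?addr_gt0// -Ad mulrDr mulr1 mulrBl.
      suff : 0 <= ell / theta * d * d by lra.
      by rewrite Ad mulr_ge0 // ltW.
    apply: le_trans (ler_wpM2l u0 h1).
    have h2 : eps' * (ell / theta) <= e / 4.
      by rewrite -elld mulrCA ler_wpM2l ?(ltW ell_gt0)// ler_wpM2r ?invr_ge0 ?(ltW theta_gt0)// ge_min lexx orbT.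
    have h3 : 0 <= eps' * e by rewrite mulr_ge0 ?ltW.
    by lra.
  apply: lee_wpmul2l; first by rewrite lee_fin subr_ge0 ge_min lexx.
  by near: m; exact: low.
- apply: (@le_trans _ _ (scaled_integral Q m (fun x =>
     (exp_tail theta (- eta) x)%:E + eps%:E * ((1 + x ^+ 2)^-1)%:E))%E).
    apply: le_scaled_integral => //.
    + exact: measurable_poissonized.
    + by apply: emeasurable_funD => //; exact: measurable_funeM.
    + by move=> x; exact: poissonized_ge0.
    + by move=> x; rewrite -EFinM; exact: hB1.
  rewrite scaled_integralD//; last 2 first.
  + exact: measurable_funeM.
  + by move=> x; rewrite mule_ge0// lee_fin ltW.
  rewrite scaled_integralZl ?(ltW eps0)//.
  apply: (@le_trans _ _ ((ell * (expR (- (theta * - eta)) / theta) + e / 4)%:E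
     + (eps * (`|Cv| + 1))%:E)%E).
    apply: leeD; first by near: m; exact: up.
    rewrite [leRHS]EFinM; apply: lee_wpmul2l; first by rewrite lee_fin ltW.
    by rewrite (le_trans (hCv m))// lee_fin (le_trans (ler_norm _))// lerDl.
  rewrite -EFinD lee_fin mulrN opprK expeta.
  have -> : eps * (`|Cv| + 1) = e / 4 by rewrite /eps; field; rewrite gt_eqF.
  have -> : ell * ((1 + d) / theta) = ell / theta + ell * (d / theta).
    by rewrite mulrDl mul1r mulrDr.
  by rewrite elld; lra.
Unshelve. all: by end_near.
Qed.

End poissonized_tail.

(** * Exponential tilting *)

(** The measure with density [g]; its integration formula passes from simple functions to [f] by
    monotone convergence. *)
Lemma exists_density d (T : measurableType d) (R : realType)
    (mu : {measure set T -> \bar R}) (g : T -> R) :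
  measurable_fun [set: T] g -> (forall x, 0 <= g x) ->
  (\int[mu]_x (g x)%:E = 1)%E ->
  exists q : probability T R, forall f : T -> \bar R,
    measurable_fun [set: T] f -> (forall x, 0 <= f x)%E ->
    (\int[q]_x f x = \int[mu]_x (f x * (g x)%:E))%E.
Proof.
move=> mg0 g00; pose g' x := (g x)%:E.
rewrite -/(g' _).
have mg : measurable_fun [set: T] g' by exact/measurable_EFinP.
have g0 x : (0 <= g' x)%E by rewrite lee_fin.
move=> g1; pose q A : \bar R := (\int[mu]_(x in A) g' x)%E.
have q0 : q set0 = 0%E by rewrite /q integral_set0.
have q_ge0 A : (0 <= q A)%E by exact: integral_ge0.
have q_sigma : semi_sigma_additive q.
  move=> /= F mF tF mUF; rewrite /q integral_bigcup//=; last first.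
    apply/integrableP; split; first exact: measurable_funTS.
    apply: (@le_lt_trans _ _ 1%E); last exact: ltry.
    rewrite -g1; under eq_integral do rewrite gee0_abs//.
    exact: ge0_subset_integral.
  by apply: is_cvg_ereal_nneg_natsum_cond => n _ _; exact: q_ge0.
pose qM := isMeasure.Build _ _ _ q q0 q_ge0 q_sigma.
pose qm : {measure set T -> \bar R} := HB.pack q qM.
have qT : qm [set: T] = 1%E by [].
pose qP := Measure_isProbability.Build _ _ _ qm qT.
pose qp : probability T R := HB.pack q qM qP.
have qpE A : qp A = (\int[mu]_(x in A) g' x)%E by [].
clearbody qp; clear qP qT qm qM q_sigma q_ge0 q0 q.
exists qp => f mf f0.
pose f_ := nnsfun_approx measurableT mf.
transitivity (limn (fun n => \int[qp]_x (f_ n x)%:E)%E).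
  rewrite -monotone_convergence//=.
  - apply: eq_integral => x _; apply/esym/cvg_lim => //=.
    by apply: cvg_nnsfun_approx.
  - by move=> n; exact/measurable_EFinP.
  - by move=> n x _; rewrite lee_fin.
  - by move=> x _ m n mn; rewrite lee_fin; exact/lefP/nd_nnsfun_approx.
transitivity (limn (fun n => \int[mu]_x ((f_ n x)%:E * g' x))%E); last first.
  rewrite -monotone_convergence//=.
  - apply: eq_integral => x _; apply/cvg_lim => //=.
    apply: cvgeZr => //; first exact: cvg_nnsfun_approx.
  - by move=> n; apply: emeasurable_funM => //; exact/measurable_EFinP.
  - by move=> n x _; rewrite mule_ge0// lee_fin.
  - by move=> x _ m n mn; rewrite lee_wpmul2r// lee_fin; exact/lefP/nd_nnsfun_approx.
congr (limn _); apply/funext => n.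
rewrite integral_nnsfun//.
under [RHS]eq_integral.
  move=> x _; rewrite fimfunE -fsumEFin// ge0_mule_fsuml; last first.
    by move=> r; rewrite EFinM nnfun_muleindic_ge0.
  over.
rewrite ge0_integral_fsum//; last 2 first.
  - move=> r; apply: emeasurable_funM => //.
    by apply/measurable_EFinP; exact: measurable_funM.
  - by move=> r x _; rewrite mule_ge0// EFinM nnfun_muleindic_ge0.
rewrite sintegralE patch_setT.
apply: eq_fsbigr => r /set_mem[x0 _ <-]; set A := f_ n @^-1` _.
have mA : measurable A by exact: measurable_funPTI.
transitivity ((f_ n x0)%:E * \int[mu]_(x in A) g' x)%E.
  by congr (_ * _)%E; exact: qpE.
rewrite integral_mkcond -ge0_integralZl//.
- apply: eq_integral => x _; rewrite EFinM -muleA; congr (_ * _)%E.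
  by rewrite patchE indicE; case: ifPn; rewrite ?mul1e ?mul0e.
- exact/(measurable_restrictT _ mA)/measurable_funTS.
- by move=> x _; rewrite patchE; case: ifPn.
- by rewrite lee_fin.
Qed.

(** Rectangles are stable under intersection and generate the product sigma-algebra. *)
Lemma measure_prod_unique d1 d2 (T1 : measurableType d1) (T2 : measurableType d2)
    (R : realType) (m1 m2 : {measure set (T1 * T2) -> \bar R}) :
  (m1 [set: T1 * T2] < +oo)%E ->
  (forall A B, measurable A -> measurable B -> m1 (A `*` B) = m2 (A `*` B)) ->
  forall E, measurable E -> m1 E = m2 E.
Proof.
move=> m1oo m12 E mE.
pose C : set (set (T1 * T2)) :=
  [set C | exists2 A, measurable A & exists2 B, measurable B & A `*` B = C].
apply: (measure_unique C (fun=> setT)) => //.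
- by rewrite measurable_prod_measurableType.
- move=> _ _ [A mA [B mB <-]] [A' mA' [B' mB' <-]].
  rewrite -setXI; exists (A `&` A'); first exact: measurableI.
  by exists (B `&` B') => //; exact: measurableI.
- by move=> _; exists setT => //; exists setT => //; rewrite setXTT.
- by rewrite bigcup_const.
- by move=> _ [A mA [B mB <-]]; exact: m12.
Qed.

Lemma exists_convolution (R : realType) (p q : probability R R) :
  exists r : probability R R, forall f : R -> \bar R,
    measurable_fun [set: R] f -> (forall x, 0 <= f x)%E ->
    (\int[r]_z f z = \int[p]_x \int[q]_y f (x + y)%R)%E.
Proof.
pose add (z : R * R) := z.1 + z.2.
have madd : measurable_fun [set: R * R] add by exact: measurable_funD.
pose addM := isMeasurableFun.Build _ _ _ _ _ madd.
pose addm : {mfun (R * R)%type >-> R} := HB.pack add addM.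
exists (distribution (p \x q)%E addm) => f mf f0.
rewrite ge0_integral_distribution//.
apply: (fubini_tonelli1 (f \o addm)) => [|x]; last exact: f0.
exact: measurableT_comp.
Qed.

Section convolution.
Context {R : realType} (r p q : probability R R).
Hypothesis rE : forall f : R -> \bar R,
  measurable_fun [set: R] f -> (forall x, 0 <= f x)%E ->
  (\int[r]_z f z = \int[p]_x \int[q]_y f (x + y)%R)%E.

(** The convolution formula is available for nonnegative functions only; adding [M] brings a
    function bounded by [M] into that class. *)
Let integralD_cst (P : probability R R) (f : R -> R) (M : R) :
  measurable_fun [set: R] f -> (forall x, `|f x| <= M) ->
  (\int[P]_x (f x + M)%:E = (\int[P]_x f x + M)%:E)%E.
Proof.
move=> mf fM; have fi := integrable_bounded P mf fM.
under eq_integral do rewrite EFinD.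
rewrite integralD//; last first.
  by apply: (@integrable_bounded _ _ _ `|M|) => // x.
rewrite integral_cst// [X in (_ + _ * X)%E](probability_setT P) mule1 EFinD.
by rewrite /Rintegral fineK//; exact: integrable_fin_num.
Qed.

Lemma Rintegral_convolution (f : R -> R) (M : R) :
  measurable_fun [set: R] f -> (forall x, `|f x| <= M) ->
  \int[r]_z f z = \int[p]_x \int[q]_y f (x + y).
Proof.
move=> mf fM.
have mfx x : measurable_fun [set: R] (fun y => f (x + y)).
  by apply: measurableT_comp => //; exact: measurable_funD.
have mF : measurable_fun [set: R] (fun x => \int[q]_y f (x + y)).
  have : measurable_fun [set: R] (fun x => \int[q]_y (f (x + y) + M)%:E)%E.
    have := @measurable_integral_on _ _ _ _ _ q _ measurableT (fun x y : R => f (x + y) + M).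
    apply.
      apply: measurable_funD => //; apply: measurableT_comp => //.
      exact: measurable_funD.
    by move=> x y _; have := fM (x + y); rewrite ler_norml; lra.
  under eq_fun do rewrite (integralD_cst _ (mfx _))//.
  move=> /measurable_EFinP mFM.
  have -> : (fun x => \int[q]_y f (x + y)) = (fun x => (\int[q]_y f (x + y) + M) - M).
    by apply/funext => x; rewrite addrK.
  exact: measurable_funB.
have FM x : `|\int[q]_y f (x + y)| <= M by exact: normr_Rintegral_le.
apply: (addIr M); apply: EFin_inj.
rewrite -integralD_cst// -integralD_cst// rE.
- by apply: eq_integral => x _; exact: integralD_cst.
- by apply/measurable_EFinP; exact: measurable_funD.
- by move=> x; have := fM x; rewrite lee_fin ler_norml; lra.
Qed.

Lemma cf_cos_convolution s :
  cf_cos r s = cf_cos p s * cf_cos q s - cf_sin p s * cf_sin q s.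
Proof.
rewrite /cf_cos (@Rintegral_convolution _ 1) => [||x]; [|exact: measurable_cosM|exact: cos_max].
under eq_Rintegral => x _.
  under eq_Rintegral do rewrite mulrDr cosD.
  rewrite RintegralB//; last 2 first.
  - by apply: integrable_mulrl => //; exact: integrable_cosM.
  - by apply: integrable_mulrl => //; exact: integrable_sinM.
  rewrite RintegralZl//; last exact: integrable_cosM.
  rewrite RintegralZl//; last exact: integrable_sinM.
  rewrite mulrC [X in _ - X]mulrC.
  over.
rewrite RintegralB//; last 2 first.
- by apply: integrable_mulrl => //; exact: integrable_cosM.
- by apply: integrable_mulrl => //; exact: integrable_sinM.
rewrite RintegralZl//; last exact: integrable_cosM.
rewrite RintegralZl//; last exact: integrable_sinM.
by rewrite mulrC [X in _ - X]mulrC.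
Qed.

Lemma cf_sin_convolution s :
  cf_sin r s = cf_cos p s * cf_sin q s + cf_sin p s * cf_cos q s.
Proof.
rewrite /cf_sin (@Rintegral_convolution _ 1) => [||x]; [|exact: measurable_sinM|exact: sin_max].
under eq_Rintegral => x _.
  under eq_Rintegral do rewrite mulrDr sinD.
  rewrite RintegralD//; last 2 first.
  - by apply: integrable_mulrl => //; exact: integrable_cosM.
  - by apply: integrable_mulrl => //; exact: integrable_sinM.
  rewrite RintegralZl//; last exact: integrable_cosM.
  rewrite RintegralZl//; last exact: integrable_sinM.
  rewrite mulrC [X in _ + X]mulrC.
  over.
rewrite RintegralD//; last 2 first.
- by apply: integrable_mulrl => //; exact: integrable_sinM.
- by apply: integrable_mulrl => //; exact: integrable_cosM.
rewrite RintegralZl//; last exact: integrable_sinM.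
rewrite RintegralZl//; last exact: integrable_cosM.
by rewrite addrC mulrC [X in _ + X]mulrC.
Qed.

End convolution.

(** * Independence and laws of the centred partial sums *)

Section centered_sums.
Context d (T : measurableType d) (R : realType) (P : probability T R).
Variables (X : nat -> {RV P >-> R}) (a : R).
Hypothesis X_indep : mutually_independent X.

Definition centered_sum m (w : T) : R := \sum_(1 <= i < m.+1) (X i w - a).

Lemma centered_sum0 w : centered_sum 0 w = 0.
Proof. by rewrite /centered_sum big_geq. Qed.

Lemma centered_sumS m w : centered_sum m.+1 w = centered_sum m w + (X m.+1 w - a).
Proof. by rewrite /centered_sum big_nat_recr. Qed.

Lemma measurable_centered_sum m : measurable_fun [set: T] (centered_sum m).
Proof.
elim: m => [|m IH]; first by rewrite (funext centered_sum0); exact: measurable_cst.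
rewrite (funext (centered_sumS m)).
by apply: measurable_funD => //; exact: measurable_funB.
Qed.

Let pair_sum m (w : T) : R * R := (centered_sum m w, X m.+1 w).

Let measurable_pair_sum m : measurable_fun [set: T] (pair_sum m).
Proof. by apply/measurable_fun_pairP; split => //; exact: measurable_centered_sum. Qed.

Let later (J : {fset nat}) (C : nat -> set R) := \bigcap_(j in [set` J]) (X j @^-1` C j).

(** Quantifying over all later indices lets the induction move [X m.+1] from the later variables
    into the sum. The law of [(W_m, X m.+1)] restricted to the later event and the same law
    multiplied by that event's probability agree on rectangles by the induction hypothesis, hence on
    the Borel set of pairs whose sum lies in [B]. *)
Lemma centered_sum_indep m (J : {fset nat}) (B : set R) (C : nat -> set R) :
  (forall j, j \in J -> (m < j)%N) -> measurable B ->
  (forall j, j \in J -> measurable (C j)) ->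
  P (centered_sum m @^-1` B `&` \bigcap_(j in [set` J]) (X j @^-1` C j)) =
  (P (centered_sum m @^-1` B) * \prod_(j <- J) P (X j @^-1` C j))%E.
Proof.
elim: m J B C => [|m IH] J B C mJ mB mC.
  rewrite (funext centered_sum0); have [B0|B0] := pselect (B 0).
    have -> : (fun=> 0) @^-1` B = [set: T] by apply/seteqP; split.
    by rewrite setTI [X in (X * _)%E]probability_setT mul1e X_indep.
  have -> : (fun=> 0) @^-1` B = set0 :> set T by apply/seteqP; split.
  by rewrite set0I measure0 mul0e.
have mD : measurable (later J C).
  by apply: fin_bigcap_measurable => // j jJ; apply: measurable_funPTI => //; exact: mC.
pose c := fine (\prod_(j <- J) P (X j @^-1` C j))%E.
have cE : (\prod_(j <- J) P (X j @^-1` C j))%E = c%:E.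
  rewrite fineK// big_seq prode_fin_num// => j jJ.
  by apply: fin_num_measure; apply: measurable_funPTI => //; exact: mC.
have c0 : 0 <= c.
  by rewrite fine_ge0// prode_ge0.
pose law1 : {measure set (R * R) -> \bar R} := pushforward (mrestr P mD) (pair_sum m).
pose law2 : {measure set (R * R) -> \bar R} :=
  mscale (NngNum c0) (pushforward P (pair_sum m)).
pose m1 := law1 (measurable_pair_sum m).
pose m2 := law2 (measurable_pair_sum m).
have rect (K : {fset nat}) (A1 A2 : set R) : (forall j, j \in K -> (m.+1 < j)%N) ->
    (forall j, j \in K -> measurable (C j)) -> measurable A1 -> measurable A2 ->
    P (pair_sum m @^-1` (A1 `*` A2) `&` later K C) =
    (P (centered_sum m @^-1` A1) *
      (P (X m.+1 @^-1` A2) * \prod_(j <- K) P (X j @^-1` C j)))%E.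
  move=> mK mCK mA1 mA2.
  have m1K : m.+1 \notin K by apply/negP => /mK; rewrite ltnn.
  pose C' j := if j == m.+1 then A2 else C j.
  have C'E j : j \in K -> C' j = C j.
    by move=> /mK; rewrite /C'; case: eqP => // ->; rewrite ltnn.
  have <- : (\prod_(j <- (m.+1 |` K)%fset) P (X j @^-1` C' j) =
      P (X m.+1 @^-1` A2) * \prod_(j <- K) P (X j @^-1` C j))%E.
    rewrite big_fsetU1//= {1}/C' eqxx; congr (_ * _)%E.
    by apply: eq_big_seq => j /C'E ->.
  rewrite -IH//.
  - congr (P _); apply/seteqP; split => [w [[/= w1 w2] wK]|w [/= w1 wK]].
      split => // j /=; rewrite !inE => /orP[/eqP->|jK]; first by rewrite /C' eqxx.
      by rewrite C'E//; exact: wK.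
    split => [|j /= jK]; last by rewrite -(C'E j)//; apply: wK => /=; rewrite !inE jK orbT.
    by split => //=; have := wK m.+1; rewrite /= /C' eqxx; apply; rewrite !inE eqxx.
  - by move=> j; rewrite !inE => /orP[/eqP->//|/mK]; exact: ltn_trans.
  - move=> j; rewrite !inE /C'; case: eqP => [//|_ /= jK]; exact: mCK.
have m12 A1 A2 : measurable A1 -> measurable A2 -> m1 (A1 `*` A2) = m2 (A1 `*` A2).
  move=> mA1 mA2; rewrite /m1 /m2 /law1 /law2/= /mscale /pushforward /mrestr/=.
  rewrite -cE rect// muleA muleC.
  have := @rect fset0 A1 A2; rewrite big_seq_fset0 mule1 => <-//.
  by rewrite /later set_fset0 bigcap_set0 setIT.
pose E := (fun z : R * R => z.1 + (z.2 - a)) @^-1` B.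
have mE : measurable E.
  have mf : measurable_fun [set: R * R] (fun z : R * R => z.1 + (z.2 - a)).
    by apply: measurable_funD => //; exact: measurable_funB.
  by rewrite -[E]setTI; exact: mf.
have EE : pair_sum m @^-1` E = centered_sum m.+1 @^-1` B.
  by apply/seteqP; split => w; rewrite /E/= centered_sumS.
have m1oo : (m1 [set: R * R] < +oo)%E.
  rewrite /m1 /law1/= /pushforward /mrestr preimage_setT setTI.
  by rewrite (le_lt_trans (probability_le1 P mD))// ltry.
have := measure_prod_unique m1oo m12 mE.
rewrite /m1 /m2 /law1 /law2/= /mscale /pushforward /mrestr/=.
by rewrite /pushforward EE -cE muleC.
Qed.

Hypothesis X_law : identically_distributed X.

Lemma integral_centered_sumS m (f : R -> \bar R) :
  measurable_fun [set: R] f -> (forall x, 0 <= f x)%E ->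
  (\int[P]_w f (centered_sum m.+1 w) =
   \int[P]_w \int[P]_v f (centered_sum m w + (X 0%N v - a))%R)%E.
Proof.
move=> mf f0.
have mXa : measurable_fun [set: R] (fun x => x - a) by exact: measurable_funB.
pose Wm := isMeasurableFun.Build _ _ _ _ _ (measurable_centered_sum m).
pose W : {mfun T >-> R} := HB.pack (centered_sum m) Wm.
pose law : {measure set (R * R) -> \bar R} := pushforward P (pair_sum m).
pose m1 := law (measurable_pair_sum m).
pose m2 := (distribution P W \x distribution P (X 0%N))%E.
have m1oo : (m1 [set: R * R] < +oo)%E.
  rewrite /m1 /law/= /pushforward preimage_setT.
  by rewrite (le_lt_trans (probability_le1 P measurableT))// ltry.
have m12 A1 A2 : measurable A1 -> measurable A2 -> m1 (A1 `*` A2) = m2 (A1 `*` A2).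
  move=> mA1 mA2; rewrite /m1 /m2 /law/= product_measure1E//.
  transitivity (P (centered_sum m @^-1` A1) * P (X m.+1 @^-1` A2))%E; last first.
    by congr (_ * _)%E; exact: X_law.
  have := @centered_sum_indep m [fset m.+1]%fset A1 (fun=> A2).
  rewrite big_seq_fset1 => <-//; last by move=> j; rewrite inE => /eqP->.
  congr (P _); apply/seteqP; split=> w /= [w1 w2]; split => //.
    by move=> j; rewrite /= inE => /eqP ->.
  by apply: w2; rewrite /= inE.
have mg : measurable_fun [set: R * R] (fun z => f (z.1 + (z.2 - a))).
  apply: measurableT_comp => //; apply: measurable_funD => //.
  exact: measurable_funB.
transitivity (\int[m1]_z f (z.1 + (z.2 - a))%R)%E.
  rewrite ge0_integral_pushforward//.
  by apply: eq_integral => w _; rewrite /= centered_sumS.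
transitivity (\int[m2]_z f (z.1 + (z.2 - a))%R)%E.
  by apply: eq_measure_integral => A mA _; exact: measure_prod_unique.
rewrite fubini_tonelli1// ge0_integral_distribution.
- apply: eq_integral => w _.
  apply: (ge0_integral_distribution (X 0%N)
    (f := fun y => f (centered_sum m w + (y - a))%R)) => //.
  by apply: measurableT_comp => //; exact: measurable_funD.
- exact: (measurable_fun_fubini_tonelli_F (fun z : R * R => f (z.1 + (z.2 - a)))).
- by move=> x; exact: integral_ge0.
Qed.

End centered_sums.

Section exponential_tilting.
Context d (T : measurableType d) (R : realType) (P : probability T R).
Variables (X : nat -> {RV P >-> R}) (a theta I : R).
Hypothesis X_iid : iid X.
Hypothesis theta_mgf : (\int[P]_w (expR (theta * (X 0%N w - a) + I))%:E = 1)%E.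

Let e (x : R) : R := expR (theta * x + I).

Let measurable_e : measurable_fun [set: R] e.
Proof. by apply: measurableT_comp => //; apply: measurable_funD => //; exact: measurable_funM. Qed.

Lemma exists_tilt : exists q : probability R R, forall f : R -> \bar R,
  measurable_fun [set: R] f -> (forall x, 0 <= f x)%E ->
  (\int[q]_x f x =
   \int[P]_w (f (X 0%N w - a)%R * (expR (theta * (X 0%N w - a) + I))%:E))%E.
Proof.
have mY : measurable_fun [set: T] (fun w => X 0%N w - a) by exact: measurable_funB.
pose Ym := isMeasurableFun.Build _ _ _ _ _ mY.
pose Y : {mfun T >-> R} := HB.pack (fun w => X 0%N w - a) Ym.
have e1 : (\int[distribution P Y]_x (e x)%:E = 1)%E.
  by rewrite ge0_integral_distribution => [//||x]; [exact/measurable_EFinP|rewrite lee_fin expR_ge0].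
have [q qE] := exists_density measurable_e (fun x => expR_ge0 _) e1.
exists q => f mf f0; rewrite qE// ge0_integral_distribution//.
  by apply: emeasurable_funM => //; exact/measurable_EFinP.
by move=> x; rewrite mule_ge0// lee_fin expR_ge0.
Qed.

Lemma exists_tilted_sums : exists q : probability R R, exists Q : nat -> probability R R,
  [/\ (forall f : R -> \bar R, measurable_fun [set: R] f -> (forall x, 0 <= f x)%E ->
        (\int[q]_x f x =
         \int[P]_w (f (X 0%N w - a)%R * (expR (theta * (X 0%N w - a) + I))%:E))%E),
      Q 0%N = \d_(0 : R),
      (forall m (f : R -> \bar R), measurable_fun [set: R] f -> (forall x, 0 <= f x)%E ->
        (\int[Q m.+1]_z f z = \int[Q m]_x \int[q]_y f (x + y)%R)%E) &
      (forall m (f : R -> \bar R), measurable_fun [set: R] f -> (forall x, 0 <= f x)%E ->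
        (\int[P]_w f (centered_sum X a m w) =
         \int[Q m]_x (f x * (expR (- (theta * x) - m%:R * I))%:E))%E)].
Proof.
have [q qE] := exists_tilt.
pose conv p := projT1 (cid (exists_convolution p q)).
have convE p : forall f : R -> \bar R, measurable_fun [set: R] f -> (forall x, 0 <= f x)%E ->
    (\int[conv p]_z f z = \int[p]_x \int[q]_y f (x + y)%R)%E.
  exact: projT2 (cid (exists_convolution p q)).
pose Q m := iter m conv \d_(0 : R).
exists q, Q; split => //; first by move=> m f mf f0; rewrite /Q iterS convE.
(* [Q m] is the law of the sum tilted by [expR (theta * W_m + m * I)]: the density is multiplicative
   over the steps. The last clause follows by applying this to [f] divided by the density. *)
have key m (f : R -> \bar R) : measurable_fun [set: R] f -> (forall x, 0 <= f x)%E ->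
    (\int[Q m]_x f x =
     \int[P]_w (f (centered_sum X a m w) *
       (expR (theta * centered_sum X a m w + m%:R * I))%:E))%E.
  elim: m f => [|m IH] f mf f0.
    rewrite integral_dirac//.
    under eq_integral do rewrite centered_sum0 mulr0 mul0r addr0 expR0 mule1.
    by rewrite diracT mul1e integral_cst// [X in (_ * X)%E]probability_setT mule1.
  rewrite /Q iterS convE// -/(Q m).
  rewrite IH; last 2 first.
  - apply: (measurable_fun_fubini_tonelli_F (fun z : R * R => f (z.1 + z.2))) => //.
    by apply: measurableT_comp => //; exact: measurable_funD.
  - by move=> x; exact: integral_ge0.
  pose g (x : R) := (f x * (expR (theta * x + m.+1%:R * I))%:E)%E.
  have mg : measurable_fun [set: R] g.
    apply: emeasurable_funM => //; apply/measurable_EFinP; apply: measurableT_comp => //.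
    by apply: measurable_funD => //; exact: measurable_funM.
  have g0 x : (0 <= g x)%E by rewrite mule_ge0// lee_fin expR_ge0.
  rewrite -/(g _) (@integral_centered_sumS _ _ _ _ _ _ X_iid.1 X_iid.2 m g)//.
  apply: eq_integral => w _.
  have mfw : measurable_fun [set: R] (fun y => f (centered_sum X a m w + y)).
    by apply: measurableT_comp => //; exact: measurable_funD.
  rewrite qE// muleC -ge0_integralZl//; last 2 first.
  - apply: emeasurable_funM.
      by apply: measurableT_comp mfw _; exact: measurable_funB.
    apply/measurable_EFinP; apply: (measurableT_comp measurable_e).
    exact: measurable_funB.
  - by move=> v _; rewrite mule_ge0// lee_fin expR_ge0.
  apply: eq_integral => v _; rewrite muleCA -EFinM -expRD; congr (_ * (expR _)%:E)%E.
  by rewrite -natr1; ring.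
move=> m f mf f0; rewrite key.
- apply: eq_integral => w _; rewrite -muleA -EFinM -expRD.
  by rewrite (_ : _ + _ = 0) ?expR0 ?mule1//; ring.
- apply: emeasurable_funM => //; apply/measurable_EFinP; apply: measurableT_comp => //.
  by apply: measurable_funB => //; apply: measurable_funN; exact: measurable_funM.
- by move=> x; rewrite mule_ge0// lee_fin expR_ge0.
Qed.

End exponential_tilting.

(** * Exponential moments and cumulants of the tilted step law *)

Section exponential_moments.
Context {R : realType} (q : probability R R) (delta : R).
Hypothesis exp_integrable : forall h : R, `|h| < delta ->
  q.-integrable [set: R] (EFin \o (fun x => expR (h * x))).
Implicit Types (h x : R) (k : nat).

Definition exp_moment k h := \int[q]_x (x ^+ k * expR (h * x)).

Let measurable_exp h : measurable_fun [set: R] (fun x => expR (h * x)).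
Proof. by apply: measurableT_comp => //; exact: measurable_funM. Qed.

(** The power is absorbed by an exponential whose rate [e] is half the distance from [h] to [delta],
    through [t^k / k! <= exp t]; and [exp (b |x|) <= exp (b x) + exp (- b x)]. *)
Let integrable_absM k h : 0 <= h < delta ->
  q.-integrable [set: R] (EFin \o (fun x => `|x| ^+ k * expR (h * `|x|))).
Proof.
move=> /andP[h0 hd].
pose e := (delta - h) / 2; have e0 : 0 < e by rewrite divr_gt0 ?subr_gt0.
have he : `|h + e| < delta by rewrite ger0_norm /e ?addr_ge0//; lra.
have heN : `|- (h + e)| < delta by rewrite normrN.
pose c : R := k`!%:R / e ^+ k.
have c0 : 0 <= c by rewrite divr_ge0 ?exprn_ge0// ltW.
apply: (@le_integrable _ _ _ _ _ measurableT _
  (EFin \o (fun x => c * (expR ((h + e) * x) + expR (- (h + e) * x))))).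
- apply/measurable_EFinP; apply: measurable_funM.
    by apply: measurable_funX; exact: normr_measurable.
  by apply: measurableT_comp => //; exact: measurable_funM.
- move=> x _; rewrite lee_fin [leRHS]ger0_norm; last by rewrite mulr_ge0// addr_ge0 ?expR_ge0.
  rewrite ger0_norm; last by rewrite mulr_ge0 ?expR_ge0 ?exprn_ge0.
  have xk : `|x| ^+ k <= c * expR (e * `|x|).
    rewrite /c mulrAC ler_pdivlMr ?exprn_gt0// -exprMn (mulrC `|x|) [leRHS]mulrC.
    have ex0 : 0 <= e * `|x| by exact: mulr_ge0 (ltW e0) (normr_ge0 x).
    rewrite -ler_pdivrMr ?ltr0n ?fact_gt0//.
    case: (k) => [|j]; first by rewrite expr0 fact0 divr1 -expR0 ler_expR.
    by apply: le_trans (expR_ge1Dxn j ex0); rewrite lerDr.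
  apply: (@le_trans _ _ (c * expR (e * `|x|) * expR (h * `|x|))).
    by rewrite ler_wpM2r ?expR_ge0.
  rewrite -mulrA -expRD ler_wpM2l// -mulrDl [e + h]addrC.
  have [x0|x0] := ger0P x; first by rewrite lerDl expR_ge0.
  by rewrite mulrN mulNr lerDr expR_ge0.
- apply: integrable_mulrl => //.
  exact: (@integrableD _ _ _ q _ measurableT _ _ (exp_integrable he) (exp_integrable heN)).
Qed.

Lemma integrable_exp_moment k h : `|h| < delta ->
  q.-integrable [set: R] (EFin \o (fun x => x ^+ k * expR (h * x))).
Proof.
move=> hd; have h1 : 0 <= `|h| < delta by rewrite normr_ge0.
apply: le_integrable (integrable_absM k h1) => //.
- apply/measurable_EFinP; apply: measurable_funM => //; exact: measurable_funX.
- move=> x _; rewrite lee_fin normrM normrX [leRHS]ger0_norm; last first.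
    by rewrite mulr_ge0 ?expR_ge0 ?exprn_ge0.
  rewrite ler_wpM2l ?exprn_ge0// ger0_norm ?expR_ge0// ler_expR.
  by rewrite -normrM ler_norm.
Qed.

(** Differentiation under the integral. Working on the smaller interval of radius [h1], midway
    between [|h|] and [delta], provides one integrable bound for all its parameters. *)
Lemma is_derive_exp_moment k h : `|h| < delta ->
  is_derive h 1 (exp_moment k) (exp_moment k.+1 h).
Proof.
move=> hd; pose h1 : R := (`|h| + delta) / 2.
have hh1 : `|h| < h1 by rewrite /h1; lra.
have h1d : h1 < delta by rewrite /h1; lra.
have h10 : 0 <= h1 by rewrite (le_trans _ (ltW hh1)).
pose f (t x : R) : R := x ^+ k * expR (t * x).
have Ih : `]- h1, h1[%classic h by rewrite /= in_itv/= -ltr_norml.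
have intf (t : R) : `]- h1, h1[%classic t -> q.-integrable [set: R] (EFin \o f t).
  rewrite /= in_itv/= -ltr_norml => th1.
  by apply: integrable_exp_moment; exact: lt_trans h1d.
have df (t x : R) : is_derive t 1 (f ^~ x) (x ^+ k.+1 * expR (t * x)).
  by apply: is_derive_eq; rewrite /GRing.scale/= exprS; ring.
have dfE (t x : R) : partial1of2 f t x = x ^+ k.+1 * expR (t * x).
  by rewrite partial1of2E; have dftx := df t x; rewrite derive_val.
have derf (t x : R) : `]- h1, h1[%classic t -> [set: R] x -> derivable (f ^~ x) t 1.
  by move=> _ _; have dftx := df t x; exact: ex_derive.
pose G x := `|x| ^+ k.+1 * expR (h1 * `|x|).
have G0 x : 0 <= G x by rewrite mulr_ge0 ?expR_ge0 ?exprn_ge0.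
have iG : q.-integrable [set: R] (EFin \o G) by apply: integrable_absM; rewrite h10.
have Gub (t x : R) : `]- h1, h1[%classic t -> [set: R] x -> `|partial1of2 f t x| <= G x.
  rewrite /= in_itv/= -ltr_norml => th1 _; rewrite dfE normrM normrX.
  rewrite ler_wpM2l ?exprn_ge0// ger0_norm ?expR_ge0// ler_expR.
  by rewrite (le_trans (ler_norm _))// normrM ler_wpM2r// ltW.
have dF := derivable_under_integral measurableT Ih intf derf G0 iG Gub.
have FE := differentiation_under_integral measurableT Ih intf derf G0 iG Gub.
apply: DeriveDef => //; rewrite -derive1E [LHS]FE.
by apply: eq_Rintegral => x _; exact: dfE.
Qed.

Lemma exp_moment0 : exp_moment 0 0 = 1.
Proof.
rewrite /exp_moment -[RHS](Rintegral_probability_cst q).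
by apply: eq_Rintegral => x _; rewrite mul0r expR0 expr0 mulr1.
Qed.

Lemma exp_moment_at0 k : exp_moment k 0 = \int[q]_x (x ^+ k).
Proof. by apply: eq_Rintegral => x _; rewrite mul0r expR0 mulr1. Qed.

Hypothesis delta_gt0 : 0 < delta.

Lemma integrable_power k : q.-integrable [set: R] (EFin \o (fun x => x ^+ k)).
Proof.
have /(integrable_exp_moment k) : `|0 : R| < delta by rewrite normr0.
by congr (_.-integrable _ _); apply/funext => x /=; rewrite mul0r expR0 mulr1.
Qed.

(** First-order condition: the moment-generating function has an interior minimum at 0, and its
    derivative there is the mean. *)
Lemma mean_eq0_of_min : (forall h : R, `|h| < delta -> 1 <= exp_moment 0 h) ->
  \int[q]_x x = 0.
Proof.
move=> F1.
have d0 h : h \in `]- delta, delta[%R -> is_derive h 1 (exp_moment 0) (exp_moment 1 h).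
  by rewrite in_itv/= -ltr_norml => hd; exact: is_derive_exp_moment.
have z0 : (0 : R) \in `]- delta, delta[%R by rewrite in_itv/= oppr_lt0 delta_gt0.
have : is_derive (0 : R) 1 (exp_moment 0) (0 : R).
  apply: (@derive1_at_min _ (exp_moment 0) (- delta) delta).
  - by rewrite ge0_cp// ltW.
  - by move=> t /d0 dt; exact: ex_derive.
  - exact: z0.
  - by move=> t; rewrite in_itv/= -ltr_norml exp_moment0; exact: F1.
move=> d1; have d2 := d0 _ z0.
have := @derive_val _ _ _ _ _ _ _ d1; rewrite (@derive_val _ _ _ _ _ _ _ d2) exp_moment_at0.
by under eq_Rintegral do rewrite expr1.
Qed.

(** Tilting translates the cumulant function and adds an affine term, which the second derivative
    ignores. As the mean is 0, the quotient rule leaves only the second moment. *)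
Lemma derive2_cumulant (L : R -> R) (theta b c : R) :
  (forall h, `|h| < delta -> 1 <= exp_moment 0 h) ->
  (forall h : R, `|h| < delta -> L (theta + h) = ln (exp_moment 0 h) + b * h + c) ->
  derive1n 2 L theta = \int[q]_x (x ^+ 2).
Proof.
move=> F1 LE; have mean0 := mean_eq0_of_min F1.
have F0 h : `|h| < delta -> 0 < exp_moment 0 h.
  by move=> /F1; exact: lt_le_trans.
pose G (h : R) := exp_moment 1 h / exp_moment 0 h + b.
have shiftE (f g : R -> R) (h df : R) : (forall h, `|h| < delta -> f (theta + h) = g h) ->
    `|h| < delta -> is_derive h 1 g df -> is_derive (theta + h) 1 f df.
  move=> fg hd dg.
  have sh : is_derive (theta + h) 1 (fun t => t - theta) (1 : R).
    by apply: is_derive_eq; rewrite subr0.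
  have hE : theta + h - theta = h by rewrite addrC addKr.
  rewrite -hE in dg.
  have := @is_derive1_comp _ g (fun t => t - theta) (theta + h) _ _ dg sh; rewrite mulr1; apply: near_eq_is_derive.
  near=> t; rewrite /= -fg; first by rewrite addrC subrK.
  near: t; exists (delta - `|h|); first by rewrite /= subr_gt0.
  move=> t /=; rewrite -normrN opprB => th.
  have -> : t - theta = (t - (theta + h)) + h by ring.
  by rewrite (le_lt_trans (ler_normD _ _))// -ltrBrDr.
have dL (h : R) : `|h| < delta -> is_derive (theta + h) 1 L (G h).
  move=> hd; have Fh := F0 _ hd.
  have dF := is_derive_exp_moment 0 hd.
  have F2 : is_derive h 1 (fun h => ln (exp_moment 0 h) + b * h + c) (G h).
    have lnF := is_derive1_ln Fh.
    have comp := is_derive1_comp lnF dF.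
    have -> : G h = (exp_moment 0 h)^-1 * exp_moment 1 h + b * 1 + 0.
      by rewrite /G mulrC mulr1 addr0.
    have bF : is_derive h 1 (fun h => b * h) (b * 1).
      by apply: is_derive_eq; rewrite /GRing.scale/=; ring.
    exact: is_deriveD (is_deriveD comp bF) (is_derive_cst c h 1).
  exact: shiftE LE hd F2.
have dG : is_derive (0 : R) 1 G (\int[q]_x (x ^+ 2)).
  have z0 : `|0 : R| < delta by rewrite normr0.
  have dF0 := is_derive_exp_moment 0 z0.
  have dF1 := is_derive_exp_moment 1 z0.
  have F00 : exp_moment 0 0 != 0 by rewrite exp_moment0 oner_eq0.
  have dV := is_deriveV F00 dF0.
  have := is_deriveD (is_deriveM dF1 dV) (is_derive_cst b (0 : R) 1).
  rewrite exp_moment0 (exp_moment_at0 1).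
  under eq_Rintegral do rewrite expr1.
  by rewrite mean0 /GRing.scale/= !mulr0 add0r invr1 mul1r addr0 exp_moment_at0.
rewrite derive1nS derive1n1 derive1E.
have z0 : `|0 : R| < delta by rewrite normr0.
have d2L : is_derive (theta + 0) 1 (derive1 L) (\int[q]_x (x ^+ 2)).
  apply: shiftE z0 dG => h hd; rewrite derive1E.
  by have dLh := dL h hd; rewrite derive_val.
by rewrite addr0 in d2L; rewrite derive_val.
Unshelve. all: by end_near.
Qed.

End exponential_moments.

(** * From the tilted law back to [P]: sign of [theta], characteristic function, variance *)

Lemma exists_angle (R : realType) (u v : R) : u ^+ 2 + v ^+ 2 = 1 ->
  exists b, cos b = u /\ sin b = v.
Proof.
move=> uv; have u1 : -1 <= u <= 1 by rewrite -ler_norml -[leRHS]sqrtr1 -sqrtr_sqr ler_sqrt//; have := sqr_ge0 v; lra.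
have u1' : u \in `[(-1), 1] by rewrite in_itv.
have vv : `|v| = Num.sqrt (1 - u ^+ 2) by rewrite -sqrtr_sqr; congr Num.sqrt; lra.
have [v0|v0] := ger0P v; first by exists (acos u); rewrite acosK// sin_acos// -vv ger0_norm.
by exists (- acos u); rewrite cosN sinN acosK// sin_acos// -vv ltr0_norm// opprK.
Qed.

Lemma lattice_of_ae d (T : measurableType d) (R : realType) (P : probability T R)
    (X : {RV P >-> R}) (c h : R) : 0 < h ->
  {ae P, forall w, exists k : int, X w = c + k%:~R * h} -> lattice X.
Proof.
move=> h0 aeX; exists c, h; split => //.
set A := [set w | _].
have mA : measurable A.
  have -> : A = \bigcup_(k : int) (X @^-1` [set c + k%:~R * h]).
    by apply/seteqP; split => [w [k Xw]|w [k _ Xw]]; exists k.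
  apply: countable_bigcupT_measurable; first exact: countableP.
  by move=> k; apply: measurable_funPTI => //; exact: measurable_set1.
have : P (~` A) = 0%E by apply: measure_negligible => //; exact: measurableC.
rewrite probability_setC// => /eqP.
by rewrite sube_eq// ?fin_num_measure// add0e => /eqP <-.
Qed.

Section tilted_law.
Context d (T : measurableType d) (R : realType) (P : probability T R).
Variables (X : {RV P >-> R}) (a theta I : R) (q : probability R R).
Hypothesis qE : forall f : R -> \bar R,
  measurable_fun [set: R] f -> (forall x, 0 <= f x)%E ->
  (\int[q]_x f x =
   \int[P]_w (f (X w - a)%R * (expR (theta * (X w - a) + I))%:E))%E.

Let mXa : measurable_fun [set: T] (fun w => X w - a).
Proof. exact: measurable_funB. Qed.

(** The tilting density never vanishes, so null sets of [q] come from null sets of [P]. *)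
Lemma tilted_ae_eq0 (g : R -> R) : measurable_fun [set: R] g -> (forall x, 0 <= g x) ->
  (\int[q]_x (g x)%:E = 0)%E -> {ae P, forall w, g (X w - a) = 0}.
Proof.
move=> mg g0; rewrite qE//; last exact/measurable_EFinP.
have mf : measurable_fun [set: T]
    (fun w => ((g (X w - a))%:E * (expR (theta * (X w - a) + I))%:E)%E).
  apply: emeasurable_funM; apply/measurable_EFinP.
    exact: measurableT_comp mg mXa.
  apply: measurableT_comp => //; apply: measurable_funD => //.
  exact: measurable_funM.
move=> h; have /(ae_eq_integral_abs P measurableT mf) : (\int[P]_w `|(g (X w - a))%:E * (expR (theta * (X w - a) + I))%:E| = 0)%E.
  by rewrite -[RHS]h; apply: eq_integral => w _; rewrite gee0_abs// mule_ge0// lee_fin ?expR_ge0.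
apply: filterS => w /(_ Logic.I) /=; rewrite -EFinM => -[] /eqP.
by rewrite mulf_eq0 [X in _ || X]gt_eqF ?expR_gt0// orbF => /eqP.
Qed.

Lemma tilted_integral (f : R -> R) : measurable_fun [set: R] f ->
  (\int[q]_x (f x)%:E =
   \int[P]_w (f (X w - a) * expR (theta * (X w - a) + I))%:E)%E.
Proof.
move=> mf; rewrite integralE [RHS]integralE.
have maxM (u e : R) : 0 <= e -> (maxe u%:E 0 * e%:E = maxe (u * e)%:E 0)%E.
  by move=> e0; rewrite -!EFin_max -EFinM maxr_pMl// mul0r.
have mfe : measurable_fun [set: R] (EFin \o f) by exact/measurable_EFinP.
congr (_ - _)%E; rewrite qE//.
- by apply: eq_integral => w _; rewrite funeposE maxM ?expR_ge0// funeposE.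
- exact: measurable_funepos.
- by apply: eq_integral => w _; rewrite !funenegE -!EFinN maxM ?expR_ge0// mulNr.
- exact: measurable_funeneg.
Qed.

(** If [theta <= 0], then [x * expR (- (theta * x)) >= x] for [x] of either sign. Undoing the tilt
    turns the [q]-integral of the left-hand side, scaled by [expR (- I)], into [nu - a], while the
    right-hand side integrates to 0; this contradicts [nu < a]. *)
Lemma tilt_gt0 (nu : R) : {ae P, forall w, 0 <= X w} ->
  (\int[P]_w (X w)%:E = nu%:E)%E -> nu < a ->
  q.-integrable [set: R] (EFin \o (fun x => x)) -> \int[q]_x x = 0 -> 0 < theta.
Proof.
move=> X0 Xnu nua iq mean0; rewrite ltNge; apply/negP => theta0.
have mX : measurable_fun [set: T] (EFin \o X) by exact/measurable_EFinP.
have iX : P.-integrable [set: T] (EFin \o X).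
  apply/integrableP; split => //.
  rewrite (_ : integral _ _ _ = nu%:E) ?ltry// -Xnu; apply: ae_eq_integral => //.
    exact: measurableT_comp.
  by apply: filterS X0 => w Xw0 _ /=; rewrite ger0_norm.
have iY : P.-integrable [set: T] (EFin \o (fun w => X w - a)).
  by apply: integrable_subr => //; apply: finite_measure_integrable_cst.
pose f (x : R) := x * expR (- (theta * x) - I).
have mf : measurable_fun [set: R] f.
  apply: measurable_funM => //; apply: measurableT_comp => //.
  by apply: measurable_funB => //; apply: measurableT_comp => //; exact: measurable_funM.
have fE w : f (X w - a) * expR (theta * (X w - a) + I) = X w - a.
  by rewrite /f -mulrA -expRD [X in expR X](_ : _ = 0) ?expR0 ?mulr1//; ring.
have if_ : q.-integrable [set: R] (EFin \o f).
  apply/integrableP; split; first exact/measurable_EFinP.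
  have /integrableP[_] := iY; congr (_ < _)%E; apply/esym.
  rewrite (tilted_integral (f := fun x => `|f x|)); last exact: measurableT_comp.
  apply: eq_integral => w _ /=; congr _%:E.
  by rewrite -[X in _ * X]ger0_norm ?expR_ge0// -normrM fE.
have : \int[q]_x (expR (- I) * x) <= \int[q]_x f x.
  apply: le_Rintegral => //; first exact: integrable_mulrl.
  move=> x _; rewrite /f expRD mulrA [leLHS]mulrC ler_wpM2r ?expR_ge0//.
  rewrite -subr_ge0 -[X in _ - X]mulr1 -mulrBr.
  have [x0|x0] := leP 0 x.
    by rewrite mulr_ge0// subr_ge0 -expR0 ler_expR oppr_ge0 mulr_le0_ge0.
  rewrite mulr_le0 ?(ltW x0)// subr_le0 -expR0 ler_expR oppr_le0.
  by rewrite mulr_le0// ltW.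
rewrite RintegralZl// mean0 mulr0 /Rintegral tilted_integral//.
under eq_integral do rewrite fE.
under eq_integral do rewrite EFinB.
rewrite integralB// ?Xnu; last exact: finite_measure_integrable_cst.
rewrite integral_cst// [X in (_ - _ * X)%E]probability_setT mule1 /= subr_ge0.
by rewrite leNgt nua.
Qed.

Hypothesis X_nonlattice : ~ lattice X.

(** If the modulus [r] were at least 1, with argument [b], the nonnegative function
    [1 - cos (s x - b)] would have integral [1 - r <= 0]. Then [s x - b] would be a multiple of
    [2 pi] almost surely, and [X] would be lattice of span [2 pi / s]. *)
Lemma tilted_cf_lt1 (s : R) : 0 < s -> cf_cos q s ^+ 2 + cf_sin q s ^+ 2 < 1.
Proof.
move=> s0; rewrite ltNge; apply/negP => cf1; apply: X_nonlattice.
set c := cf_cos q s in cf1; set e := cf_sin q s in cf1.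
pose r := Num.sqrt (c ^+ 2 + e ^+ 2).
have r1 : 1 <= r by rewrite -sqrtr1 ler_sqrt// (le_trans _ cf1).
have r0 : 0 < r by rewrite (lt_le_trans _ r1).
have r2 : r ^+ 2 = c ^+ 2 + e ^+ 2 by rewrite sqr_sqrtr// (le_trans _ cf1).
have [b [cosb sinb]] : exists b, cos b = c / r /\ sin b = e / r.
  by apply: exists_angle; rewrite !expr_div_n -mulrDl -r2 divff// expf_neq0// gt_eqF.
have mcos : measurable_fun [set: R] (fun x => cos (s * (x - b / s))).
  apply: (measurableT_comp (@measurable_cosM R s)); exact: measurable_funB.
have : (\int[q]_x (1 - cos (s * (x - b / s)))%:E = 0)%E.
  have i1 : q.-integrable [set: R] (EFin \o (fun x => cos (s * (x - b / s)))).
    by apply: (@integrable_bounded _ _ _ 1) => // x; exact: cos_max.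
  have i2 : q.-integrable [set: R] (EFin \o (fun x => 1 - cos (s * (x - b / s)))).
    apply: integrable_subr => //; apply: (@integrable_bounded _ _ _ 1) => // x.
    by rewrite normr1.
  apply/eqP; rewrite eq_le integral_ge0 ?andbT; last first.
    by move=> x _; rewrite lee_fin subr_ge0 cos_le1.
  rewrite -(fineK (integrable_fin_num _ i2))// lee_fin -/(Rintegral _ _ _).
  rewrite RintegralB//; last by apply: (@integrable_bounded _ _ _ 1) => // x; rewrite normr1.
  rewrite Rintegral_probability_cst cf_cos_shift (mulrCA s) divff ?mulr1 ?gt_eqF//.
  rewrite cosb sinb -/c -/e.
  have -> : c * (c / r) + e * (e / r) = r.
    by rewrite !mulrA -!expr2 -mulrDl -r2 expr2 mulfK// gt_eqF.
  by rewrite subr_le0.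
move=> /tilted_ae_eq0 h.
apply: (@lattice_of_ae _ _ _ _ _ (a + b / s) (pi *+ 2 / s)).
  by rewrite divr_gt0// pmulrn_lgt0// pi_gt0.
apply: filterS (h _ _) => [w /eqP||].
- rewrite subr_eq0 => /eqP /esym /cos_eq1[k hk]; exists k.
  rewrite mulrA -hk mulrAC divff ?gt_eqF// mul1r; ring.
- exact: measurable_funB.
- by move=> x; rewrite subr_ge0 cos_le1.
Qed.

(** A vanishing second moment forces [X = a] almost surely, and constants count as lattice. *)
Lemma tilted_variance_gt0 : q.-integrable [set: R] (EFin \o (fun x => x ^+ 2)) ->
  0 < \int[q]_x (x ^+ 2).
Proof.
move=> i2; rewrite lt_neqAle Rintegral_ge0 ?andbT; last by move=> x _; exact: sqr_ge0.
apply/negP => /eqP h; apply: X_nonlattice.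
apply: (@lattice_of_ae _ _ _ _ _ a 1) => //.
have : (\int[q]_x (x ^+ 2)%:E = 0)%E.
  by rewrite -(fineK (integrable_fin_num _ i2))// -/(Rintegral _ _ _) -h.
move=> /tilted_ae_eq0 h0; apply: filterS (h0 _ _) => [w /eqP||].
- by rewrite sqrf_eq0 subr_eq0 => /eqP ->; exists 0; rewrite mul0r addr0.
- exact: measurable_funX.
- by move=> x; exact: sqr_ge0.
Qed.

End tilted_law.

(** * Sharp asymptotics *)

Section sharp_asymptotics.
Context d (T : measurableType d) (R : realType) (P : probability T R).
Variables (X : nat -> {RV P >-> R}) (nu a theta : R).
Hypotheses (X_iid : iid X) (X_ge0 : {ae P, forall w, 0 <= X 0%N w})
  (X_nonlattice : ~ lattice (X 0%N)) (X_mean : ('E_P[X 0%N] = nu%:E)%E)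
  (a_gt_nu : nu < a)
  (theta_interior : interior [set t : R | ('M_P (X 0%N) t < +oo)%E] theta)
  (theta_attains :
    ((theta * a)%:E - log_mgf (X 0%N) theta)%E = rate_function (X 0%N) a).

Let I := fine (rate_function (X 0%N) a).
Let C := prefactor (X 0%N) theta.
Let M t := fine ('M_P (X 0%N) t).

Let mean_integral : (\int[P]_w (X 0%N w)%:E = nu%:E)%E.
Proof. by rewrite -X_mean expectation_def. Qed.

Let a_gt0 : 0 < a.
Proof.
apply: le_lt_trans a_gt_nu; rewrite -lee_fin -mean_integral.
have <- : (\int[P]_w `|X 0%N w|%:E = \int[P]_w (X 0%N w)%:E)%E.
  apply: ae_eq_integral => //.
  - by apply/measurable_EFinP; exact: measurableT_comp.
  - exact/measurable_EFinP.
  - by apply: filterS X_ge0 => w Xw0 _ /=; rewrite ger0_norm.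
by apply: integral_ge0 => w _; rewrite lee_fin.
Qed.

Let mgfE t : 'M_P (X 0%N) t = (\int[P]_w (expR (t * X 0%N w))%:E)%E.
Proof.
rewrite /mmt_gen_fun unlock; apply: eq_integral => w _ /=.
by rewrite mulrC.
Qed.

Let measurable_exp t : measurable_fun [set: T] (fun w => (expR (t * X 0%N w))%:E).
Proof. by apply/measurable_EFinP; apply: measurableT_comp => //; exact: measurable_funM. Qed.

Let mgf_gt0 t : (0 < 'M_P (X 0%N) t)%E.
Proof.
rewrite mgfE lt_neqAle integral_ge0 ?andbT => [|w _]; last by rewrite lee_fin expR_ge0.
apply/negP => /eqP/esym; set f := fun w => (expR (t * X 0%N w))%:E => M0.
have /(ae_eq_integral_abs P measurableT (measurable_exp t)) : (\int[P]_w `|f w| = 0)%E.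
  by rewrite -[RHS]M0; apply: eq_integral => w _; rewrite gee0_abs// lee_fin expR_ge0.
move=> aeF; have : P [set: T] = 0%E.
  apply: measure_negligible => //; apply: negligibleS aeF => w _ /= /(_ Logic.I) [] /eqP.
  by rewrite gt_eqF ?expR_gt0.
by rewrite probability_setT => -[] /eqP; rewrite oner_eq0.
Qed.

Let mgf_fin t : ('M_P (X 0%N) t < +oo)%E -> 'M_P (X 0%N) t = (M t)%:E /\ 0 < M t.
Proof.
move=> Mt; have M0 := mgf_gt0 t.
have Mfin : 'M_P (X 0%N) t \is a fin_num by rewrite ge0_fin_numE// ltW.
have ME : 'M_P (X 0%N) t = (M t)%:E by rewrite /M fineK.
by split => //; rewrite -lte_fin -ME.
Qed.

Let log_mgf_fin t : ('M_P (X 0%N) t < +oo)%E -> log_mgf (X 0%N) t = (ln (M t))%:E.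
Proof. by move=> /mgf_fin[ME M0]; rewrite /log_mgf ME lne_EFin. Qed.

Let theta_fin : ('M_P (X 0%N) theta < +oo)%E.
Proof. exact: interior_subset theta_interior. Qed.

Let rateE : rate_function (X 0%N) a = I%:E.
Proof. by rewrite /I -theta_attains log_mgf_fin. Qed.

Let IE : I = theta * a - ln (M theta).
Proof. by apply: EFin_inj; rewrite -rateE -theta_attains log_mgf_fin. Qed.

Let I_ge t : ('M_P (X 0%N) t < +oo)%E -> t * a - ln (M t) <= I.
Proof.
move=> Mt; rewrite -lee_fin -rateE EFinB -log_mgf_fin//.
by apply: ereal_sup_ubound; exists t.
Qed.

Let integral_exp h :
  (\int[P]_w (expR (h * (X 0%N w - a) + (theta * (X 0%N w - a) + I)))%:E =
   'M_P (X 0%N) (theta + h) * (expR (I - (theta + h) * a))%:E)%E.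
Proof.
rewrite mgfE muleC -ge0_integralZl//.
apply: eq_integral => w _; rewrite -EFinM -expRD; congr (expR _)%:E; ring.
Qed.

Let theta_mgf : (\int[P]_w (expR (theta * (X 0%N w - a) + I))%:E = 1)%E.
Proof.
have := integral_exp 0; under eq_integral do rewrite mul0r add0r.
move=> ->; rewrite addr0; have [-> M0] := mgf_fin theta_fin.
by rewrite -EFinM IE addrC addKr expRN lnK ?posrE// divff// gt_eqF.
Qed.

(** [B] and the threshold on [m] depend on [e] alone, so [N] may afterwards be tied to [m] in any
    way compatible with [B * m.+1%:R ^+ 2 <= N]. *)
Lemma sharp_asymptotics : 0 < C /\ forall e, 0 < e -> exists B : R,
  \forall m \near \oo, forall N n, 0 < N -> (0 < n)%N -> N * a = n%:R ->
    B * m.+1%:R ^+ 2 <= N ->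
    ((C - e)%:E <=
     (Num.sqrt m.+1%:R * expR (m.+1%:R * I))%:E *
     \int[P]_w poisson_prob (N * sample_mean X m.+1 w) 0 [set k | (n <= k)%N] <=
     (C + e)%:E)%E.
Proof.
have [q [Q [qE Q0 QS QP]]] := exists_tilted_sums X_iid theta_mgf.
have [delta /= delta0 thetaM] := theta_interior.
have Mh h : `|h| < delta -> ('M_P (X 0%N) (theta + h) < +oo)%E.
  by move=> hd; apply: thetaM; rewrite /= opprD addNKr normrN.
have q_exp h : (\int[q]_x (expR (h * x))%:E =
    'M_P (X 0%N) (theta + h) * (expR (I - (theta + h) * a))%:E)%E.
  rewrite -integral_exp qE.
  - by apply: eq_integral => w _; rewrite -EFinM -expRD.
  - by apply/measurable_EFinP; apply: measurableT_comp => //; exact: measurable_funM.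
  - by move=> x; rewrite lee_fin expR_ge0.
have q_int h : `|h| < delta -> q.-integrable [set: R] (EFin \o (fun x => expR (h * x))).
  move=> hd; apply/integrableP; split.
    by apply/measurable_EFinP; apply: measurableT_comp => //; exact: measurable_funM.
  under eq_integral do rewrite /= ger0_norm ?expR_ge0//.
  by rewrite q_exp; have [-> _] := mgf_fin (Mh _ hd); rewrite -EFinM ltry.
have moment0 h : `|h| < delta ->
    exp_moment q 0 h = M (theta + h) * expR (I - (theta + h) * a).
  move=> hd; rewrite /exp_moment /Rintegral.
  under eq_integral do rewrite expr0 mul1r.
  by rewrite q_exp; have [-> _] := mgf_fin (Mh _ hd).
(* This is the optimality of [theta]: the logarithm of the moment is [I] minus the value at
   [theta + h] of the function whose supremum is [I]. *)
have moment1 h : `|h| < delta -> 1 <= exp_moment q 0 h.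
  move=> hd; rewrite moment0//; have [_ M0] := mgf_fin (Mh _ hd).
  rewrite -[X in X * _](lnK M0) -expRD -expR0 ler_expR.
  by have := I_ge (Mh _ hd); lra.
have mean0 := mean_eq0_of_min q_int delta0 moment1.
pose L s := fine (log_mgf (X 0%N) s).
have LE h : `|h| < delta ->
    L (theta + h) = ln (exp_moment q 0 h) + a * h + (theta * a - I).
  move=> hd; rewrite /L (log_mgf_fin (Mh _ hd)) moment0//=.
  have [_ M0] := mgf_fin (Mh _ hd).
  by rewrite lnM ?posrE ?expR_gt0// expRK; ring.
have varE := derive2_cumulant q_int delta0 moment1 LE.
have ipow k := integrable_power q_int delta0 k.
have var0 : 0 < \int[q]_x (x ^+ 2) := tilted_variance_gt0 qE X_nonlattice (ipow 2%N).
pose sigma := Num.sqrt (\int[q]_x (x ^+ 2)).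
have sigma0 : 0 < sigma by rewrite sqrtr_gt0.
have sigmaE : \int[q]_x (x ^+ 2) = sigma ^+ 2 by rewrite sqr_sqrtr// ltW.
have iid1 : q.-integrable [set: R] (EFin \o (fun x : R => x)).
  by have := ipow 1%N; congr (_.-integrable _ _).
have theta0 : 0 < theta := tilt_gt0 qE X_ge0 mean_integral a_gt_nu iid1 mean0.
have cf1 := tilted_cf_lt1 qE X_nonlattice.
have Qcos0 s : cf_cos (Q 0%N) s = 1.
  rewrite Q0 /cf_cos /Rintegral integral_dirac//; last by apply/measurable_EFinP; exact: measurable_cosM.
  by rewrite diracT mul1e mulr0 cos0.
have Qsin0 s : cf_sin (Q 0%N) s = 0.
  rewrite Q0 /cf_sin /Rintegral integral_dirac//; last by apply/measurable_EFinP; exact: measurable_sinM.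
  by rewrite diracT mul1e mulr0 sin0.
have QScos m := cf_cos_convolution (QS m).
have QSsin m := cf_sin_convolution (QS m).
pose ell := (sigma * Num.sqrt (2 * pi))^-1.
have s2pi : 0 < Num.sqrt (2 * pi) :> R by rewrite sqrtr_gt0 mulr_gt0// pi_gt0.
have ell0 : 0 < ell by rewrite invr_gt0 mulr_gt0.
(* The prefactor is the local density [ell] of the tilted sums times the integral [1 / theta] of
   [expR (- (theta * x))] over the half-line. *)
have CE : C = ell / theta.
  rewrite /C /prefactor varE sqrtrM ?mulr_ge0 ?pi_ge0// -/sigma /ell.
  by rewrite mul1r invfM mulrC (mulrC sigma).
have bounded := fejer_bounded sigma0 (ipow 4%N) mean0 sigmaE cf1 Qcos0 Qsin0 QScos QSsin.
have cvg := fejer_cvg sigma0 (ipow 4%N) mean0 sigmaE cf1 Qcos0 Qsin0 QScos QSsin.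
split; first by rewrite CE divr_gt0.
move=> e e0; have [B hB] := poissonized_limit theta0 a_gt0 ell0 bounded cvg e0.
exists B; apply: filterS hB => m hm N n N0 n0 Na BN.
have -> : (\int[P]_w poisson_prob (N * sample_mean X m.+1 w) 0 [set k | (n <= k)%N] =
    \int[P]_w poisson_prob (N * (a + centered_sum X a m.+1 w / m.+1%:R)) 0 [set k | (n <= k)%N])%E.
  apply: eq_integral => w _; congr (poisson_prob (N * _) _ _).
  rewrite /sample_mean /centered_sum sumrB sumr_const_nat subn1 /=.
  by rewrite mulrBl -[a *+ _]mulr_natr mulfK ?pnatr_eq0// subrKC mulrC.
pose f (x : R) := poisson_prob (N * (a + x / m.+1%:R)) 0 [set k | (n <= k)%N].
have mf : measurable_fun [set: R] f.
  apply: (measurableT_comp (measurable_poisson_prob_at _)).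
  by apply: measurable_funM => //; apply: measurable_funD => //; exact: measurable_funM.
have -> : ((Num.sqrt m.+1%:R * expR (m.+1%:R * I))%:E * \int[P]_w f (centered_sum X a m.+1 w) =
    scaled_integral Q m (poissonized theta a m N n))%E.
  have f0 x : (0 <= f x)%E by [].
  rewrite (QP m.+1 f mf f0).
  rewrite EFinM -muleA.
  apply: (congr1 (mule _)).
  rewrite -ge0_integralZl//.
  - apply: eq_integral => x _; rewrite /poissonized muleCA -EFinM -expRD muleC.
    by congr ((expR _)%:E * _)%E; ring.
  - apply: emeasurable_funM => //; apply/measurable_EFinP; apply: measurableT_comp => //.
    by apply: measurable_funB => //; apply: measurableT_comp => //; exact: measurable_funM.
  - by move=> x _; rewrite mule_ge0// lee_fin expR_ge0.
by rewrite CE; exact: hm.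
Qed.

End sharp_asymptotics.

(** * From the number of summands back to [N] *)

Lemma powR_near_ge (R : realType) (p K : R) : 0 < p ->
  \forall x \near +oo, K <= x `^ p.
Proof.
move=> p0; have K0 : 0 <= `|K| `^ p^-1 by exact: powR_ge0.
near=> x; have Kx : `|K| `^ p^-1 <= x by near: x; exact: nbhs_pinfty_ge.
rewrite (le_trans (ler_norm K))// -[leLHS]powRr1// -(mulVf (lt0r_neq0 p0)) powRrM.
by apply: ge0_ler_powR; rewrite ?ltW// nnegrE// (le_trans K0).
Unshelve. all: by end_near. Qed.

Unset Implicit Arguments.
Set Printing Implicit Defensive.

Theorem proposition2p2 (d : measure_display) (T : measurableType d)
  (R : realType) (P : probability T R)
  (X : nat -> {RV P >-> R}) (nu a theta alpha : R)
  (Z : R -> {RV P >-> nat})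
  (X_iid : iid X)
  (X_ge0 : forall i, {ae P, forall w, 0 <= X i w})
  (X_nonlattice : ~ lattice (X 0%N))
  (X_mean : ('E_P[X 0%N] = nu%:E)%E)
  (X_mgf : exists U : set R, [/\ open U, U 0 &
             forall t, U t -> ('M_P (X 0%N) t < +oo)%E])
  (a_gt_nu : nu < a)
  (theta_interior :
     interior [set t : R | ('M_P (X 0%N) t < +oo)%E] theta)
  (theta_attains :
     ((theta * a)%:E - log_mgf (X 0%N) theta)%E = rate_function (X 0%N) a)
  (a_lt_bplus : (a%:E < ess_supremum (X 0%N))%E)
  (alpha_gt0 : 0 < alpha)
  (Z_mixed : forall (N : R) (m : nat), admissible a alpha N ->
     N `^ alpha = m%:R ->
     mixed_poisson (fun w => N * sample_mean X m w) (Z N)) :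
  let PN := fun N : R => fine (P [set w | N * a <= (Z N w)%:R]) in
  let I := fine (rate_function (X 0%N) a) in
  let C := prefactor (X 0%N) theta in
  (alpha < 1 / 3 ->
     asymp_equiv (to_infinity a alpha) PN
       (fun N => expR (- (N `^ alpha) * I) * (C / N `^ (alpha / 2)))) /\
  (1 / 3 <= alpha < 1 / 2 ->
     (C%:E <= limf_einf
        (fun N => (PN N * expR (N `^ alpha * I) * N `^ (alpha / 2))%:E)
        (to_infinity a alpha))%E).
Proof.
move=> PN I C.
have [C0 sharp] := sharp_asymptotics X_iid (X_ge0 0%N) X_nonlattice X_mean a_gt_nu
  theta_interior theta_attains.
pose G N := PN N * expR (N `^ alpha * I) * N `^ (alpha / 2).
(* For [m = N^alpha] the condition [B m^2 <= N] reads [B <= N^(1 - 2 alpha)], which holds eventually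
   because the exponent is positive. *)
have G_cvg e : 0 < e -> alpha < 1 / 2 ->
    \forall N \near to_infinity a alpha, C - e <= G N <= C + e.
  move=> e0 alpha2.
  have [B [m0 _ Bm]] := sharp e e0.
  have near1 := @powR_near_ge R alpha m0.+1%:R alpha_gt0.
  have near2 : \forall N \near +oo, B <= N `^ (1 - 2 * alpha).
    by apply: powR_near_ge; lra.
  rewrite near_withinE; near=> N => admN.
  have [N0 Na0 /natrP[n nE] /natrP[m mE]] := admN.
  have m0m : (m0 < m)%N.
    by rewrite -(ler_nat R) -mE; near: N.
  (* The estimate is indexed by the predecessor of the number of summands. *)
  have [m' m'E] : exists m', m = m'.+1 by case: (m) m0m => // k _; exists k.
  have m0m' : (m0 <= m')%N by rewrite m'E in m0m.
  have BN : B * m%:R ^+ 2 <= N.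
    have BN2 : B <= N `^ (1 - 2 * alpha) by near: N.
    rewrite -mE -powR_mulrn ?powR_ge0// -powRrM.
    apply: (le_trans (ler_wpM2r (powR_ge0 _ _) BN2)).
    rewrite -powRD; last by rewrite (gt_eqF N0) implybT.
    have -> : 1 - 2 * alpha + alpha * 2 = 1 by ring.
    by rewrite powRr1// ltW.
  have n0 : (0 < n)%N by rewrite -(ltr_nat R) -nE.
  rewrite m'E in mE BN.
  have := Bm m' m0m' N n N0 n0 nE BN.
  have PE : (P [set w | (N * a <= (Z N w)%:R)%R] =
      \int[P]_w poisson_prob (N * sample_mean X m'.+1 w) 0 [set k | (n <= k)%N])%E.
    have := Z_mixed N m'.+1 admN mE setT [set k | (n <= k)%N] measurableT.
    rewrite preimage_setT setTI => <-; congr (P _).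
    by apply/seteqP; split => w /=; rewrite nE ler_nat.
  have mE' : measurable [set w | N * a <= (Z N w)%:R].
    have -> : [set w | N * a <= (Z N w)%:R] = Z N @^-1` [set k | (n <= k)%N].
      by apply/seteqP; split => w /=; rewrite nE ler_nat.
    exact: measurable_funPTI.
  rewrite -PE -(fineK (fin_num_measure P _ mE')).
  rewrite -EFinM !lee_fin -/(PN N).
  suff -> : Num.sqrt m'.+1%:R * expR (m'.+1%:R * I) * PN N = G N by [].
  rewrite /G mE -powR12_sqrt// -mE -powRrM.
  by rewrite [RHS]mulrC mulrA mulrAC.
have limG e : 0 < e -> alpha < 1 / 2 -> \forall N \near to_infinity a alpha, `|C - G N| <= e.
  move=> e0 alpha2; apply: filterS (G_cvg e e0 alpha2) => N /andP[? ?].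
  by rewrite ler_norml; lra.
split.
- move=> alpha3; have alpha2 : alpha < 1 / 2 by lra.
  apply/cvgrPdist_le => e e0.
  have posN : \forall N \near to_infinity a alpha, 0 < N by rewrite near_withinE; near=> N => -[].
  (* The ratio to be controlled is [G N / C], so an absolute error [e * C] on [G N] is the right
     precision. *)
  have := limG (e * C) (mulr_gt0 e0 C0) alpha2.
  apply: filterS2 posN => N N0 GN.
  have -> : PN N / (expR (- N `^ alpha * I) * (C / N `^ (alpha / 2))) = G N / C.
    rewrite /G mulNr expRN; have := expR_gt0 (N `^ alpha * I); have := powR_gt0 (alpha / 2) N0.
    move: (expR _) (N `^ (alpha / 2)) (PN N) => x y z y0 x0.
    by field; rewrite !gt_eqF.
  rewrite -(ler_pM2r C0) -[X in _ * X <= _](gtr0_norm C0) -normrM mulrBl mul1r divfK//.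
  by rewrite gt_eqF.
- move=> /andP[_ alpha2]; rewrite limf_einfE.
  apply/lee_subgt0Pr => e e0.
  (* [A] belongs to the filter, so the infimum of [G] over it is one of the values whose supremum is
     the lower limit. *)
  pose A := [set N | C - e <= G N <= C + e].
  apply: (@le_trans _ _ (ereal_inf [set (G N)%:E | N in A])).
    by apply/ereal_infP => _ [N /andP[CG _] <-]; rewrite lee_fin.
  by apply: ereal_sup_ubound; exists A => //; exact: G_cvg.
Unshelve. all: by end_near.
Qed.
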